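(* Let $M$ be a closed surface endowed with an area form $\omega$, and let $\zeta$ be a simple quasi-state on $M$. Then for any $F,G\in C^\infty(M)$, $$|\zeta(F+G)-\zeta(F)-\zeta(G)|^2\ \le\ \mathrm{area}(M)\,\|\{F,G\}\|,$$ where $\mathrm{area}(M)=\int_M\omega$, $\{\cdot,\cdot\}$ is the Poisson bracket defined by $\omega$, and $\|\cdot\|$ is the supremum norm.
   Context: A closed surface is a compact smooth two-dimensional manifold without boundary, oriented by the area form $\omega$. The Poisson bracket of $F,G\in C^\infty(M)$ is the function $\{F,G\}$ determined by $-dF\wedge dG=\{F,G\}\,\omega$. For a compact Hausdorff space $X$, $C(X)$ is the algebra of real-valued continuous functions on $X$, and for $F\in C(X)$, $C(F)=\{\varphi\circ F \mid \varphi\in C(F(X))\}$. A quasi-state on $X$ is a (not necessarily linear) functional $\zeta: C(X)\to\mathbb{R}$ such that (i) $\zeta(F)\ge 0$ whenever $F\ge 0$; (ii) $\zeta$ is linear on $C(F)$ for every $F\in C(X)$; (iii) $\zeta(1)=1$. A quasi-state is simple if it is multiplicative on $C(F)$ for every $F\in C(X)$. *)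

(* Defs.v *)
From HB Require Import structures.
From mathcomp Require Import all_boot all_order all_algebra.
From mathcomp Require Import all_classical all_reals all_analysis.
Set Implicit Arguments.
Unset Strict Implicit.
Unset Printing Implicit Defensive.
Import Order.TTheory GRing.Theory Num.Theory.
Import numFieldNormedType.Exports.
Local Open Scope classical_set_scope.
Local Open Scope ring_scope.

Section Plane.
Context {R : realType}.
Implicit Types (U : set (R * R)) (f g : R * R -> R).

Definition dx f (p : R * R) : R := 'D_(1, 0) f p.
Definition dy f (p : R * R) : R := 'D_(0, 1) f p.

(* The coefficient of df /\ dg with respect to dx /\ dy. *)
Definition jacobian f g (p : R * R) : R :=
  dx f p * dy g p - dy f p * dx g p.

(* C^k on an open set [U]; the values of [f] outside [U] are irrelevant. *)
Fixpoint Ck_on (k : nat) U f : Prop :=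
  {in U, continuous f} /\
  (if k is k'.+1 then
     [/\ forall p, U p -> derivable f p (1, 0) /\ derivable f p (0, 1),
         Ck_on k' U (dx f) & Ck_on k' U (dy f)]
   else True).

Definition smooth_on U f : Prop := forall k, Ck_on k U f.

Definition lebesgue2 : {measure set (measurableTypeR R * measurableTypeR R) -> \bar R} :=
  (@lebesgue_measure R \x @lebesgue_measure R)%E.

End Plane.

(* A smooth atlas of charts with values in the plane. [param i] is the inverse
   of the homeomorphism [coord i] from [dom i] onto an open subset of the
   plane; only the restrictions of [coord i] to [dom i] and of [param i] to
   its image are meaningful. *)
Record smooth_surface (R : realType) (M : topologicalType) := SmoothSurface {
  chart : Type;
  dom : chart -> set M;
  coord : chart -> M -> R * R;
  param : chart -> R * R -> M;
  dom_open : forall i, open (dom i);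
  coord_dom_open : forall i, open (coord i @` dom i);
  coordK : forall i, {in dom i, cancel (coord i) (param i)};
  coord_continuous : forall i, {in dom i, continuous (coord i)};
  param_continuous : forall i, {in coord i @` dom i, continuous (param i)};
  dom_cover : \bigcup_i dom i = [set: M];
  transition_smooth : forall i j,
    let U := coord i @` (dom i `&` dom j) in
    smooth_on U (fst \o coord j \o param i) /\
    smooth_on U (snd \o coord j \o param i)
}.

Definition closed_surface (R : realType) (M : topologicalType)
    (S : smooth_surface R M) : Prop :=
  compact [set: M] /\ hausdorff_space M.

Definition smooth (R : realType) (M : topologicalType)
    (S : smooth_surface R M) (F : M -> R) : Prop :=
  forall i : chart S, smooth_on (coord i @` dom i) (F \o param i).

(* A nowhere vanishing smooth 2-form, equal to [density i] dx /\ dy in the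
   chart [i]. Charts are not assumed to be compatible with the orientation
   given by the form, so [density i] may be negative. *)
Record area_form (R : realType) (M : topologicalType)
    (S : smooth_surface R M) := AreaForm {
  density : chart S -> R * R -> R;
  density_smooth : forall i, smooth_on (coord i @` dom i) (density i);
  density_neq0 : forall i p, (coord i @` dom i) p -> density i p != 0;
  density_transition : forall i j p, (coord i @` (dom i `&` dom j)) p ->
    let T := coord j \o param i in
    density i p = density j (T p) * jacobian (fst \o T) (snd \o T) p
}.

Section AreaForm.
Context {R : realType} {M : topologicalType} {S : smooth_surface R M}.
Variable w : area_form S.

(* The value at [x] of the function determined by
   - dF /\ dG = {F, G} w, this equation being read in every chart around [x];
   its two sides transform in the same way when F and G are smooth. *)
Definition poisson_bracket (F G : M -> R) (x : M) : R :=
  get [set b : R | forall i : chart S, dom i x ->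
    - jacobian (F \o param i) (G \o param i) (coord i x)
      = b * density w i (coord i x)].

(* A finite partition of [M] into Borel sets, each inside the domain of a
   chart. *)
Definition chart_partition (n : nat) (c : 'I_n -> chart S)
    (B : 'I_n -> set M) : Prop :=
  [/\ forall k, B k `<=` dom (c k),
      forall k, measurable
        (coord (c k) @` B k : set (measurableTypeR R * measurableTypeR R)),
      trivIset [set: 'I_n] B
    & \bigcup_k B k = [set: M]].

(* The integral of [w] over [M], oriented by [w] itself (whence the absolute
   value). On a closed surface chart partitions exist, and by the change of
   variables formula they all give the same finite value, so the supremum
   only serves to name this common value. *)
Definition area : \bar R :=
  ereal_sup [set a | exists n (c : 'I_n -> chart S) (B : 'I_n -> set M),
    chart_partition c B /\
    a = (\sum_(k < n)
           \int[lebesgue2]_(p in coord (c k) @` B k)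
             `|density w (c k) p|%:E)%E].

End AreaForm.

Definition sup_norm (R : realType) (M : Type) (H : M -> R) : \bar R :=
  ereal_sup [set `|H x|%:E | x in [set: M]].

Section QuasiState.
Context {R : realType} {X : topologicalType}.
Implicit Types F H K : X -> R.

(* The algebra C(F) of the compositions of F with the continuous functions on
   the image of F. *)
Definition generated_algebra F : set (X -> R) :=
  [set H | exists2 phi : R -> R,
     {within range F, continuous phi} & H = phi \o F].

(* Functionals on C(X) are represented by functions on all of [X -> R]; only
   their values at continuous functions matter. *)
Definition quasi_state (zeta : (X -> R) -> R) : Prop :=
  [/\ forall F, continuous F -> (forall x, 0 <= F x) -> 0 <= zeta F,
      forall F, continuous F -> forall (a b : R) H K,
        generated_algebra F H -> generated_algebra F K ->
        zeta (fun x => a * H x + b * K x) = a * zeta H + b * zeta K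
    & zeta (fun=> 1) = 1].

Definition simple_quasi_state (zeta : (X -> R) -> R) : Prop :=
  quasi_state zeta /\
  forall F, continuous F -> forall H K,
    generated_algebra F H -> generated_algebra F K ->
    zeta (fun x => H x * K x) = zeta H * zeta K.

End QuasiState.

(* Main.v *)
(** Put [Phi = (F, G) : M -> R^2], [a = zeta F], [b = zeta G], [c = zeta (F + G)].
    Let [v] be a point of the open triangle bounded by the lines [x = a],
    [y = b] and [x + y = c]. Up to a common sign, the functions [F - v.1],
    [G - v.2] and [v.1 + v.2 - (F + G)] add up to 0 and have positive values
    under [zeta]. As [zeta] is multiplicative on the algebras C(F), it behaves
    like a measure with values in {0, 1} on zero sets, and this forces the
    three functions to have a common zero: [v] is in the image of [Phi].

    On the other hand a point of [M] which is the only one with its value under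
    [Phi] is critical: otherwise the form rho(F, G) dF /\ dG, where rho is a bump
    function at this value, would be exact, of constant sign and nonzero.
    Hence, apart from critical values, [Phi] takes every value in the triangle
    at least twice, and the area formula gives
      [2 * |a + b - c|^2 / 2 <= \int_M |{F, G}| w <= area(M) * ||{F, G}||].
    The area formula is only needed as an inequality. Bisecting the charts into
    squares that are small enough for [Phi] to be almost affine on them, one
    bounds the multiplicity function of [Phi] from above by functions whose
    integrals are under control; critical points cost arbitrarily little, so
    that Sard's theorem is not needed. *)
Require Import Defs.
From HB Require Import structures.
From mathcomp Require Import all_boot all_order all_algebra.
From mathcomp Require Import all_classical all_reals all_analysis.
From mathcomp Require Import measurable_realfun ring lra.
Import Order.TTheory GRing.Theory Num.Theory.
Import numFieldNormedType.Exports.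
Local Open Scope classical_set_scope.
Local Open Scope ring_scope.
Set Implicit Arguments.
Unset Strict Implicit.
Unset Printing Implicit Defensive.
(* These two names are also used for other notions in the libraries. *)
Local Notation jacobian := Defs.jacobian.
Local Notation coord := Defs.coord.

(** Integration over [M] is available only through integrals over squares in charts, and two facts
    about it are needed: independence of the chart, and the area inequality for [Phi]. Both come
    from [image_cover]. Applied to a transition map in both directions, it gives the change of
    variables formula as two opposite inequalities; applied to [Phi], it bounds the multiplicity. A
    majorant built at a fixed mesh sees two preimages in one chart only if they are far enough
    apart, so a sequence of majorants with separation [1 / (m + 1)] is taken and Fatou's lemma
    passes to the limit. A value with a single preimage is then counted twice as well, because
    critical points receive a second majorant of small integral. Since [area] is a supremum, one
    chart partition is enough to bound it from below. As for regularity, in [dF /\ dG = - d(G dF)]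
    only [F] is differentiated twice. The other function may therefore be multiplied by cut-offs
    that are merely C^1, such as squares of positive parts. *)

Lemma cvg_maxr (R : realType) (X : Type) (F : set_system X) (FF : Filter F)
    (f g : X -> R) (a b : R) :
  f @ F --> a -> g @ F --> b -> (fun x => Num.max (f x) (g x)) @ F --> Num.max a b.
Proof.
move=> fa gb; under eq_fun do rewrite maxr_absE.
rewrite maxr_absE; apply: cvgM; last exact: cvg_cst.
by apply: cvgD; [exact: cvgD|apply: cvg_norm; exact: cvgB].
Qed.

Lemma compact_pos_lower_bound (R : realType) (X : topologicalType) (K : X -> R) :
  compact [set: X] -> continuous K -> (forall x, 0 < K x) ->
  exists2 e, 0 < e & forall x, e <= K x.
Proof.
move=> cX cK K0; have [[x0]|X0] := pselect (exists x : X, True); last first.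
  by exists 1 => // x; exfalso; apply: X0; exists x.
have [||c _ cmin] := @compact_EVT_min X R K setT _ cX.
- by exists x0.
- exact: continuous_subspaceT.
by exists (K c) => // x; apply: cmin; rewrite inE.
Qed.

(** * Simple quasi-states and zero sets *)

Section SimpleQuasiState.
Context {R : realType} {X : topologicalType}.
Variable zeta : (X -> R) -> R.
Hypothesis cX : compact [set: X].
Hypothesis hz : simple_quasi_state zeta.
Implicit Types F H K : X -> R.

Let zpos F : continuous F -> (forall x, 0 <= F x) -> 0 <= zeta F.
Proof. by case: hz => -[h _ _ _]; exact: h. Qed.

Let z1 : zeta (fun=> 1) = 1.
Proof. by case: hz => -[]. Qed.

Let alg F (phi : R -> R) : continuous phi -> generated_algebra F (phi \o F).
Proof. by move=> cphi; exists phi => //; exact: continuous_subspaceT. Qed.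

Let zlin F (a b : R) (phi psi : R -> R) : continuous F -> continuous phi ->
  continuous psi ->
  zeta (fun x => a * phi (F x) + b * psi (F x)) =
  a * zeta (phi \o F) + b * zeta (psi \o F).
Proof.
by move=> cF c1 c2; case: hz => -[_ h _ _]; apply: (h F cF); exact: alg.
Qed.

Let zmul F (phi psi : R -> R) : continuous F -> continuous phi ->
  continuous psi ->
  zeta (fun x => phi (F x) * psi (F x)) = zeta (phi \o F) * zeta (psi \o F).
Proof.
by move=> cF c1 c2; case: hz => _ h; apply: (h F cF); exact: alg.
Qed.

Let c_aff (F : R -> R) (a b : R) : continuous F ->
  continuous (fun x => a * F x + b).
Proof.
move=> cF x; apply: cvgD; last exact: cvg_cst.
by apply: cvgM; [exact: cvg_cst|exact: cF].
Qed.

Lemma zeta_affine F (a b : R) : continuous F ->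
  zeta (fun x => a * F x + b) = a * zeta F + b.
Proof.
move=> cF; have c1 : continuous (fun _ : R => 1 : R) by exact: cst_continuous.
have ci : continuous (@id R) by move=> ?; exact: cvg_id.
have := zlin a b cF ci c1.
have -> : (fun=> 1) \o F = (fun=> 1) by [].
rewrite z1 mulr1 => <-; congr zeta; apply/funext => x /=; ring.
Qed.

(** Zero variance: by multiplicativity on C(F), the left-hand side is the square of
    [zeta (phi \o F) - y]. *)
Let zsqr F (phi : R -> R) y : continuous F -> continuous phi ->
  zeta (phi \o F) = y -> zeta (fun x => (phi (F x) - y) ^+ 2) = 0.
Proof.
move=> cF cphi zy.
have cp : continuous (fun t => 1 * phi t + - y) by exact: c_aff.
rewrite (_ : (fun _ => _) = fun x => (1 * phi (F x) + - y) * (1 * phi (F x) + - y)); last first.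
  by apply/funext => x; rewrite mul1r expr2.
rewrite (zmul cF cp cp) /=.
rewrite (_ : _ \o F = fun x => 1 * (phi \o F) x + - y) // zeta_affine; last first.
  by move=> x; apply: continuous_comp; [exact: cF|exact: cphi].
by rewrite zy mul1r subrr mulr0.
Qed.

(* [zeta] restricted to C(F) is evaluation at a point: otherwise the sum of
   squares below would be bounded away from 0, while [zeta] kills it. *)
Lemma zeta_comp F (phi : R -> R) : continuous F -> continuous phi ->
  zeta (phi \o F) = phi (zeta F).
Proof.
move=> cF cphi; set y := zeta _; set z := zeta F.
pose p1 t := (phi t - y) ^+ 2; pose p2 (t : R) := (t - z) ^+ 2.
have cp1 : continuous p1.
  by move=> t; apply: cvgM; apply: cvgB; [exact: cphi|exact: cvg_cst|exact: cphi|exact: cvg_cst].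
have cp2 : continuous p2.
  by move=> t; apply: cvgM; apply: cvgB; [exact: cvg_id|exact: cvg_cst|exact: cvg_id|exact: cvg_cst].
have zp1 : zeta (p1 \o F) = 0 by exact: zsqr.
have zp2 : zeta (p2 \o F) = 0.
  by apply: (@zsqr F id) => // ?; exact: cvg_id.
pose K x := 1 * p1 (F x) + 1 * p2 (F x).
have zK : zeta K = 0 by rewrite /K zlin// zp1 zp2 !mulr0 addr0.
have cK : continuous K.
  move=> x; apply: cvgD; (apply: cvgM; first exact: cvg_cst).
    by apply: continuous_comp; [exact: cF|exact: cp1].
  by apply: continuous_comp; [exact: cF|exact: cp2].
have [[x Kx]|noK] := pselect (exists x, K x = 0).
  have p10 : 0 <= p1 (F x) by exact: sqr_ge0.
  have p20 : 0 <= p2 (F x) by exact: sqr_ge0.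
  have : p1 (F x) = 0 by move: Kx; rewrite /K; lra.
  have : p2 (F x) = 0 by move: Kx; rewrite /K; lra.
  move=> /eqP; rewrite sqrf_eq0 subr_eq0 => /eqP <-.
  by move=> /eqP; rewrite sqrf_eq0 subr_eq0 => /eqP.
have [|e e0 eK] := compact_pos_lower_bound cX cK.
  move=> x; have K0 : 0 <= K x by rewrite /K !mul1r addr_ge0// sqr_ge0.
  by rewrite lt_neqAle K0 andbT eq_sym; apply/eqP => Kx; apply: noK; exists x.
have := @zpos (fun x => 1 * K x + - e).
rewrite zeta_affine// zK => /(_ _ _)/wrap[].
- by move=> x; apply: cvgD; [apply: cvgM; [exact: cvg_cst|exact: cK]|exact: cvg_cst].
- by move=> x; move: (eK x); lra.
by lra.
Qed.

Let c_pos : continuous (fun t : R => Num.max 0 t).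
Proof. by move=> t; apply: cvg_maxr; [exact: cvg_cst|exact: cvg_id]. Qed.

Let c_neg : continuous (fun t : R => Num.max 0 (- t)).
Proof.
by move=> t; apply: cvg_maxr; [exact: cvg_cst|apply: cvgN; exact: cvg_id].
Qed.

(* f and g are the positive and negative parts of [f - g]. *)
Lemma zeta_disjoint F H : continuous F -> continuous H ->
  (forall x, 0 <= F x) -> (forall x, 0 <= H x) -> (forall x, F x * H x = 0) ->
  exists t, [/\ zeta F = Num.max 0 t, zeta H = Num.max 0 (- t) &
    zeta (fun x => F x + H x) = `|t|].
Proof.
move=> cF cH F0 H0 FH.
pose D x := F x - H x.
have cD : continuous D by move=> x; apply: cvgB; [exact: cF|exact: cH].
have FH0 x : F x = 0 \/ H x = 0.
  by have /eqP := FH x; rewrite mulf_eq0 => /orP[]/eqP; [left|right].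
exists (zeta D); split.
- rewrite -(@zeta_comp D (fun t => Num.max 0 t))//; congr zeta; apply/funext => x /=.
  rewrite /D; have [->|->] := FH0 x; last by rewrite subr0 max_r.
  by rewrite max_l// sub0r oppr_le0.
- rewrite -(@zeta_comp D (fun t => Num.max 0 (- t)))//; congr zeta; apply/funext => x /=.
  rewrite /D opprB; have [->|->] := FH0 x; first by rewrite subr0 max_r.
  by rewrite max_l// sub0r oppr_le0.
- rewrite -(@zeta_comp D (fun t => `|t|))//; last exact: norm_continuous.
  congr zeta; apply/funext => x /=.
  rewrite /D; have [->|->] := FH0 x; first by rewrite sub0r add0r normrN ger0_norm.
  by rewrite subr0 addr0 ger0_norm.
Qed.

Let c_trunc (d : R) H : continuous H -> continuous (fun x => Num.max 0 (H x - d)).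
Proof.
move=> cH x; apply: cvg_maxr; first exact: cvg_cst.
by apply: cvgB; [exact: cH|exact: cvg_cst].
Qed.

(** Whether [zeta] kills a nonnegative function depends only on its zero set. Where [H > d],
    compactness keeps [F] above some [e > 0], so the truncation of [H] at level [d] and the function
    [max 0 (1 - F / e)] are never nonzero together. As [zeta] is 1 on the latter it is 0 on the
    former, whence [zeta H <= d]. *)
Lemma zeta_zero_set F H : continuous F -> continuous H ->
  (forall x, 0 <= F x) -> (forall x, 0 <= H x) ->
  (forall x, F x = 0 -> H x = 0) -> zeta F = 0 -> zeta H = 0.
Proof.
move=> cF cH F0 H0 FH zF.
suff zH d : 0 < d -> zeta H <= d.
  apply/eqP; rewrite eq_le zpos// andbT; apply/ler_addgt0Pl => e e0.
  by rewrite addr0 zH.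
move=> d0.
pose Hd x := Num.max 0 (H x - d).
have cHd : continuous Hd by exact: c_trunc.
have [|||e e0 eK] := @compact_pos_lower_bound R X (fun x => F x + Num.max 0 (d - H x)).
- exact: cX.
- move=> x; apply: cvgD; first exact: cF.
  apply: cvg_maxr; first exact: cvg_cst.
  by apply: cvgB; [exact: cvg_cst|exact: cH].
- move=> x; have [Fx|Fx] := eqVneq (F x) 0; last first.
    by rewrite ltr_wpDr ?le_max ?lexx// lt_neqAle eq_sym Fx F0.
  by rewrite Fx add0r FH// subr0 lt_max d0 orbT.
pose F1 x := Num.max 0 (1 + - e^-1 * F x).
have cF1 : continuous F1.
  move=> x; apply: cvg_maxr; first exact: cvg_cst.
  apply: cvgD; first exact: cvg_cst.
  by apply: cvgM; [exact: cvg_cst|exact: cF].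
have zF1 : zeta F1 = 1.
  rewrite (@zeta_comp F (fun t => Num.max 0 (1 + - e^-1 * t)))//; last first.
    move=> x; apply: cvg_maxr; first exact: cvg_cst.
    apply: cvgD; first exact: cvg_cst.
    by apply: cvgM; [exact: cvg_cst|exact: cvg_id].
  by rewrite zF mulr0 addr0 max_r.
have [|||t [zHd zF1' _]] := @zeta_disjoint Hd F1 cHd cF1 _ _ _.
- by move=> x; rewrite le_max lexx.
- by move=> x; rewrite le_max lexx.
- move=> x; have [Hxd|dHx] := leP (H x) d.
    by rewrite /Hd max_l ?mul0r// subr_le0.
  have := eK x; rewrite max_l ?subr_le0 ?(ltW dHx)// addr0 => eF.
  rewrite /F1 max_l ?mulr0// mulNr subr_le0.
  by rewrite -(mulVf (lt0r_neq0 e0)) ler_pM2l// invr_gt0.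
have t1 : t = -1.
  by move: zF1'; rewrite zF1; case: (leP 0 (- t)); lra.
have : zeta Hd = Num.max 0 (zeta H - d).
  rewrite -(@zeta_comp H (fun s => Num.max 0 (s - d)))//.
  move=> s; apply: cvg_maxr; first exact: cvg_cst.
  by apply: cvgB; [exact: cvg_id|exact: cvg_cst].
rewrite zHd t1 max_l; last by lra.
by case: (leP 0 (zeta H - d)); lra.
Qed.

(** If the zero sets did not meet, [u = F / (F + H)] and [1 - u] would vanish where [F],
    respectively [H], does. Then [zeta] would kill both, although they add up to 1. *)
Lemma zeta_disjoint_zero_sets F H : continuous F -> continuous H ->
  (forall x, 0 <= F x) -> (forall x, 0 <= H x) ->
  zeta F = 0 -> zeta H = 0 -> exists x, F x + H x = 0.
Proof.
move=> cF cH F0 H0 zF zH.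
have [//|noFH] := pselect (exists x, F x + H x = 0).
have FHn x : F x + H x != 0 by apply/eqP => FHx; apply: noFH; exists x.
have FHp x : 0 < F x + H x by rewrite lt_neqAle eq_sym FHn addr_ge0.
pose u x := F x / (F x + H x).
have cu : continuous u.
  move=> x; apply: cvgM; first exact: cF.
  by apply: cvgV => //; apply: cvgD; [exact: cF|exact: cH].
have zu : zeta u = 0.
  apply: (@zeta_zero_set F) => // x; first by rewrite divr_ge0// ltW.
  by rewrite /u => ->; rewrite mul0r.
have : zeta (fun x => - 1 * u x + 1) = 0.
  apply: (@zeta_zero_set H) => //.
  - move=> x; apply: cvgD; last exact: cvg_cst.
    by apply: cvgM; [exact: cvg_cst|exact: cu].
  - move=> x; rewrite addrC mulN1r subr_ge0 /u ler_pdivrMr// mul1r.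
    by move: (H0 x); lra.
  - move=> x Hx; have := FHn x; rewrite /u Hx addr0 => Fx.
    by rewrite divff// mulr1 addNr.
by rewrite zeta_affine// zu mulr0 add0r => /eqP; rewrite oner_eq0.
Qed.

(* A zero set splitting into two disjoint closed pieces: one of them carries
   [zeta], because [u (1 - u)] is killed by [zeta] and [zeta] is
   multiplicative on C(u). *)
Lemma zeta_zero_set_split F H : continuous F -> continuous H ->
  (forall x, 0 <= F x) -> (forall x, 0 <= H x) ->
  (forall x, 0 < F x + H x) -> zeta (fun x => F x * H x) = 0 ->
  zeta F = 0 \/ zeta H = 0.
Proof.
move=> cF cH F0 H0 FHp zFH.
pose u x := F x / (F x + H x).
have cu : continuous u.
  move=> x; apply: cvgM; first exact: cF.
  by apply: cvgV; [rewrite gt_eqF|apply: cvgD; [exact: cF|exact: cH]].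
have u01 x : 0 <= u x <= 1.
  rewrite /u divr_ge0 ?(ltW (FHp _))//= ler_pdivrMr// mul1r.
  by move: (H0 x); lra.
have cq : continuous (fun t : R => t * (1 - t)).
  by move=> t; apply: cvgM; [exact: cvg_id|apply: cvgB; [exact: cvg_cst|exact: cvg_id]].
have : zeta ((fun t => t * (1 - t)) \o u) = 0.
  apply: (@zeta_zero_set (fun x => F x * H x)) => //.
  - by move=> x; apply: cvgM; [exact: cF|exact: cH].
  - by move=> x; apply: continuous_comp; [exact: cu|exact: cq].
  - by move=> x; rewrite mulr_ge0.
  - by move=> x /=; rewrite mulr_ge0 ?subr_ge0//; case/andP: (u01 x).
  - move=> x /eqP; rewrite mulf_eq0 /= => /orP[]/eqP.
      by rewrite /u => ->; rewrite !mul0r.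
    move=> Hx; rewrite /u Hx addr0 divff ?subrr ?mulr0//.
    by have := FHp x; rewrite Hx addr0 => /gt_eqF ->.
rewrite (@zeta_comp u (fun t => t * (1 - t)))// => /eqP.
rewrite mulf_eq0 subr_eq0 => /orP[/eqP zu|/eqP zu].
  left; apply: (@zeta_zero_set u) => //.
    by move=> x; case/andP: (u01 x).
  move=> x /eqP; rewrite mulf_eq0 invr_eq0 => /orP[/eqP//|].
  by rewrite gt_eqF.
right; apply: (@zeta_zero_set (fun x => - 1 * u x + 1)) => //.
- move=> x; apply: cvgD; last exact: cvg_cst.
  by apply: cvgM; [exact: cvg_cst|exact: cu].
- by move=> x; rewrite addrC mulN1r subr_ge0; case/andP: (u01 x).
- move=> x; rewrite addrC mulN1r => /eqP; rewrite subr_eq0 eq_sym => /eqP.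
  move=> /(congr1 (fun t => t * (F x + H x))).
  by rewrite /u mulfVK ?gt_eqF// mul1r; lra.
- by rewrite zeta_affine// -zu; lra.
Qed.

(** Let A, B, C be the zero sets of [f], [g], [h]; they cover [X]. As [f] and [g * h] are never
    nonzero together, [zeta] kills their sum, whose zero set is the part of A lying in B or C.
    Without a common point of the three, A meets B and C in disjoint closed sets, so one of these
    intersections, say that with B, already carries [zeta]; but then it must meet C. *)
Lemma zeta_triple (f g h : X -> R) :
  continuous f -> continuous g -> continuous h ->
  (forall x, 0 <= f x) -> (forall x, 0 <= g x) -> (forall x, 0 <= h x) ->
  zeta f = 0 -> zeta g = 0 -> zeta h = 0 ->
  (forall x, f x * g x * h x = 0) -> exists x, f x + g x + h x = 0.
Proof.
move=> cf cg ch f0 g0 h0 zf zg zh fgh.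
have [//|nofgh] := pselect (exists x, f x + g x + h x = 0).
have cgh : continuous (fun x => g x * h x).
  by move=> x; apply: cvgM; [exact: cg|exact: ch].
have gh0 x : 0 <= g x * h x by rewrite mulr_ge0.
have zgh : zeta (fun x => g x * h x) = 0.
  by apply: (@zeta_zero_set g) => // x ->; rewrite mul0r.
have [|t [zf' zgh' zs]] := @zeta_disjoint f _ cf cgh f0 gh0.
  by move=> x; rewrite mulrA.
have t0 : t = 0.
  move: zf' zgh'; rewrite zf zgh; case: (leP 0 t); case: (leP 0 (- t)); lra.
have cfg : continuous (fun x => f x + g x).
  by move=> x; apply: cvgD; [exact: cf|exact: cg].
have cfh : continuous (fun x => f x + h x).
  by move=> x; apply: cvgD; [exact: cf|exact: ch].
have cs : continuous (fun x => f x + g x * h x).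
  by move=> x; apply: cvgD; [exact: cf|exact: cgh].
have [||||||zfg|zfh] := @zeta_zero_set_split (fun x => f x + g x) (fun x => f x + h x).
- exact: cfg.
- exact: cfh.
- by move=> x; rewrite addr_ge0.
- by move=> x; rewrite addr_ge0.
- move=> x; have : f x + g x + h x != 0 by apply/eqP => e; apply: nofgh; exists x.
  rewrite -(@ltr_pM2l _ 2)// mulr0 => e.
  have : 0 < f x + g x + h x by rewrite lt_neqAle eq_sym e !addr_ge0.
  by move: (f0 x); lra.
(* Where [f + g * h] vanishes both terms are 0, and [(f + g) * (f + h)] reduces to [g * h]. *)
- apply: (@zeta_zero_set (fun x => f x + g x * h x)) => //.
  + by move=> x; apply: cvgM; [exact: cfg|exact: cfh].
  + by move=> x; rewrite addr_ge0.
  + by move=> x; rewrite mulr_ge0// addr_ge0.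
  + move=> x /eqP; rewrite paddr_eq0// => /andP[/eqP -> /eqP].
    by rewrite !add0r.
  + by rewrite zs t0 normr0.
- have [||||x e] := @zeta_disjoint_zero_sets _ h cfg ch.
  + by move=> x; rewrite addr_ge0.
  + by [].
  + by [].
  + by [].
  + by exists x.
- have [||||x e] := @zeta_disjoint_zero_sets _ g cfh cg.
  + by move=> x; rewrite addr_ge0.
  + by [].
  + by [].
  + by [].
  + by exists x; rewrite addrAC.
Qed.

(** For [d <= zeta p], the function [max 0 (d - p)] is killed by [zeta], and its zero set is
    [p >= d]; likewise for [q] and [r]. If [p] and [q] had no common zero, these three sets would
    cover [X] for small [d], hence have a common point, which [p + q + r = 0] forbids. *)
Lemma zeta_balanced (p q r : X -> R) :
  continuous p -> continuous q -> continuous r ->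
  (forall x, p x + q x + r x = 0) ->
  0 < zeta p -> 0 < zeta q -> 0 < zeta r -> exists x, p x = 0 /\ q x = 0.
Proof.
move=> cp cq cr pqr zp zq zr.
have [//|nopq] := pselect (exists x, p x = 0 /\ q x = 0).
have cN : continuous (fun x => `|p x| + `|q x|).
  move=> x; apply: cvgD; apply: continuous_comp.
  - exact: cp.
  - exact: norm_continuous.
  - exact: cq.
  - exact: norm_continuous.
have [|m m0 mN] := compact_pos_lower_bound cX cN.
  move=> x; rewrite lt_neqAle addr_ge0// andbT eq_sym.
  rewrite paddr_eq0// !normr_eq0; apply/negP => /andP[/eqP px /eqP qx].
  by apply: nopq; exists x.
(* If [p], [q], [r] are all below [d], each exceeds [- 2 d], so [|p| + |q| < 4 d < m]: any divisor
   from 4 on would do in place of 7. *)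
pose d := Num.min (Num.min (zeta p) (zeta q)) (Num.min (zeta r) (m / 7)).
have d0 : 0 < d by rewrite !lt_min zp zq zr divr_gt0.
have cd (s : X -> R) : continuous s -> continuous (fun x => Num.max 0 (d - s x)).
  move=> cs x; apply: cvg_maxr; first exact: cvg_cst.
  by apply: cvgB; [exact: cvg_cst|exact: cs].
have zd (s : X -> R) : continuous s -> d <= zeta s -> zeta (fun x => Num.max 0 (d - s x)) = 0.
  move=> cs ds; rewrite (@zeta_comp s (fun t => Num.max 0 (d - t)))//.
    by rewrite max_l// subr_le0.
  move=> t; apply: cvg_maxr; first exact: cvg_cst.
  by apply: cvgB; [exact: cvg_cst|exact: cvg_id].
have pos (s : X -> R) x : 0 <= Num.max 0 (d - s x) by rewrite le_max lexx.
have [||||x] := @zeta_triple _ _ _ (cd _ cp) (cd _ cq) (cd _ cr) (pos _) (pos _) (pos _).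
- by rewrite zd// !ge_min lexx.
- by rewrite zd// !ge_min lexx orbT.
- by rewrite zd// !ge_min lexx !orbT.
- move=> x.
  have [dp|pd] := leP d (p x); first by rewrite max_l ?mul0r ?subr_le0.
  have [dq|qd] := leP d (q x); first by rewrite [X in _ * X * _]max_l ?mulr0 ?mul0r ?subr_le0.
  have [dr|rd] := leP d (r x); first by rewrite [X in _ * _ * X]max_l ?mulr0 ?subr_le0.
  exfalso; have dm : d <= m / 7 by rewrite !ge_min lexx !orbT.
  have := pqr x; have := mN x.
  by case: (ger0P (p x)); case: (ger0P (q x)); lra.
move=> e; exfalso; move: (pqr x) e.
case: (leP 0 (d - p x)); case: (leP 0 (d - q x)); case: (leP 0 (d - r x)); lra.
Qed.

End SimpleQuasiState.

(** * Topology and measurability in the plane *)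

Lemma plane_nbhsP (R : realType) (p : R * R) (A : set (R * R)) :
  nbhs p A <-> exists2 e, 0 < e &
    forall q, `|p.1 - q.1| < e -> `|p.2 - q.2| < e -> A q.
Proof.
split=> [/nbhs_ballP[e /= e0 eA]|[e e0 eA]].
  by exists e => // q q1 q2; apply: eA; split.
by apply/nbhs_ballP; exists e => // q [] q1 q2; exact: eA.
Qed.

Section PlaneMeasurability.
Context {R : realType}.
Local Notation RR := (measurableTypeR R * measurableTypeR R)%type.

(** An open set is the union of the boxes with rational centre and radius [1 / (n + 1)] that it
    contains, a countable family of measurable rectangles. *)
Lemma plane_open_measurable (U : set (R * R)) : open U -> measurable (U : set RR).
Proof.
move=> oU.
pose box (a b : rat) (n : nat) : set RR :=
  ball (ratr a : R) n.+1%:R^-1 `*` ball (ratr b : R) n.+1%:R^-1.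
pose B a b n := if `[< box a b n `<=` U >] then box a b n else set0.
have -> : (U : set RR) = \bigcup_a \bigcup_b \bigcup_n B a b n.
  apply/seteqP; split=> [[x y] Uxy|p [a _ [b _ [n _]]]]; last first.
    by rewrite /B; case: ifPn => // /asboolP; exact.
  have /plane_nbhsP[e e0 eU] : nbhs (x, y) U by exact: open_nbhs_nbhs.
  have [n en] : exists n, n.+1%:R^-1 < e / 2.
    have [|n] := @ltr_add_invr R 0 (e / 2); first by rewrite divr_gt0.
    by rewrite add0r => ?; exists n.
  have n0 : 0 < n.+1%:R^-1 :> R by rewrite invr_gt0.
  have [r rE] : {r : R | r = n.+1%:R^-1} by eexists.
  rewrite -rE in en n0.
  have [a] := @rat_in_itvoo R (x - r) (x + r) ltac:(lra).
  rewrite in_itv/= => /andP[a1 a2].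
  have [b] := @rat_in_itvoo R (y - r) (y + r) ltac:(lra).
  rewrite in_itv/= => /andP[b1 b2].
  exists a => //; exists b => //; exists n => //; rewrite /B /box -rE.
  case: ifPn => [_|/asboolPn].
    by split; rewrite /= -ball_normE /ball_/= ltr_norml; apply/andP; split; lra.
  case=> -[q1 q2] [] /=; rewrite -!ball_normE /ball_/= => h1 h2.
  move: h1 h2; rewrite !ltr_norml => /andP[h1 h1'] /andP[h2 h2'].
  by apply: eU => /=; rewrite ltr_norml; apply/andP; split; lra.
apply: bigcupT_measurable_rat => a; apply: bigcupT_measurable_rat => b.
apply: bigcupT_measurable => n; rewrite /B; case: ifPn => // _.
by apply: measurableX; exact: measurable_ball.
Qed.

Lemma plane_closed_measurable (A : set (R * R)) : closed A -> measurable (A : set RR).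
Proof.
by move=> cA; rewrite -(setCK A); apply: measurableC; apply: plane_open_measurable; exact: closed_openC.
Qed.

Lemma plane_continuous_measurable (U : set (R * R)) (A : set RR) (f : R * R -> R) :
  open U -> measurable A -> A `<=` U -> (forall p, U p -> {for p, continuous f}) ->
  measurable_fun A (f : RR -> R).
Proof.
move=> oU mA AU cf.
apply: (measurability _ (RGenOInfty.measurableE R)) => // _ [_ [x ->] <-].
suff oUf : open (U `&` f @^-1` `]x, +oo[).
  rewrite (_ : A `&` _ = A `&` (U `&` f @^-1` `]x, +oo[)).
    by apply: measurableI => //; exact: plane_open_measurable.
  by rewrite setIA; congr setI; rewrite setIidl.
rewrite openE => p [Up fp]; apply: filterI; first exact: open_nbhs_nbhs.
by apply: (cf _ Up); apply: open_nbhs_nbhs; split => //; exact: interval_open.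
Qed.

End PlaneMeasurability.

(** * Area of a parallelogram *)

Section LebesguePlane.
Context {R : realType}.
Local Notation RR := (measurableTypeR R * measurableTypeR R)%type.
Local Notation mu := (@lebesgue_measure R).
Local Open Scope ereal_scope.

Lemma lebesgue2_xsection (A : set RR) :
  lebesgue2 A = \int[mu]_x mu (xsection A x).
Proof. by []. Qed.

Lemma lebesgue2_ysection (A : set RR) : measurable A ->
  lebesgue2 A = \int[mu]_y mu (ysection A y).
Proof.
move=> mA; rewrite -/((mu \x^ mu) A).
apply: (@product_measure_unique _ _ _ _ _ mu mu (mu \x^ mu)%E) => // B C mB mC.
exact: product_measure2E.
Qed.

Lemma lebesgue_measure_translate (A : set R) (t : R) : measurable A ->
  mu [set u | A (u + t)%R] = mu A.
Proof.
move=> mA.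
have mt : measurable_fun setT ((fun u => (u + t)%R) : measurableTypeR R -> measurableTypeR R).
  by apply: measurable_funD => //; exact: measurable_cst.
have -> : mu A = pushforward mu ((fun u => (u + t)%R) : _ -> measurableTypeR R) A.
  apply: (@lebesgue_measure_unique R
    (pushforward mu ((fun u => (u + t)%R) : measurableTypeR R -> measurableTypeR R))) => //.
  move=> _ [[a b]] _ <-; rewrite /pushforward /=.
  have E : [set u : R | (u + t)%R \in `]a, b]] = `](a - t)%R, (b - t)%R]%classic.
    by apply/seteqP; split=> u /=; rewrite !in_itv/= => /andP[h1 h2]; apply/andP; split; lra.
  transitivity (mu `](a - t)%R, (b - t)%R]); last by rewrite -E.
  rewrite !lebesgue_measure_itv/= !lte_fin ltrD2r; case: ifPn => // _.
  by rewrite -!EFinB; congr EFin; ring.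
by [].
Qed.

Lemma lebesgue_measure_slab (a b k : R) : a != 0%R -> (0 <= k)%R ->
  mu [set u | (`|a * u + b| <= k)%R] = (2 * k / `|a|)%:E.
Proof.
move=> a0 k0; have na : (0 < `|a|)%R by rewrite normr_gt0.
rewrite (_ : mkset _ = `[(- b / a - k / `|a|)%R, (- b / a + k / `|a|)%R]%classic); last first.
  apply/seteqP; split=> u /=; rewrite in_itv/= -ler_distlC => h.
    rewrite (_ : (- b / a - u) = - ((a * u + b) / a))%R; last by field.
    by rewrite normrN normrM normfV ler_pM2r// invr_gt0.
  move: h; rewrite (_ : (- b / a - u) = - ((a * u + b) / a))%R; last by field.
  by rewrite normrN normrM normfV ler_pM2r// invr_gt0.
rewrite lebesgue_measure_itv/= lte_fin -EFinB.
case: ifPn => [_|]; first by congr EFin; field; rewrite gt_eqF.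
rewrite -leNgt => h; have : (k / `|a| = 0)%R.
  by apply/eqP; rewrite eq_le divr_ge0// andbT; move: h; lra.
by move=> /eqP; rewrite mulf_eq0 invr_eq0 (gt_eqF na) orbF => /eqP ->; rewrite mulr0 mul0r.
Qed.

(** Parallelograms are handled as intersections of two strips: their areas then come from
    one-dimensional slabs, without a linear change of variables. *)
Definition strip (a b m k : R) : set RR := [set p | `|a * p.1 + b * p.2 - m| <= k]%R.

Lemma measurable_strip a b m k : measurable (strip a b m k).
Proof.
have mf : measurable_fun setT ((fun p => `|a * p.1 + b * p.2 - m|%R) : RR -> R).
  apply: (@plane_continuous_measurable _ setT) => // [|p _]; first exact: openT.
  apply: cvg_norm; apply: cvgB; last exact: cvg_cst.
  apply: cvgD; (apply: cvgM; first exact: cvg_cst); [exact: cvg_fst|exact: cvg_snd].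
rewrite (_ : strip a b m k = setT `&` (fun p : RR => `|a * p.1 + b * p.2 - m|%R) @^-1` `]-oo, k]).
  by apply: mf => //; exact: measurable_itv.
by rewrite setTI; apply/seteqP; split=> p /=; rewrite in_itv.
Qed.

(** A shear, by [b / a * v] at height [v], preserves the lengths of horizontal sections and makes
    the first strip vertical. The vertical sections of the sheared set are slabs of length
    [2 l / |d'|] over a base of length [2 k / |a|]. *)
Let lebesgue2_parallelogram_neq0 (a b c d m n k l : R) : a != 0%R ->
  (a * d - b * c != 0)%R -> (0 <= k)%R -> (0 <= l)%R ->
  lebesgue2 (strip a b m k `&` strip c d n l) <=
    (4 * k * l / `|a * d - b * c|)%:E.
Proof.
move=> a0 D0 k0 l0; set E := _ `&` _.
pose d' := ((a * d - b * c) / a)%R.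
have d'0 : d' != 0%R by rewrite mulf_neq0// invr_eq0.
pose E0 := strip a 0 m k `&` strip c d' n l.
have mE : measurable E by apply: measurableI; exact: measurable_strip.
have mE0 : measurable E0 by apply: measurableI; exact: measurable_strip.
have -> : lebesgue2 E = lebesgue2 E0.
  rewrite (lebesgue2_ysection mE) (lebesgue2_ysection mE0); apply: eq_integral => v _.
  rewrite -(@lebesgue_measure_translate (ysection E0 v) (b / a * v)%R); last exact: measurable_ysection.
  congr (mu _); apply/seteqP; split=> u /=; rewrite !ysectionE /E /E0 /strip /= => -[].
    rewrite (_ : a * u + b * v - m = a * (u + b / a * v) + 0 * v - m)%R; last by field.
    rewrite (_ : c * u + d * v - n = c * (u + b / a * v) + d' * v - n)%R; last by rewrite /d'; field.
    by [].
  rewrite (_ : a * u + b * v - m = a * (u + b / a * v) + 0 * v - m)%R; last by field.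
  rewrite (_ : c * u + d * v - n = c * (u + b / a * v) + d' * v - n)%R; last by rewrite /d'; field.
  by [].
pose J := [set u : R | `|a * u + - m| <= k]%R.
have mJ : measurable (J : set (measurableTypeR R)).
  have mf : measurable_fun setT (fun u : R => `|a * u + - m|%R).
    by apply: continuous_measurable_fun => u; apply: cvg_norm; apply: cvgD;
      [apply: cvgM; [exact: cvg_cst|exact: cvg_id]|exact: cvg_cst].
  rewrite (_ : J = setT `&` (fun u : R => `|a * u + - m|%R) @^-1` `]-oo, k]).
    by apply: mf => //; exact: measurable_itv.
  by rewrite setTI; apply/seteqP; split=> p /=; rewrite in_itv.
rewrite lebesgue2_xsection.
have -> : \int[mu]_x mu (xsection E0 x) =
    \int[mu]_(x in setT) ((2 * l / `|d'|)%:E * (\1_J x)%:E).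
  apply: eq_integral => u _; rewrite indicE.
  have [uJ|uJ] := boolP (u \in J); last first.
    rewrite mule0 (_ : xsection E0 u = set0) ?measure0//.
    apply/seteqP; split=> v //=; rewrite xsectionE => -[+ _].
    by rewrite /strip /= mul0r addr0 => h; move: uJ; rewrite notin_setE.
  rewrite mule1 -(@lebesgue_measure_slab d' (c * u - n)%R)//; congr (mu _).
  rewrite xsectionE; apply/seteqP; split=> v /=.
    by move=> [_]; rewrite /strip /= (_ : c * u + _ - n = d' * v + (c * u - n))%R//; ring.
  move=> h; split; first by move: uJ; rewrite inE /J /strip /= mul0r addr0.
  by rewrite /strip /= (_ : c * u + _ - n = d' * v + (c * u - n))%R//; ring.
rewrite ge0_integralZl//; last 2 first.
- by apply: measurableT_comp => //; exact: measurable_indic.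
- by rewrite lee_fin divr_ge0// mulr_ge0.
have muJ : mu J = (2 * k / `|a|)%:E by exact: lebesgue_measure_slab.
rewrite integral_indic// setIT [X in _ * X]muJ.
rewrite -EFinM lee_fin.
rewrite le_eqVlt; apply/orP; left; apply/eqP.
by rewrite /d' normrM normfV; field; rewrite !normr_eq0 a0 D0.
Qed.

Lemma lebesgue2_parallelogram (a b c d m n k l : R) :
  (a * d - b * c != 0)%R -> (0 <= k)%R -> (0 <= l)%R ->
  lebesgue2 (strip a b m k `&` strip c d n l) <=
    (4 * k * l / `|a * d - b * c|)%:E.
Proof.
move=> D0 k0 l0; have [a0|a0] := eqVneq a 0%R; last exact: lebesgue2_parallelogram_neq0.
have c0 : c != 0%R by apply: contraNneq D0 => ->; rewrite a0 mulr0 mul0r subrr.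
have D0' : (c * b - d * a != 0)%R.
  by rewrite -oppr_eq0 opprB (mulrC d) (mulrC c).
rewrite setIC (_ : (4 * k * l / _ = 4 * l * k / `|c * b - d * a|)%R).
  exact: lebesgue2_parallelogram_neq0.
by rewrite distrC (mulrC d) (mulrC c) -!mulrA (mulrCA l).
Qed.

End LebesguePlane.

(** * Calculus of C^1 functions on the plane *)

Section PlaneCalculus.
Context {R : realType}.
Implicit Types (U : set (R * R)) (f g : R * R -> R) (p : R * R).

Lemma plane_eq (p q : R * R) : p.1 = q.1 -> p.2 = q.2 -> p = q.
Proof. by case: p q => ? ? [? ?] /= -> ->. Qed.

Lemma mvt_ball (phi dphi : R -> R) (p r y z : R) :
  (forall t, `|t - p| < r -> is_derive t 1 phi (dphi t)) ->
  `|y - p| < r -> `|z - p| < r ->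
  exists2 c, `|c - p| < r & phi z - phi y = dphi c * (z - y).
Proof.
move=> dp.
have cp t : `|t - p| < r -> {for t, continuous phi}.
  move=> tr; have [d _] := dp t tr.
  by apply: differentiable_continuous; apply/derivable1_diffP.
suff H y' z' : `|y' - p| < r -> `|z' - p| < r -> y' < z' ->
    exists2 c, `|c - p| < r & phi z' - phi y' = dphi c * (z' - y').
  have [yz|zy|->] := ltgtP y z => yr zr; first exact: H.
    by have [c cr e] := H _ _ zr yr zy; exists c => //; lra.
  by exists z => //; rewrite !subrr mulr0.
rewrite !ltr_norml => /andP[y1 y2] /andP[z1 z2] yz.
have in_r t : y' <= t <= z' -> `|t - p| < r.
  by move=> /andP[t1 t2]; rewrite ltr_norml; apply/andP; split; lra.
have [t|t|c cyz e] := @MVT R phi dphi y' z' yz.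
- by rewrite in_itv/= => /andP[t1 t2]; apply/dp/in_r; rewrite !ltW.
- apply: continuous_in_subspaceT => {}t; rewrite inE/= in_itv/= => tyz.
  exact/cp/in_r.
exists c => //; apply: in_r; move: cyz; rewrite in_itv/= => /andP[? ?].
by rewrite !ltW.
Qed.

Lemma derive_dx f p : derivable f p (1, 0) ->
  is_derive p.1 1 (fun t => f (t, p.2)) (dx f p).
Proof.
case: p => x y /= df.
have E : (fun h : R => h^-1 *: (((fun t => f (t, y)) \o shift x) (h *: 1) - f (x, y))) =
  (fun h : R => h^-1 *: ((f \o shift (x, y)) (h *: (1, 0)) - f (x, y))).
  apply/funext => h /=; congr (_ *: (f _ - _)).
  by apply: plane_eq; rewrite /= ?scaler0 ?add0r.
by apply: DeriveDef; rewrite /derivable /dx /derive E.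
Qed.

Lemma derive_dy f p : derivable f p (0, 1) ->
  is_derive p.2 1 (fun t => f (p.1, t)) (dy f p).
Proof.
case: p => x y /= df.
have E : (fun h : R => h^-1 *: (((fun t => f (x, t)) \o shift y) (h *: 1) - f (x, y))) =
  (fun h : R => h^-1 *: ((f \o shift (x, y)) (h *: (0, 1)) - f (x, y))).
  apply/funext => h /=; congr (_ *: (f _ - _)).
  by apply: plane_eq; rewrite /= ?scaler0 ?add0r.
by apply: DeriveDef; rewrite /derivable /dy /derive E.
Qed.

(** The two points are joined through the corner [(z.1, y.2)]. On each of the two segments the mean
    value theorem produces a partial derivative that is within [e] of its value at [p]. *)
Lemma strict_differentiability U f p (e : R) : open U ->
  (forall q, U q -> derivable f q (1, 0) /\ derivable f q (0, 1)) ->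
  U p -> {for p, continuous (dx f)} -> {for p, continuous (dy f)} -> 0 < e ->
  exists2 r : R, 0 < r & forall y z : R * R,
    `|y.1 - p.1| < r -> `|y.2 - p.2| < r -> `|z.1 - p.1| < r -> `|z.2 - p.2| < r ->
    `|f z - f y - dx f p * (z.1 - y.1) - dy f p * (z.2 - y.2)| <=
      e * (`|z.1 - y.1| + `|z.2 - y.2|).
Proof.
move=> oU df Up cx cy e0.
have nU : nbhs p U by exact: open_nbhs_nbhs.
have nx : nbhs p [set q | `|dx f p - dx f q| < e] by move: cx => /cvgr_dist_lt /(_ _ e0).
have ny : nbhs p [set q | `|dy f p - dy f q| < e] by move: cy => /cvgr_dist_lt /(_ _ e0).
have [r r0 rP] := (plane_nbhsP p _).1 (filterI nU (filterI nx ny)).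
have {}rP s t : `|s - p.1| < r -> `|t - p.2| < r ->
    [/\ U (s, t), `|dx f p - dx f (s, t)| < e & `|dy f p - dy f (s, t)| < e].
  rewrite (distrC s) (distrC t) => hs ht.
  have [h1 [h2 h3]] := rP (s, t) hs ht; exact: And3 h1 h2 h3.
exists r => // -[y1 y2] [z1 z2] /= hy1 hy2 hz1 hz2.
have [c1 c1r e1] : exists2 c, `|c - p.1| < r &
    f (z1, y2) - f (y1, y2) = dx f (c, y2) * (z1 - y1).
  apply: (@mvt_ball (fun t => f (t, y2)) (fun t => dx f (t, y2))) hy1 hz1 => t tr.
  have [Ut _ _] := rP _ _ tr hy2.
  exact: (@derive_dx f (t, y2) (df _ Ut).1).
have [c2 c2r e2] : exists2 c, `|c - p.2| < r &
    f (z1, z2) - f (z1, y2) = dy f (z1, c) * (z2 - y2).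
  apply: (@mvt_ball (fun t => f (z1, t)) (fun t => dy f (z1, t))) hy2 hz2 => t tr.
  have [Ut _ _] := rP _ _ hz1 tr.
  exact: (@derive_dy f (z1, t) (df _ Ut).2).
have [_ d1 _] := rP _ _ c1r hy2.
have [_ _ d2] := rP _ _ hz1 c2r.
rewrite (_ : f (z1, z2) - _ - _ - _ =
  (dx f (c1, y2) - dx f p) * (z1 - y1) + (dy f (z1, c2) - dy f p) * (z2 - y2)); last first.
  rewrite [in RHS]mulrBl -e1 [X in _ = _ + X]mulrBl -e2.
  by set A := dx f p; set B := dy f p; ring.
rewrite [leRHS]mulrDr (le_trans (ler_normD _ _))// !normrM.
apply: lerD; rewrite ler_wpM2r ?normr_ge0//.
  by rewrite distrC; exact: ltW d1.
by rewrite distrC; exact: ltW d2.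
Qed.

(** [Ck_on 1] speaks of partial derivatives only; building differentiability into the notion makes
    the chain rule directly available. *)
Definition C1_on U f := forall p, U p ->
  [/\ differentiable f p, {for p, continuous (dx f)} & {for p, continuous (dy f)}].

Lemma differentiable_of_affine_approx f p (a b : R) :
  (forall e : R, 0 < e -> exists2 r : R, 0 < r & forall z,
    `|z.1 - p.1| < r -> `|z.2 - p.2| < r ->
    `|f z - f p - a * (z.1 - p.1) - b * (z.2 - p.2)| <=
      e * (`|z.1 - p.1| + `|z.2 - p.2|)) ->
  differentiable f p.
Proof.
move=> H.
pose d (h : R * R) : R := a * h.1 + b * h.2.
have lin_d : linear d by move=> k u v; rewrite /d /= /GRing.scale /=; ring.
pose dM := GRing.isLinear.Build _ _ _ _ _ lin_d.
pose dL : {linear (R * R)%type -> R} := HB.pack d dM.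
have cd : continuous dL.
  move=> h; apply: cvgD; (apply: cvgM; first exact: cvg_cst); [exact: cvg_fst|exact: cvg_snd].
have E : f \o shift p = cst (f p) + (dL : R * R -> R) +o_ (0 : R * R) id.
  apply/eqaddoP => e e0.
  have [|r r0 Hr] := H (e / 2); first by rewrite divr_gt0.
  apply/plane_nbhsP; exists r => // h /=; rewrite !sub0r !normrN => h1 h2.
  have := Hr (h + p); rewrite /= !addrK => /(_ h1 h2).
  rewrite !fctE /= /d /= => /le_trans; rewrite (_ : f (h + p) - (_ + _) = f (h + p) - f p - a * h.1 - b * h.2); last by ring.
  apply; rewrite -mulrA ler_wpM2l ?(ltW e0)// prod_normE /=.
  have := @lexx _ _ (Num.max `|h.1| `|h.2|); rewrite ge_max => /andP[? ?]; lra.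
by apply/diff_locallyP; rewrite (diff_unique cd E).
Qed.

Lemma C1_of_Ck1 U f : open U -> Ck_on 1 U f -> C1_on U f.
Proof.
move=> oU [_ [df [cx _] [cy _]]] p Up.
have cxp : {for p, continuous (dx f)} by apply: cx; rewrite inE.
have cyp : {for p, continuous (dy f)} by apply: cy; rewrite inE.
split => //; apply: (@differentiable_of_affine_approx _ _ (dx f p) (dy f p)) => e e0.
have [r r0 H] := strict_differentiability oU df Up cxp cyp e0.
by exists r => // z; apply: H; rewrite subrr normr0.
Qed.

Lemma C1_strict U f p (e : R) : open U -> C1_on U f -> U p -> 0 < e ->
  exists2 r : R, 0 < r & forall y z : R * R,
    `|y.1 - p.1| < r -> `|y.2 - p.2| < r -> `|z.1 - p.1| < r -> `|z.2 - p.2| < r ->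
    `|f z - f y - dx f p * (z.1 - y.1) - dy f p * (z.2 - y.2)| <=
      e * (`|z.1 - y.1| + `|z.2 - y.2|).
Proof.
move=> oU cf Up e0; have [_ cx cy] := cf p Up.
have dU q : U q -> derivable f q (1, 0) /\ derivable f q (0, 1).
  by move=> /cf[df _ _]; split; exact: diff_derivable.
exact: (strict_differentiability oU dU Up cx cy e0).
Qed.

Lemma continuous_at_of_eq U f g p : open U -> U p ->
  (forall q, U q -> f q = g q) -> {for p, continuous g} -> {for p, continuous f}.
Proof.
move=> oU Up fg cg; have fgp : f p = g p by exact: fg.
suff : f @ nbhs p --> f p by [].
rewrite fgp; apply: cvg_trans cg.
by apply: near_eq_cvg; apply: filterS (open_nbhs_nbhs (conj oU Up)) => q Uq; rewrite fg.
Qed.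

Lemma near_eq_C1 U f g : open U -> (forall p, U p -> f p = g p) ->
  C1_on U f -> C1_on U g.
Proof.
move=> oU fg cf.
have nfg p : U p -> \near p, f p = g p.
  by move=> Up; apply: filterS (open_nbhs_nbhs (conj oU Up)) => q; exact: fg.
have E p v : U p -> 'D_v f p = 'D_v g p.
  by move=> Up; apply: near_eq_derive; exact: nfg.
move=> p Up; have [df cx cy] := cf p Up; split.
- apply: (@differentiable_of_affine_approx _ _ (dx f p) (dy f p)) => e e0.
  have [r r0 H] := C1_strict oU cf Up e0.
  have /plane_nbhsP[s s0 sP] := nfg p Up.
  exists (Num.min r s); first by rewrite lt_min r0.
  move=> z; rewrite !lt_min => /andP[zr1 zs1] /andP[zr2 zs2].
  have <- : f z = g z by apply: sP; rewrite distrC.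
  by rewrite -(fg p Up); apply: H; rewrite ?subrr ?normr0.
- by apply: (continuous_at_of_eq oU Up) cx => q Uq; rewrite /dx E.
- by apply: (continuous_at_of_eq oU Up) cy => q Uq; rewrite /dy E.
Qed.

Lemma continuous_at_add f g p : {for p, continuous f} -> {for p, continuous g} ->
  {for p, continuous (fun q => f q + g q)}.
Proof. by move=> cf cg; apply: (cvgD cf cg). Qed.

Lemma continuous_at_mul f g p : {for p, continuous f} -> {for p, continuous g} ->
  {for p, continuous (fun q => f q * g q)}.
Proof. by move=> cf cg; apply: (cvgM cf cg). Qed.

Lemma C1_continuous U f p : C1_on U f -> U p -> {for p, continuous f}.
Proof. by move=> cf /cf[df _ _]; exact: differentiable_continuous. Qed.

Lemma C1_cst U (c : R) : C1_on U (fun=> c).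
Proof.
have E v : (fun p => 'D_v (fun _ : R * R => c) p) = fun=> 0.
  by apply/funext => p; exact: derive_cst.
by move=> p _; split; [exact: differentiable_cst|rewrite /dx E; exact: cvg_cst|
  rewrite /dy E; exact: cvg_cst].
Qed.

Lemma derive_add U f g p v : C1_on U f -> C1_on U g -> U p ->
  'D_v (fun q => f q + g q) p = 'D_v f p + 'D_v g p.
Proof.
move=> cf cg Up; have [df _ _] := cf p Up; have [dg _ _] := cg p Up.
by rewrite -[LHS]/('D_v (f + g) p) deriveD//; exact: diff_derivable.
Qed.

Lemma derive_mul U f g p v : C1_on U f -> C1_on U g -> U p ->
  'D_v (fun q => f q * g q) p = f p * 'D_v g p + g p * 'D_v f p.
Proof.
move=> cf cg Up; have [df _ _] := cf p Up; have [dg _ _] := cg p Up.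
by rewrite -[LHS]/('D_v (f * g) p) deriveM//; exact: diff_derivable.
Qed.

Lemma C1_add U f g : open U -> C1_on U f -> C1_on U g -> C1_on U (fun q => f q + g q).
Proof.
move=> oU cf cg p Up.
have [df fx fy] := cf p Up; have [dg gx gy] := cg p Up.
have E v q : U q -> 'D_v (fun q => f q + g q) q = 'D_v f q + 'D_v g q.
  by move=> Uq; exact: (derive_add v cf cg Uq).
split; first exact: differentiableD.
- exact: (continuous_at_of_eq oU Up (E (1, 0)) (continuous_at_add fx gx)).
- exact: (continuous_at_of_eq oU Up (E (0, 1)) (continuous_at_add fy gy)).
Qed.

Lemma C1_mul U f g : open U -> C1_on U f -> C1_on U g -> C1_on U (fun q => f q * g q).
Proof.
move=> oU cf cg p Up.
have [df fx fy] := cf p Up; have [dg gx gy] := cg p Up.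
have cfp := C1_continuous cf Up; have cgp := C1_continuous cg Up.
have E v q : U q -> 'D_v (fun q => f q * g q) q = f q * 'D_v g q + g q * 'D_v f q.
  by move=> Uq; exact: (derive_mul v cf cg Uq).
split; first exact: differentiableM.
- exact: (continuous_at_of_eq oU Up (E (1, 0))
    (continuous_at_add (continuous_at_mul cfp gx) (continuous_at_mul cgp fx))).
- exact: (continuous_at_of_eq oU Up (E (0, 1))
    (continuous_at_add (continuous_at_mul cfp gy) (continuous_at_mul cgp fy))).
Qed.

Lemma derive_comp1 f (phi dphi : R -> R) p v : differentiable f p ->
  is_derive (f p) 1 phi (dphi (f p)) ->
  'D_v (phi \o f) p = dphi (f p) * 'D_v f p.
Proof.
move=> df [dphi1 dphiE].
have dd : differentiable phi (f p) by apply/derivable1_diffP.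
rewrite deriveE; last exact: differentiable_comp.
rewrite diff_comp//= deriveE// -dphiE deriveE//.
by rewrite -[X in 'd phi _ X = _]mulr1 [LHS]linearZ /= mulrC.
Qed.

Lemma C1_comp1 U f (phi dphi : R -> R) : open U -> C1_on U f ->
  (forall p, U p -> is_derive (f p) 1 phi (dphi (f p)) /\ {for f p, continuous dphi}) ->
  C1_on U (phi \o f).
Proof.
move=> oU cf H p Up; have [df fx fy] := cf p Up; have [dp cdp] := H p Up.
have E q v : U q -> 'D_v (phi \o f) q = dphi (f q) * 'D_v f q.
  by move=> Uq; apply: derive_comp1; [case: (cf q Uq)|case: (H q Uq)].
have cdf : {for p, continuous (dphi \o f)}.
  by apply: continuous_comp; [exact: C1_continuous cf Up|exact: cdp].
split.
- by apply: differentiable_comp => //; apply/derivable1_diffP; case: dp.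
- exact: (continuous_at_of_eq oU Up (fun q => E q (1, 0)) (continuous_at_mul cdf fx)).
- exact: (continuous_at_of_eq oU Up (fun q => E q (0, 1)) (continuous_at_mul cdf fy)).
Qed.

Lemma C1_inv U f : open U -> C1_on U f -> (forall p, U p -> f p != 0) ->
  C1_on U (fun p => (f p)^-1).
Proof.
move=> oU cf f0; apply: (@C1_comp1 U f GRing.inv (fun t => - t ^- 2)) => // p Up.
have fp0 := f0 p Up; split; last first.
  apply: cvgN; apply: cvgV; first by rewrite expf_neq0.
  exact: exprn_continuous.
apply: DeriveDef; first by apply: derivableV.
rewrite -[LHS]/('D_1 (fun t : R => (id t)^-1) (f p)) deriveV//= derive_id.
by rewrite /GRing.scale /= mulr1.
Qed.

Lemma diff_partials f p h : differentiable f p ->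
  'd f p h = dx f p * h.1 + dy f p * h.2.
Proof.
case: h => a b df; rewrite /dx /dy !deriveE//=.
rewrite (_ : (a, b) = a *: (1, 0) + b *: (0, 1)); last first.
  by apply: plane_eq; rewrite /= ?scaler0 ?add0r ?addr0 /GRing.scale /= ?mulr1.
by rewrite linearD !linearZ /= /GRing.scale /= mulrC (mulrC b).
Qed.

Lemma derive_comp2 f (T1 T2 : R * R -> R) p v :
  differentiable T1 p -> differentiable T2 p -> differentiable f (T1 p, T2 p) ->
  'D_v (fun q => f (T1 q, T2 q)) p =
  dx f (T1 p, T2 p) * 'D_v T1 p + dy f (T1 p, T2 p) * 'D_v T2 p.
Proof.
move=> d1 d2 df; have dT := differentiable_pair d1 d2.
rewrite -[LHS]/('D_v (f \o (fun q => (T1 q, T2 q))) p) deriveE; last exact: differentiable_comp.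
by rewrite diff_comp//= diff_pair//= diff_partials//= !deriveE.
Qed.

Lemma C1_comp2 U V f (T1 T2 : R * R -> R) : open U -> C1_on V f ->
  C1_on U T1 -> C1_on U T2 -> (forall p, U p -> V (T1 p, T2 p)) ->
  C1_on U (fun q => f (T1 q, T2 q)).
Proof.
move=> oU cf c1 c2 UV p Up.
have [d1 x1 y1] := c1 p Up; have [d2 x2 y2] := c2 p Up.
have [df fx fy] := cf _ (UV p Up).
have dT := differentiable_pair d1 d2.
have cT := differentiable_continuous dT.
have E q v : U q -> 'D_v (fun q => f (T1 q, T2 q)) q =
    dx f (T1 q, T2 q) * 'D_v T1 q + dy f (T1 q, T2 q) * 'D_v T2 q.
  move=> Uq; apply: derive_comp2; [by case: (c1 q Uq)|by case: (c2 q Uq)|].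
  by case: (cf _ (UV q Uq)).
have cfx : {for p, continuous (fun q => dx f (T1 q, T2 q))} by exact: (continuous_comp cT fx).
have cfy : {for p, continuous (fun q => dy f (T1 q, T2 q))} by exact: (continuous_comp cT fy).
split.
- exact: (@differentiable_comp _ _ _ _ (fun q => (T1 q, T2 q)) f).
- exact: (continuous_at_of_eq oU Up (fun q => E q (1, 0))
    (continuous_at_add (continuous_at_mul cfx x1) (continuous_at_mul cfy x2))).
- exact: (continuous_at_of_eq oU Up (fun q => E q (0, 1))
    (continuous_at_add (continuous_at_mul cfx y1) (continuous_at_mul cfy y2))).
Qed.

Lemma jacobian_comp2 f g (T1 T2 : R * R -> R) p :
  differentiable T1 p -> differentiable T2 p ->
  differentiable f (T1 p, T2 p) -> differentiable g (T1 p, T2 p) ->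
  jacobian (fun q => f (T1 q, T2 q)) (fun q => g (T1 q, T2 q)) p =
  jacobian f g (T1 p, T2 p) * jacobian T1 T2 p.
Proof.
move=> d1 d2 df dg.
have E (a b c d x y z w : R) : (a * x + b * y) * (c * z + d * w) -
    (a * z + b * w) * (c * x + d * y) = (a * d - b * c) * (x * w - z * y) by ring.
by rewrite /Defs.jacobian /dx /dy !derive_comp2//; exact: E.
Qed.

End PlaneCalculus.

(** * Area of the image of a small square *)

Section LocalArea.
Context {R : realType}.
Local Notation RR := (measurableTypeR R * measurableTypeR R)%type.

Lemma normr_lincomb (a b x y k : R) : `|x| <= k -> `|y| <= k ->
  `|a * x + b * y| <= (`|a| + `|b|) * k.
Proof.
move=> xk yk; rewrite (le_trans (ler_normD _ _))// !normrM mulrDl.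
by apply: lerD; rewrite ler_wpM2l.
Qed.

(** The cofactor matrix turns the image of the square into a square of half-side [|J| h / 2], and
    errors of size [eta h] into errors of size at most [eta C h]. The two strips of half-width [k]
    record exactly this. *)
Let affine_image_area_neq0 (a b c d e : R) : a * d - b * c != 0 -> 0 < e ->
  exists2 eta, 0 < eta & forall h u v : R, 0 < h -> exists E : set RR,
    [/\ measurable E, (lebesgue2 E <= ((`|a * d - b * c| + e) * h ^+ 2)%:E)%E &
    forall s t e1 e2, `|s| <= h / 2 -> `|t| <= h / 2 ->
      `|e1| <= eta * h -> `|e2| <= eta * h ->
      E (u + (a * s + b * t) + e1, v + (c * s + d * t) + e2)].
Proof.
set J := a * d - b * c => J0 e0; have nJ : 0 < `|J| by rewrite normr_gt0.
pose C := `|a| + `|b| + `|c| + `|d|.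
have C0 : 0 <= C by rewrite !addr_ge0.
(* The parallelogram has area [4 k^2 / |J|], that is [(|J| + 4 eta C + 4 eta^2 C^2 / |J|) h^2], and
   [eta <= 1] bounds the excess by [eta D h^2]. The final 1 makes [D] positive. *)
pose D := 4 * C + 4 * C ^+ 2 / `|J| + 1.
have C2 : 0 <= 4 * C ^+ 2 / `|J| by apply: divr_ge0 => //; apply: mulr_ge0 => //; exact: sqr_ge0.
have D0 : 0 < D by rewrite /D; lra.
pose eta := Num.min 1 (e / D).
have eta0 : 0 < eta by rewrite lt_min ltr01 divr_gt0.
exists eta => // h u v h0.
pose k := h * (`|J| / 2 + eta * C).
have k0 : 0 <= k.
  by apply: mulr_ge0; [exact: ltW|apply: addr_ge0; [exact: divr_ge0|apply: mulr_ge0 => //; exact: ltW]].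
exists (strip d (- b) (d * u - b * v) k `&` strip (- c) a (- c * u + a * v) k).
have JE : d * a - - b * - c = J by rewrite /J; ring.
split; first by apply: measurableI; exact: measurable_strip.
- apply: le_trans (lebesgue2_parallelogram _ _ _ k0 k0) _; rewrite JE// lee_fin.
  rewrite (_ : 4 * k * k / `|J| = (`|J| + (eta * (4 * C) + eta * (eta * (4 * C ^+ 2 / `|J|)))) * h ^+ 2); last first.
    by rewrite /k; field; rewrite gt_eqF.
  rewrite ler_wpM2r ?sqr_ge0// lerD2l.
  have eta1 : eta <= 1 by rewrite ge_min lexx.
  have etaD : eta * D <= e by rewrite -ler_pdivlMr// ge_min lexx orbT.
  apply: le_trans etaD; rewrite /D; move: (4 * C ^+ 2 / `|J|) C2 => W W0.
  have eW : eta * (eta * W) <= eta * W.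
    by rewrite ler_wpM2l ?(ltW eta0)// -[leRHS]mul1r ler_wpM2r.
  by rewrite 2!(mulrDr eta) mulr1; lra.
- move=> s t e1 e2 hs ht he1 he2; split; rewrite /strip /=.
  + rewrite (_ : _ - _ = J * s + (d * e1 + - b * e2)); last by rewrite /J; ring.
    rewrite (le_trans (ler_normD _ _))// normrM /k mulrDr.
    apply: lerD; first by rewrite [leRHS]mulrCA ler_wpM2l.
    apply: le_trans (normr_lincomb _ _ he1 he2) _.
    rewrite normrN (mulrA h) (mulrC h) [leLHS]mulrC ler_wpM2l//.
      by apply: mulr_ge0; exact: ltW.
    rewrite /C; have := normr_ge0 a; have := normr_ge0 c; lra.
  + rewrite (_ : _ - _ = J * t + (- c * e1 + a * e2)); last by rewrite /J; ring.
    rewrite (le_trans (ler_normD _ _))// normrM /k mulrDr.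
    apply: lerD; first by rewrite [leRHS]mulrCA ler_wpM2l.
    apply: le_trans (normr_lincomb _ _ he1 he2) _.
    rewrite normrN (mulrA h) (mulrC h) [leLHS]mulrC ler_wpM2l//.
      by apply: mulr_ge0; exact: ltW.
    rewrite /C; have := normr_ge0 b; have := normr_ge0 d; lra.
Qed.

(** The image of the linear part lies on a line. Across the line only the errors count, which gives
    a width proportional to [eta h]; along it a crude bound of order [h] suffices. The product is an
    arbitrarily small multiple of [h^2]. *)
Let affine_image_area_eq0 (a b c d e : R) : a * d - b * c = 0 -> 0 < e ->
  exists2 eta, 0 < eta & forall h u v : R, 0 < h -> exists E : set RR,
    [/\ measurable E, (lebesgue2 E <= (e * h ^+ 2)%:E)%E &
    forall s t e1 e2, `|s| <= h / 2 -> `|t| <= h / 2 ->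
      `|e1| <= eta * h -> `|e2| <= eta * h ->
      E (u + (a * s + b * t) + e1, v + (c * s + d * t) + e2)].
Proof.
move=> J0 e0.
(* A normal of that line: up to sign a nonzero row of the cofactor matrix, or any nonzero vector if
   the matrix is 0. *)
have [x [y [xy0 xac xbd]]] : exists x y : R,
    [/\ 0 < x ^+ 2 + y ^+ 2, x * a + y * c = 0 & x * b + y * d = 0].
  have pos (z1 z2 : R) : (z1 != 0) || (z2 != 0) -> 0 < z1 ^+ 2 + z2 ^+ 2.
    move=> h; rewrite lt_neqAle addr_ge0 ?sqr_ge0// andbT eq_sym paddr_eq0 ?sqr_ge0//.
    by rewrite !sqrf_eq0 negb_and.
  have [/pos h|] := boolP ((c != 0) || (- a != 0)).
    by exists c, (- a); split => //; move: J0; lra.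
  rewrite negb_or !negbK oppr_eq0 => /andP[/eqP -> /eqP ->].
  have [/pos h|] := boolP ((d != 0) || (- b != 0)).
    by exists d, (- b); split => //; lra.
  rewrite negb_or !negbK oppr_eq0 => /andP[/eqP -> /eqP ->].
  by exists 1, 0; split; rewrite ?expr1n ?expr0n /= ?addr0 ?ltr01//; lra.
pose C := `|a| + `|b| + `|c| + `|d|.
have C0 : 0 <= C by rewrite !addr_ge0.
pose D := 8 * (C + 1).
have D0 : 0 < D by rewrite mulr_gt0// ltr_wpDl.
pose eta := Num.min 1 (e / D).
have eta0 : 0 < eta by rewrite lt_min ltr01 divr_gt0.
exists eta => // h u v h0.
pose k := (`|x| + `|y|) * (eta * h); pose l := (`|x| + `|y|) * ((C + 1) * h).
have k0 : 0 <= k by apply: mulr_ge0; [exact: addr_ge0|apply: mulr_ge0; exact: ltW].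
have l0 : 0 <= l.
  by apply: mulr_ge0; [exact: addr_ge0|apply: mulr_ge0; [exact: addr_ge0|exact: ltW]].
have DE : x * x - y * - y = x ^+ 2 + y ^+ 2 by ring.
exists (strip x y (x * u + y * v) k `&` strip (- y) x (- y * u + x * v) l).
split; first by apply: measurableI; exact: measurable_strip.
- apply: le_trans (lebesgue2_parallelogram _ _ _ k0 l0) _; rewrite DE ?gt_eqF// lee_fin.
  rewrite (gtr0_norm xy0) ler_pdivrMr//.
  have xy2 : (`|x| + `|y|) ^+ 2 <= 2 * (x ^+ 2 + y ^+ 2).
    rewrite -(real_normK (num_real x)) -(real_normK (num_real y)) -subr_ge0.
    by rewrite (_ : _ - _ = (`|x| - `|y|) ^+ 2) ?sqr_ge0//; ring.
  rewrite (_ : 4 * k * l = (eta * (4 * (C + 1)) * h ^+ 2) * (`|x| + `|y|) ^+ 2); last first.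
    by rewrite /k /l; ring.
  have etaD : eta * D <= e by rewrite -ler_pdivlMr// ge_min lexx orbT.
  apply: (@le_trans _ _ (eta * (4 * (C + 1)) * h ^+ 2 * (2 * (x ^+ 2 + y ^+ 2)))).
    rewrite ler_wpM2l//; apply: mulr_ge0; last exact: sqr_ge0.
    by apply: mulr_ge0; [exact: ltW|apply: mulr_ge0 => //; exact: addr_ge0].
  rewrite (_ : _ * _ * (2 * _) = eta * D * h ^+ 2 * (x ^+ 2 + y ^+ 2)); last first.
    by rewrite /D; ring.
  by rewrite ler_wpM2r ?(ltW xy0)// ler_wpM2r ?sqr_ge0.
- move=> s t e1 e2 hs ht he1 he2; split; rewrite /strip /=.
  + rewrite (_ : _ - _ = (x * a + y * c) * s + (x * b + y * d) * t + (x * e1 + y * e2)); last by ring.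
    by rewrite xac xbd !mul0r !add0r; exact: normr_lincomb.
  + rewrite (_ : _ - _ = - y * (a * s + b * t + e1) + x * (c * s + d * t + e2)); last by ring.
    have eta1 : eta <= 1 by rewrite ge_min lexx.
    have na := normr_ge0 a; have nb := normr_ge0 b.
    have nc := normr_ge0 c; have nd := normr_ge0 d.
    have aux (z1 z2 z : R) : `|z| <= eta * h -> `|z1| + `|z2| <= C ->
        `|z1 * s + z2 * t + z| <= (C + 1) * h.
      move=> hz z12; rewrite (le_trans (ler_normD _ _))// mulrDl mul1r.
      apply: lerD; last first.
        by apply: (le_trans hz); rewrite -[leRHS]mul1r ler_wpM2r// ltW.
      apply: le_trans (normr_lincomb _ _ hs ht) _.
      by apply: ler_pM => //; lra.
    rewrite /l (addrC `|x|) -(normrN y).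
    by apply: normr_lincomb; apply: aux; rewrite // /C; lra.
Qed.

Lemma affine_image_area (a b c d e : R) : 0 < e ->
  exists2 eta, 0 < eta & forall h u v : R, 0 < h -> exists E : set RR,
    [/\ measurable E, (lebesgue2 E <= ((`|a * d - b * c| + e) * h ^+ 2)%:E)%E &
    forall s t e1 e2, `|s| <= h / 2 -> `|t| <= h / 2 ->
      `|e1| <= eta * h -> `|e2| <= eta * h ->
      E (u + (a * s + b * t) + e1, v + (c * s + d * t) + e2)].
Proof.
have [J0|J0] := eqVneq (a * d - b * c) 0; last exact: affine_image_area_neq0.
by move=> e0; rewrite J0 normr0 add0r; exact: affine_image_area_eq0.
Qed.

Definition square (a : R * R) (h : R) : set (R * R) :=
  `[a.1, a.1 + h] `*` `[a.2, a.2 + h].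

Lemma squareP a h (q : R * R) : square a h q <->
  (a.1 <= q.1 <= a.1 + h /\ a.2 <= q.2 <= a.2 + h).
Proof. by rewrite /square /= !in_itv. Qed.

Lemma ler_dist_itv (a h x y : R) : a <= x <= a + h -> a <= y <= a + h -> `|x - y| <= h.
Proof. by move=> /andP[? ?] /andP[? ?]; rewrite ler_norml; apply/andP; split; lra. Qed.

Lemma ler_dist_midpoint (a h x : R) : a <= x <= a + h -> `|x - (a + h / 2)| <= h / 2.
Proof. by move=> /andP[? ?]; rewrite ler_norml; apply/andP; split; lra. Qed.

(** [p] is an arbitrary point of the square and not its centre, because bisection gives no control
    of the position of the limit point. Strictness [eta / 2] compensates for the sum of two
    coordinate differences, each at most [h]. *)
Lemma local_image_area U (f g : R * R -> R) p e : open U ->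
  C1_on U f -> C1_on U g -> U p -> 0 < e ->
  exists2 r, 0 < r & forall a h, 0 < h < r -> square a h p -> exists E : set RR,
    [/\ measurable E, (lebesgue2 E <= ((`|jacobian f g p| + e) * h ^+ 2)%:E)%E &
      forall q, square a h q -> E (f q, g q)].
Proof.
move=> oU cf cg Up e0.
have [eta eta0 H] := affine_image_area (dx f p) (dy f p) (dx g p) (dy g p) e0.
have eta20 : 0 < eta / 2 by rewrite divr_gt0.
have [r r0 Hf] := C1_strict oU cf Up eta20.
have [r' r'0 Hg] := C1_strict oU cg Up eta20.
exists (Num.min r r'); first by rewrite lt_min r0.
move=> a h /andP[h0]; rewrite lt_min => /andP[hr hr'] /squareP[p1 p2].
pose m1 := a.1 + h / 2; pose m2 := a.2 + h / 2.
have [E [mE E1 E2]] := H h (f p + (dx f p * (m1 - p.1) + dy f p * (m2 - p.2)))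
  (g p + (dx g p * (m1 - p.1) + dy g p * (m2 - p.2))) h0.
exists E; split => // q /squareP[q1 q2].
have d1 : `|q.1 - p.1| <= h by exact: ler_dist_itv q1 p1.
have d2 : `|q.2 - p.2| <= h by exact: ler_dist_itv q2 p2.
have := Hf p q; rewrite !subrr normr0 => /(_ r0 r0 (le_lt_trans d1 hr) (le_lt_trans d2 hr)) hf.
have := Hg p q; rewrite !subrr normr0 => /(_ r'0 r'0 (le_lt_trans d1 hr') (le_lt_trans d2 hr')) hg.
have aux k : k <= eta / 2 * (`|q.1 - p.1| + `|q.2 - p.2|) -> k <= eta * h.
  move=> /le_trans; apply; rewrite -mulrA ler_pM2l// ler_pdivrMl// mulr_natl mulr2n.
  exact: lerD.
have := E2 (q.1 - m1) (q.2 - m2) _ _ _ _ (aux _ hf) (aux _ hg).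
rewrite (_ : f p + _ + _ + _ = f q); last by ring.
rewrite (_ : g p + _ + _ + _ = g q); last by ring.
by apply; exact: ler_dist_midpoint.
Qed.

End LocalArea.

(** * Bisection of squares *)

Section SquareBisection.
Context {R : realType}.

Definition subsquare (a : R * R) (h : R) (b : R * R) (k : R) : Prop :=
  [/\ a.1 <= b.1, b.1 + k <= a.1 + h, a.2 <= b.2 & b.2 + k <= a.2 + h].

Definition quarter (b : R * R) (k : R) (s : bool * bool) : R * R :=
  (b.1 + (if s.1 then k / 2 else 0), b.2 + (if s.2 then k / 2 else 0)).

Lemma quarter_subsquare b k s : 0 < k -> subsquare b k (quarter b k s) (k / 2).
Proof. by move=> k0; case: s => -[] [] ; split => /=; lra. Qed.

Lemma subsquare_trans a h b k c l :
  subsquare a h b k -> subsquare b k c l -> subsquare a h c l.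
Proof. by move=> [? ? ? ?] [? ? ? ?]; split; lra. Qed.

Lemma square_quarter b k (q : R * R) : square b k q ->
  exists s, square (quarter b k s) (k / 2) q.
Proof.
move=> /squareP[q1 q2].
have half (x y : R) : x <= y <= x + k -> exists s : bool,
    x + (if s then k / 2 else 0) <= y <= x + (if s then k / 2 else 0) + k / 2.
  move=> /andP[xy yx]; have [h|h] := leP (x + k / 2) y.
    by exists true; apply/andP; split; lra.
  by exists false; apply/andP; split; lra.
have [s1 h1] := half _ _ q1; have [s2 h2] := half _ _ q2.
by exists (s1, s2); apply/squareP.
Qed.

(** Cousin's lemma for squares: if [P a h] failed, successive bad quarters would shrink to a point,
    and the local hypothesis there contradicts their badness. It plays the role of compactness, and
    lets estimates be summed over quarters without listing a subdivision. *)
Lemma square_bisection (P : R * R -> R -> Prop) (a : R * R) (h : R) : 0 < h ->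
  (forall b k, 0 < k -> subsquare a h b k ->
    (forall s, P (quarter b k s) (k / 2)) -> P b k) ->
  (forall p, square a h p -> exists2 r, 0 < r & forall b k, 0 < k < r ->
    subsquare a h b k -> square b k p -> P b k) ->
  P a h.
Proof.
move=> h0 Psub Ploc; apply: contrapT => nPa.
(* [F] selects a quarter on which [P] fails, whenever it fails on the whole subsquare. *)
have /choice[F FP] : forall bk : R * R * R, exists s, 0 < bk.2 ->
    subsquare a h bk.1 bk.2 -> ~ P bk.1 bk.2 -> ~ P (quarter bk.1 bk.2 s) (bk.2 / 2).
  move=> [b k]; apply: contrapT => /forallNP nF.
  have [k0 [sb nP]] : 0 < k /\ subsquare a h b k /\ ~ P b k.
    have /not_implyP[k0 /not_implyP[sb /not_implyP[nP _]]] := nF (false, false).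
    by split.
  apply/nP/Psub => // s; apply: contrapT => nPs.
  by apply: (nF s).
pose step (bk : R * R * R) := (quarter bk.1 bk.2 (F bk), bk.2 / 2).
pose sq n := iter n step (a, h).
have sq2 n : (sq n).2 = h / 2 ^+ n.
  elim: n => [|n IH]; first by rewrite expr0 divr1.
  by rewrite /sq iterS /= -/(sq n) IH exprS invfM mulrA mulrAC.
have sq0 n : 0 < (sq n).2 by rewrite sq2 divr_gt0// exprn_gt0.
have sqP n : subsquare a h (sq n).1 (sq n).2 /\ ~ P (sq n).1 (sq n).2.
  elim: n => [|n [IH1 IH2]]; first by split => //; split.
  split; last exact: FP.
  by apply: (subsquare_trans IH1); exact: quarter_subsquare.
have nested n m : subsquare (sq n).1 (sq n).2 (sq (m + n)%N).1 (sq (m + n)%N).2.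
  elim: m => [|m IH]; first by split.
  rewrite addSn; apply: (subsquare_trans IH).
  exact: quarter_subsquare.
have nest n m : (sq m).1.1 <= (sq n).1.1 + (sq n).2 /\ (sq m).1.2 <= (sq n).1.2 + (sq n).2.
  have /orP[nm|mn] := leq_total n m.
    by have := nested n (m - n)%N; rewrite subnK// => -[]; have := sq0 m; lra.
  by have := nested m (n - m)%N; rewrite subnK// => -[]; have := sq0 n; lra.
(* The lower left corners increase in both coordinates, so their suprema give the common point of
   the nested squares. *)
pose p := (sup [set (sq n).1.1 | n in [set: nat]], sup [set (sq n).1.2 | n in [set: nat]]).
have in_sq n : square (sq n).1 (sq n).2 p.
  apply/squareP; split; apply/andP; split => /=.
  - apply: ub_le_sup; last by exists n.
    by exists ((sq 0).1.1 + (sq 0).2) => _ [m _ <-]; case: (nest 0 m).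
  - apply: ge_sup; first by exists (sq 0).1.1; exists 0%N.
    by move=> _ [m _ <-]; case: (nest n m).
  - apply: ub_le_sup; last by exists n.
    by exists ((sq 0).1.2 + (sq 0).2) => _ [m _ <-]; case: (nest 0 m).
  - apply: ge_sup; first by exists (sq 0).1.2; exists 0%N.
    by move=> _ [m _ <-]; case: (nest n m).
have [r r0 rP] := Ploc p (in_sq 0%N).
have [n nr] : exists n, (sq n).2 < r.
  have /archi_boundP : 0 <= h / r by rewrite divr_ge0// ltW.
  set n := Num.bound _ => hn; exists n; rewrite sq2 ltr_pdivrMr ?exprn_gt0//.
  rewrite -ltr_pdivrMl// mulrC (lt_trans hn)// -natrX ltr_nat.
  by rewrite ltn_expl.
have [sn nPn] := sqP n; apply: nPn; apply: rP => //.
by rewrite sq0.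
Qed.

End SquareBisection.

(** * Majorants of the multiplicity function of a plane map *)

Section ImageCover.
Context {R : realType}.
Local Notation RR := (measurableTypeR R * measurableTypeR R)%type.

(** Half-open, so that the four quarters are disjoint and integrals over them add up; the closed
    [square] is kept for covering points and for passing to limit points. *)
Definition hsquare (a : R * R) (h : R) : set RR :=
  `[a.1, a.1 + h[ `*` `[a.2, a.2 + h[.

Lemma measurable_hsquare a h : measurable (hsquare a h).
Proof. by apply: measurableX; exact: measurable_itv. Qed.

Lemma lebesgue2_hsquare a h : 0 <= h -> lebesgue2 (hsquare a h) = (h ^+ 2)%:E.
Proof.
move=> h0; rewrite /lebesgue2 /= product_measure1E; [|exact: measurable_itv..].
have E x : lebesgue_measure (`[x, x + h[%classic : set R) = h%:E.
  rewrite lebesgue_measure_itv /= lte_fin -EFinB; case: ifPn => [_|].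
    by congr EFin; rewrite addrC addKr.
  by rewrite -leNgt => xh; congr EFin; lra.
by rewrite [X in (X * _)%E]E [X in (_ * X)%E]E -EFinM expr2.
Qed.

Lemma hsquareP a h (q : R * R) : hsquare a h q <->
  (a.1 <= q.1 < a.1 + h /\ a.2 <= q.2 < a.2 + h).
Proof. by rewrite /hsquare /= !in_itv. Qed.

Lemma hsquare_square a h (q : R * R) : hsquare a h q -> square a h q.
Proof.
move=> /hsquareP[/andP[? ?] /andP[? ?]]; apply/squareP.
by split; apply/andP; split => //; exact: ltW.
Qed.

Lemma subsquare_hsquare a h b k : subsquare a h b k -> hsquare b k `<=` hsquare a h.
Proof.
move=> [? ? ? ?] q /hsquareP[? ?]; apply/hsquareP; split; apply/andP; split; lra.
Qed.

Lemma trivIset_quarter (b : R * R) k :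
  trivIset [set: bool * bool] (fun s => hsquare (quarter b k s) (k / 2)).
Proof.
move=> s t _ _ [q [/hsquareP[]]]; rewrite /quarter /=.
move=> h1 h2 /hsquareP[] /= h3 h4.
by case: s t h1 h2 h3 h4 => -[] [] [[] []] //= ? ? ? ?; exfalso; lra.
Qed.

Lemma integral_quarters (phi : RR -> \bar R) (b : R * R) k : 0 < k ->
  measurable_fun (hsquare b k) phi -> (forall q, hsquare b k q -> 0 <= phi q)%E ->
  (\sum_(s : bool * bool) \int[lebesgue2]_(q in hsquare (quarter b k s) (k / 2)) phi q
    <= \int[lebesgue2]_(q in hsquare b k) phi q)%E.
Proof.
move=> k0 mphi phi0.
have sub : \big[setU/set0]_(s <- index_enum (bool * bool)%type) hsquare (quarter b k s) (k / 2)
    `<=` hsquare b k.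
  by rewrite -bigcup_seq => q [s _]; apply: subsquare_hsquare; exact: quarter_subsquare.
have mU : measurable (\big[setU/set0]_(s <- index_enum (bool * bool)%type)
    hsquare (quarter b k s) (k / 2)).
  by apply: bigsetU_measurable => s _; exact: measurable_hsquare.
rewrite -ge0_integral_bigsetU//.
- apply: ge0_subset_integral => //; exact: measurable_hsquare.
- by move=> s; exact: measurable_hsquare.
- exact: index_enum_uniq.
- by apply: sub_trivIset; last exact: trivIset_quarter.
- by apply: measurable_funS mphi; [exact: measurable_hsquare|exact: sub].
- by move=> q /sub; exact: phi0.
Qed.

(* [Theta] majorizes the multiplicity function of [(f, g)] on [K], weighted by
   [m], as far as it can be seen on pairs of [d]-separated points. *)
Definition covers (K : set (R * R)) (f g m : R * R -> R) (d : R) (b : R * R) (k : R)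
    (Theta : RR -> \bar R) : Prop :=
  [/\ measurable_fun setT Theta, forall v, (0 <= Theta v)%E,
    forall x, square b k x -> K x -> ((m x)%:E <= Theta (f x, g x))%E &
    forall x y, square b k x -> square b k y -> K x -> K y ->
      f x = f y -> g x = g y -> d <= `|x.1 - y.1| + `|x.2 - y.2| ->
      ((m x + m y)%:E <= Theta (f x, g x))%E].

(** Two points in different quarters are dominated separately and the bounds add up; two points in
    one quarter fall under the pair clause of that quarter. *)
Lemma covers_quarters K f g m d b k (Theta : bool * bool -> RR -> \bar R) :
  0 < k -> (forall s, covers K f g m d (quarter b k s) (k / 2) (Theta s)) ->
  covers K f g m d b k (fun v => \sum_(s : bool * bool) Theta s v)%E.
Proof.
move=> k0 H.
have T0 s v : (0 <= Theta s v)%E by case: (H s).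
split.
- by apply: emeasurable_sum => s; case: (H s).
- by move=> v; apply: sume_ge0.
- move=> x xb Kx; have [s xs] := square_quarter xb.
  rewrite (bigD1 s)//=; have [_ _ hx _] := H s.
  by apply: (le_trans (hx x xs Kx)); apply: leeDl; exact: sume_ge0.
- move=> x y xb yb Kx Ky fxy gxy dxy.
  have [s xs] := square_quarter xb; have [t yt] := square_quarter yb.
  rewrite (bigD1 s)//=.
  have [_ _ hx hxy] := H s.
  have [ts|ts] := eqVneq t s.
    rewrite ts in yt; apply: (le_trans (hxy x y xs yt Kx Ky fxy gxy dxy)).
    by apply: leeDl; exact: sume_ge0.
  rewrite (bigD1 t)//= EFinD; apply: leeD; first exact: hx.
  have [_ _ hy _] := H t; rewrite fxy gxy.
  by apply: (le_trans (hy y yt Ky)); apply: leeDl; exact: sume_ge0.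
Qed.

(** The area formula as an upper bound. On a small square of side [k] about a point [p] of [K], the
    majorant is [m p + eta] times the indicator of a set containing the image, of area at most
    [(|jacobian f g p| + eta) k^2]. The pair clause is vacuous on so small a square, and acquires
    content when quarters are added. Squares missing [K] get the majorant 0. *)
Lemma image_cover (K U : set (R * R)) (f g m phi : R * R -> R) (a : R * R) (h d e : R) :
  0 < h -> 0 < d -> 0 < e ->
  (forall p, square a h p -> ~ K p -> \forall q \near p, ~ K q) ->
  open U -> K `&` square a h `<=` U -> C1_on U f -> C1_on U g ->
  (forall p, square a h p -> K p -> {for p, continuous m} /\ 0 <= m p) ->
  measurable_fun (hsquare a h) (phi : RR -> R) ->
  (forall p, hsquare a h p -> 0 <= phi p) ->
  (forall p, square a h p -> K p ->
    {for p, continuous phi} /\ m p * `|jacobian f g p| <= phi p) ->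
  exists2 Theta, covers K f g m d a h Theta &
    (\int[lebesgue2]_v Theta v <= \int[lebesgue2]_(p in hsquare a h) (phi p + e)%:E)%E.
Proof.
move=> h0 d0 e0 HK oU KU cf cg Hm mphi phi0 Hphi.
pose P b k := exists2 Theta, covers K f g m d b k Theta &
    (\int[lebesgue2]_v Theta v <= \int[lebesgue2]_(p in hsquare b k) (phi p + e)%:E)%E.
have mphie b k : subsquare a h b k ->
    measurable_fun (hsquare b k) (fun p => (phi p + e)%:E).
  move=> sb; apply/measurable_EFinP; apply: measurable_funD => //.
  by apply: measurable_funS mphi; [exact: measurable_hsquare|exact: subsquare_hsquare].
have phie0 b k p : subsquare a h b k -> hsquare b k p -> (0 <= (phi p + e)%:E)%E.
  move=> sb /(subsquare_hsquare sb) /phi0 p0; rewrite lee_fin; lra.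
apply: (@square_bisection R P a h h0).
- move=> b k k0 sb H.
  pose Theta s := sval (cid2 (H s)).
  have cT s : covers K f g m d (quarter b k s) (k / 2) (Theta s).
    by rewrite /Theta; case: cid2.
  have iT s : (\int[lebesgue2]_v Theta s v <=
      \int[lebesgue2]_(p in hsquare (quarter b k s) (k / 2)) (phi p + e)%:E)%E.
    by rewrite /Theta; case: cid2.
  exists (fun v => \sum_(s : bool * bool) Theta s v)%E; first exact: covers_quarters.
  rewrite ge0_integral_sum//; last 2 first.
  + by move=> s; case: (cT s).
  + by move=> s v _; case: (cT s).
  apply: le_trans (integral_quarters k0 (mphie _ _ sb) _); last by move=> q; exact: phie0 sb.
  by apply: lee_sum => s _; exact: iT.
- move=> p ap; have [Kp|nKp] := pselect (K p); last first.
    have /plane_nbhsP[r r0 rP] := HK p ap nKp.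
    exists r => // b k /andP[k0 kr] sb /squareP[p1 p2]; exists (cst 0%E); last first.
      by rewrite integral0; apply: integral_ge0 => q; exact: phie0.
    have noK x : square b k x -> ~ K x.
      move=> /squareP[x1 x2]; apply: rP.
        exact: (le_lt_trans (ler_dist_itv p1 x1) kr).
      exact: (le_lt_trans (ler_dist_itv p2 x2) kr).
    by split => // x; [move=> /noK|move=> ? /noK].
  have [cphi mphip] := Hphi p ap Kp; have [cm m0] := Hm p ap Kp.
  have J0 := normr_ge0 (jacobian f g p); move: mphip J0.
  have := local_image_area oU cf cg (KU _ (conj Kp ap)).
  set J := (`|jacobian f g p|); move=> area mphip J0.
  (* [(m p + eta) * (J + eta)] exceeds [m p * J] by [eta * (m p + J + eta)], which is at most
     [e / 2]. The other half of [e] absorbs the oscillation of [phi] on the square. *)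
  pose eta := Num.min 1 (e / 2 / (m p + J + 1)).
  have D0 : 0 < m p + J + 1 by lra.
  have eta0 : 0 < eta by rewrite lt_min ltr01 !divr_gt0.
  have etaP : (m p + eta) * (J + eta) <= phi p + e / 2.
    have eta1 : eta <= 1 by rewrite ge_min lexx.
    have etaD : eta * (m p + J + 1) <= e / 2 by rewrite -ler_pdivlMr// ge_min lexx orbT.
    have : eta * eta <= eta by rewrite -[leRHS]mulr1 ler_wpM2l// ltW.
    by move: etaD; rewrite 2!mulrDr mulr1 mulrDl 2!mulrDr (mulrC (m p) eta); lra.
  have [r r0 rP] := area _ eta0.
  have nm : nbhs p [set q | `|m p - m q| < eta] by move: cm => /cvgr_dist_lt /(_ _ eta0).
  have e20 : 0 < e / 2 by rewrite divr_gt0.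
  have nphi : nbhs p [set q | `|phi p - phi q| < e / 2] by move: cphi => /cvgr_dist_lt /(_ _ e20).
  have [s s0 sP] := (plane_nbhsP p _).1 (filterI nm nphi).
  (* With sides below [d / 2], the sum of the two coordinate differences stays below [d]. *)
  exists (Num.min (Num.min r s) (d / 2)); first by rewrite !lt_min r0 s0 divr_gt0.
  move=> b k /andP[k0]; rewrite !lt_min => /andP[/andP[kr ks] kd] sb bp.
  have [|E [mE aE EP]] := rP b k _ bp; first by rewrite k0.
  have near_p q : square b k q -> `|m p - m q| < eta /\ `|phi p - phi q| < e / 2.
    move: bp => /squareP[p1 p2] /squareP[q1 q2].
    apply: sP; first exact: (le_lt_trans (ler_dist_itv p1 q1) ks).
    exact: (le_lt_trans (ler_dist_itv p2 q2) ks).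
  have mpe : 0 <= m p + eta by rewrite addr_ge0// ltW.
  exists (fun v => (m p + eta)%:E * (\1_E v)%:E)%E.
    have dom x : square b k x -> ((m x)%:E <= (m p + eta)%:E * (\1_E (f x, g x))%:E)%E.
      move=> xb; rewrite indicE mem_set ?mule1; last exact: EP.
      by rewrite lee_fin; have [/ltW + _] := near_p x xb; rewrite ler_distlC => /andP[].
    split.
    + apply: measurable_funeM; apply: measurableT_comp => //; exact: measurable_indic.
    + by move=> v; rewrite mule_ge0// lee_fin.
    + by move=> x xb _; exact: dom.
    + move=> x y /squareP[x1 x2] /squareP[y1 y2] _ _ _ _ dxy; exfalso.
      have := lerD (ler_dist_itv x1 y1) (ler_dist_itv x2 y2).
      move=> /(le_trans dxy); rewrite leNgt => /negP; apply.
      by rewrite -mulr2n -mulr_natl -ltr_pdivlMl// mulrC.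
  rewrite ge0_integralZl//; last first.
    by apply: measurableT_comp => //; exact: measurable_indic.
  rewrite integral_indic// setIT.
  apply: (@le_trans _ _ ((phi p + e / 2)%:E * (k ^+ 2)%:E)%E).
    apply: (@le_trans _ _ ((m p + eta)%:E * ((J + eta) * k ^+ 2)%:E)%E).
      by apply: lee_wpmul2l => //; rewrite lee_fin.
    by rewrite -!EFinM lee_fin mulrA ler_wpM2r// sqr_ge0.
  rewrite -(@lebesgue2_hsquare b k) ?(ltW k0)// -integral_cst; last exact: measurable_hsquare.
  apply: ge0_le_integral => //.
  + exact: measurable_hsquare.
  + move=> q _; rewrite lee_fin; apply: le_trans etaP.
    by apply: mulr_ge0 => //; apply: addr_ge0 => //; exact: ltW.
  + exact: mphie.
  + move=> q /hsquare_square bq; rewrite lee_fin.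
    have [_ /ltW] := near_p q bq; rewrite ler_distl => /andP[_].
    by move: (phi p) (phi q) => u v; clear -e; lra.
Qed.

End ImageCover.

(** * Stokes' theorem on a square *)

Section StokesSquare.
Context {R : realType}.
Local Notation RR := (measurableTypeR R * measurableTypeR R)%type.
Implicit Types (U : set (R * R)) (f g u w : R * R -> R) (p q : R * R).

Lemma is_derive_dx f (x y : R) : differentiable f (x, y) ->
  is_derive x 1 (fun t : R => f (t, y)) (dx f (x, y)).
Proof.
move=> df; have dd : derivable f (x, y) (1, 0) by exact: diff_derivable.
have H := @derive_dx R f (x, y) dd; exact: H.
Qed.

Lemma is_derive_dy f (x y : R) : differentiable f (x, y) ->
  is_derive y 1 (fun t : R => f (x, t)) (dy f (x, y)).
Proof.
move=> df; have dd : derivable f (x, y) (0, 1) by exact: diff_derivable.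
have H := @derive_dy R f (x, y) dd; exact: H.
Qed.

(* Both sides are the limit of the second difference of [f] at [p], divided by
   the square of the step. *)
Lemma schwarz U f p : open U -> C1_on U f -> C1_on U (dx f) -> C1_on U (dy f) ->
  U p -> dy (dx f) p = dx (dy f) p.
Proof.
move=> oU cf cfx cfy Up.
suff H (e : R) : 0 < e -> `|dy (dx f) p - dx (dy f) p| <= e.
  apply/eqP; rewrite -subr_eq0 -normr_le0; apply/ler_addgt0Pl => e e0.
  by rewrite addr0 H.
move=> e0; have e20 : 0 < e / 2 by rewrite divr_gt0.
have [r r0 Hx] := C1_strict oU cfx Up e20.
have [s s0 Hy] := C1_strict oU cfy Up e20.
have [t t0 tU] := (plane_nbhsP p _).1 (open_nbhs_nbhs (conj oU Up)).
have [m [m0 mr ms mt]] : exists m : R, [/\ 0 < m, m <= r, m <= s & m <= t].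
  exists (Num.min (Num.min r s) t).
  by split; rewrite ?lt_min ?r0 ?s0 ?t0 // !ge_min lexx ?orbT.
have [h [h0 hm]] : exists h : R, 0 < h /\ h < m by exists (m / 2); split; lra.
have inU (x y : R) : `|x - p.1| < m -> `|y - p.2| < m -> U (x, y).
  by move=> x1 y1; apply: tU; rewrite distrC /=; exact: lt_le_trans mt.
have nh (x : R) : `|x + h - x| < m by rewrite addrAC subrr add0r gtr0_norm.
have nx (x : R) : `|x - x| < m by rewrite subrr normr0.
have dfx (x y : R) : `|x - p.1| < m -> `|y - p.2| < m ->
    is_derive x 1 (fun t : R => f (t, y)) (dx f (x, y)).
  by move=> x1 y1; have [df _ _] := cf _ (inU _ _ x1 y1);
    exact: (is_derive_dx df).
have dfy (x y : R) : `|x - p.1| < m -> `|y - p.2| < m ->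
    is_derive y 1 (fun t : R => f (x, t)) (dy f (x, y)).
  by move=> x1 y1; have [df _ _] := cf _ (inU _ _ x1 y1);
    exact: (is_derive_dy df).
(* [c] and [d] come from the mean value theorem applied to the same second difference, read as an
   increment in the first and in the second coordinate. *)
have [c cm e1] := @mvt_ball R (fun t => f (t, p.2 + h) - f (t, p.2))
  (fun t => dx f (t, p.2 + h) - dx f (t, p.2)) p.1 m p.1 (p.1 + h)
  (fun t tm => @is_deriveB _ _ _ _ _ _ _ _ _ (dfx _ _ tm (nh _)) (dfx _ _ tm (nx _)))
  (nx _) (nh _).
have [d dm e2] := @mvt_ball R (fun t => f (p.1 + h, t) - f (p.1, t))
  (fun t => dy f (p.1 + h, t) - dy f (p.1, t)) p.2 m p.2 (p.2 + h)
  (fun t tm => @is_deriveB _ _ _ _ _ _ _ _ _ (dfy _ _ (nh _) tm) (dfy _ _ (nx _) tm))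
  (nx _) (nh _).
have := Hx (c, p.2) (c, p.2 + h) (lt_le_trans cm mr) (lt_le_trans (nx _) mr)
  (lt_le_trans cm mr) (lt_le_trans (nh _) mr).
have := Hy (p.1, d) (p.1 + h, d) (lt_le_trans (nx _) ms) (lt_le_trans dm ms)
  (lt_le_trans (nh _) ms) (lt_le_trans dm ms).
move: e1 e2 => /=.
move: (dx f (c, p.2 + h)) (dx f (c, p.2)) (dy f (p.1 + h, d)) (dy f (p.1, d)).
move: (dx (dy f) p) (dy (dx f) p) (f (p.1 + h, p.2 + h)) (f (p.1, p.2 + h)).
move: (f (p.1 + h, p.2)) (f (p.1, p.2)) => F1 F2 X Y F3 F4 A B C D.
have shiftK (x : R) : x + h - x = h by rewrite addrAC subrr add0r.
move: (dx (dx f) p) (dy (dy f) p) => Z W.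
rewrite (shiftK p.1) (shiftK p.2) (subrr c) (subrr d) normr0 add0r addr0 !mulr0 !subr0 (gtr0_norm h0) => e1 e2 hy hx.
have {e1}e1 : F3 - F1 - F4 + F2 = (A - B) * h by rewrite -e1; ring.
have {e2}e2 : F3 - F1 - F4 + F2 = (C - D) * h by rewrite -e2; ring.
have AB : A - B = C - D by apply: (mulIf (lt0r_neq0 h0)); rewrite -e1.
rewrite AB in hx; rewrite -(ler_pM2r h0) -{1}(gtr0_norm h0) -normrM.
rewrite (_ : (Y - X) * h = (C - D - X * h) - (C - D - Y * h)); last by ring.
by apply: (le_trans (ler_normB _ _)); lra.
Qed.

Lemma continuous_bounded_square w (a : R * R) h : 0 < h ->
  (forall p, square a h p -> {for p, continuous w}) ->
  exists M, forall p, square a h p -> `|w p| <= M.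
Proof.
move=> h0 cw.
apply: (@square_bisection R (fun b k => exists M, forall p, square b k p -> `|w p| <= M) a h) => //.
  move=> b k k0 _ /choice[M MP].
  exists (\sum_(s : bool * bool) `|M s|) => p /square_quarter[s ps].
  rewrite (bigD1 s)//= ler_wpDr ?sumr_ge0//.
  by rewrite (le_trans (MP s p ps))// ler_norm.
move=> p ap; have np : nbhs p [set q | `|w p - w q| < 1].
  by move: (cw p ap) => /cvgr_dist_lt /(_ _ ltr01).
have [r r0 rP] := (plane_nbhsP p _).1 np.
exists r => // b k /andP[k0 kr] _ /squareP[p1 p2]; exists (`|w p| + 1) => q /squareP[q1 q2].
have : `|w p - w q| < 1 by apply: rP; rewrite ltr_norml; apply/andP; split; lra.
rewrite distrC => h1; rewrite -[w q](subrK (w p)) (le_trans (ler_normD _ _))// addrC.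
by rewrite lerD2l ltW.
Qed.

Lemma measurable_on_hsquare U w (a : R * R) h : open U -> square a h `<=` U ->
  (forall p, U p -> {for p, continuous w}) -> measurable_fun (hsquare a h) (w : RR -> R).
Proof.
move=> oU sU cw; apply: (plane_continuous_measurable oU) => //; first exact: measurable_hsquare.
by move=> p /hsquare_square/sU.
Qed.

Lemma integrable_hsquare U w (a : R * R) h : 0 < h -> open U -> square a h `<=` U ->
  (forall p, U p -> {for p, continuous w}) ->
  lebesgue2.-integrable (hsquare a h) (EFin \o w).
Proof.
move=> h0 oU sU cw; apply: measurable_bounded_integrable.
- exact: measurable_hsquare.
- by rewrite lebesgue2_hsquare ?ltry// ltW.
- exact: measurable_on_hsquare oU sU cw.
have [M MP] := @continuous_bounded_square w a h h0 (fun p ap => cw p (sU p ap)).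
exists M; split; first exact: num_real.
by move=> N MN p /hsquare_square/MP wM; apply: (le_trans wM); exact: ltW.
Qed.

Let restrict_y w (a : R * R) h x y :
  ((EFin \o w) \_ (hsquare a h)) (x, y) =
  if x \in `[a.1, a.1 + h[
  then ((fun y => (w (x, y))%:E) \_ `[a.2, a.2 + h[%classic) y else 0%E.
Proof.
rewrite !patchE /= mem_setE; have [xI|xI] := boolP (x \in _); last first.
  by case: ifPn => //; rewrite inE /hsquare /= (negbTE xI) => -[].
have [yI|yI] := boolP (y \in _); case: ifPn => //; last by rewrite inE /hsquare /= (negbTE yI) => -[].
by rewrite notin_setE /hsquare /= xI yI => -[].
Qed.

Let restrict_x w (a : R * R) h x y :
  ((EFin \o w) \_ (hsquare a h)) (x, y) =
  if y \in `[a.2, a.2 + h[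
  then ((fun x => (w (x, y))%:E) \_ `[a.1, a.1 + h[%classic) x else 0%E.
Proof.
rewrite !patchE /= mem_setE; have [yI|yI] := boolP (y \in _); last first.
  by case: ifPn => //; rewrite inE /hsquare /= (negbTE yI) => -[].
have [xI|xI] := boolP (x \in _); case: ifPn => //; last by rewrite inE /hsquare /= (negbTE xI) => -[].
by rewrite notin_setE /hsquare /= xI yI => -[].
Qed.

Lemma FTC2_half_open (G dG : R -> R) (x h : R) : 0 < h ->
  (forall t, t \in `[x, x + h] -> is_derive t 1 G (dG t) /\ {for t, continuous dG}) ->
  (\int[lebesgue_measure]_(t in `[x, (x + h)%R[) (dG t)%:E = (G (x + h)%R)%:E - (G x)%:E)%E.
Proof.
move=> h0 H; have xh : x < x + h by rewrite ltrDl.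
have cG t : t \in `[x, x + h] -> {for t, continuous G}.
  by move=> /H[[d _] _]; apply: differentiable_continuous; apply/derivable1_diffP.
have xin : x \in `[x, x + h] by rewrite in_itv/= lexx ltW.
have xhin : x + h \in `[x, x + h] by rewrite in_itv/= lexx ltW.
have cdG : {within `[x, x + h], continuous dG}.
  by apply: continuous_in_subspaceT => t; rewrite inE => /H[].
rewrite -(continuous_FTC2 xh cdG)//; last 2 first.
- split.
  + by move=> t txh; have [|[]] := H t; first exact: subset_itv_oo_cc.
  + by apply: cvg_at_right_filter; exact: cG.
  + by apply: cvg_at_left_filter; exact: cG.
- move=> t txh; have [|[_ <-] _] := H t; first exact: subset_itv_oo_cc.
  by rewrite derive1E.
apply: integral_itv_bndo_bndc; apply/measurable_EFinP.
apply: measurable_funS (subspace_continuous_measurable_fun _ cdG) => //; exact: subset_itv_co_cc.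
Qed.

(** Fubini with the inner integral along [y], where the fundamental theorem of calculus leaves a
    difference of two boundary values, both 0. *)
Lemma integral_dy_eq0 U u (a : R * R) h : 0 < h -> open U -> square a h `<=` U ->
  C1_on U u ->
  (forall x, a.1 <= x <= a.1 + h -> u (x, a.2) = 0 /\ u (x, a.2 + h) = 0) ->
  (\int[lebesgue2]_(p in hsquare a h) (dy u p)%:E = 0)%E.
Proof.
move=> h0 oU sU cu u0.
have int := integrable_hsquare h0 oU sU (fun p Up => let: And3 _ _ c := cu p Up in c).
rewrite integral_mkcond; rewrite integrable_mkcond in int; last exact: measurable_hsquare.
rewrite -(integral12_prod_meas1 int) /= integral0_eq// => x _.
rewrite /fubini_F; under eq_integral do rewrite restrict_y.
have [xI|xI] := boolP (x \in `[a.1, a.1 + h[); last by rewrite integral0.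
rewrite -integral_mkcond.
have xI' : a.1 <= x <= a.1 + h by move: xI; rewrite in_itv/= => /andP[-> /ltW].
rewrite (@FTC2_half_open (fun y => u (x, y)))//.
  by have [-> ->] := u0 x xI'; rewrite subee.
move=> y; rewrite in_itv/= => yI.
have [du _ cy] : [/\ differentiable u (x, y), {for (x, y), continuous (dx u)} &
    {for (x, y), continuous (dy u)}] by apply/cu/sU/squareP.
split; first exact: (is_derive_dy du).
apply: (@continuous_comp _ _ _ (fun y => (x, y)) (dy u)); last exact: cy.
by apply: (@cvg_pair _ _ _ _ (nbhs x) (nbhs y)); [exact: cvg_cst|exact: cvg_id].
Qed.

Lemma integral_dx_eq0 U u (a : R * R) h : 0 < h -> open U -> square a h `<=` U ->
  C1_on U u ->
  (forall y, a.2 <= y <= a.2 + h -> u (a.1, y) = 0 /\ u (a.1 + h, y) = 0) ->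
  (\int[lebesgue2]_(p in hsquare a h) (dx u p)%:E = 0)%E.
Proof.
move=> h0 oU sU cu u0.
have int := integrable_hsquare h0 oU sU (fun p Up => let: And3 _ c _ := cu p Up in c).
rewrite integral_mkcond; rewrite integrable_mkcond in int; last exact: measurable_hsquare.
rewrite -(integral21_prod_meas1 int) /= integral0_eq// => y _.
rewrite /fubini_G; under eq_integral do rewrite restrict_x.
have [yI|yI] := boolP (y \in `[a.2, a.2 + h[); last by rewrite integral0.
rewrite -integral_mkcond.
have yI' : a.2 <= y <= a.2 + h by move: yI; rewrite in_itv/= => /andP[-> /ltW].
rewrite (@FTC2_half_open (fun x => u (x, y)))//.
  by have [-> ->] := u0 y yI'; rewrite subee.
move=> x; rewrite in_itv/= => xI.
have [du cx _] : [/\ differentiable u (x, y), {for (x, y), continuous (dx u)} &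
    {for (x, y), continuous (dy u)}] by apply/cu/sU/squareP.
split; first exact: (is_derive_dx du).
apply: (@continuous_comp _ _ _ (fun x => (x, y)) (dx u)); last exact: cx.
by apply: (@cvg_pair _ _ _ _ (nbhs x) (nbhs y)); [exact: cvg_id|exact: cvg_cst].
Qed.

(* df /\ dg = - d(g df), and [g df] vanishes on the boundary. *)
Lemma stokes_square U f g (a : R * R) h : 0 < h -> open U -> square a h `<=` U ->
  C1_on U f -> C1_on U (dx f) -> C1_on U (dy f) -> C1_on U g ->
  (forall p, square a h p -> ~ hsquare a h p \/ p.1 = a.1 \/ p.2 = a.2 -> g p = 0) ->
  (\int[lebesgue2]_(p in hsquare a h) (jacobian f g p)%:E = 0)%E.
Proof.
move=> h0 oU sU cf cfx cfy cg g0.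
have cu : C1_on U (fun p => dx f p * g p) by exact: C1_mul.
have cv : C1_on U (fun p => dy f p * g p) by exact: C1_mul.
(* The mixed second derivatives of [f] cancel, and [g] is differentiated only once. *)
transitivity (\int[lebesgue2]_(p in hsquare a h)
    ((dy (fun p => dx f p * g p) p)%:E - (dx (fun p => dy f p * g p) p)%:E))%E.
  apply: eq_integral => p; rewrite inE => /hsquare_square/sU Up; rewrite -EFinB; congr EFin.
  have e1 : dy (fun p => dx f p * g p) p = dx f p * dy g p + g p * dy (dx f) p.
    exact: (derive_mul (0, 1) cfx cg Up).
  have e2 : dx (fun p => dy f p * g p) p = dy f p * dx g p + g p * dx (dy f) p.
    exact: (derive_mul (1, 0) cfy cg Up).
  rewrite e1 e2 /Defs.jacobian (schwarz oU cf cfx cfy Up).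
  by move: (dx f p) (dy f p) (dx g p) (dy g p) (dx (dy f) p) => *; ring.
have iu := integrable_hsquare h0 oU sU (fun p Up => let: And3 _ _ c := cu p Up in c).
have iv := integrable_hsquare h0 oU sU (fun p Up => let: And3 _ c _ := cv p Up in c).
have lo (x : R) : x <= x <= x + h by rewrite lexx lerDl ltW.
have hi (x : R) : x <= x + h <= x + h by rewrite lexx lerDl ltW.
have zu : (\int[lebesgue2]_(p in hsquare a h) (dy (fun p => dx f p * g p)%R p)%:E = 0)%E.
  apply: (integral_dy_eq0 h0 oU sU cu) => x x1; split.
    by rewrite (g0 (x, a.2)) ?mulr0//; [apply/squareP|right; right].
  rewrite (g0 (x, a.2 + h)) ?mulr0//; first exact/squareP.
  by left => /hsquareP[_ /=]; rewrite ltxx andbF.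
have zv : (\int[lebesgue2]_(p in hsquare a h) (dx (fun p => dy f p * g p)%R p)%:E = 0)%E.
  apply: (integral_dx_eq0 h0 oU sU cv) => y y2; split.
    by rewrite (g0 (a.1, y)) ?mulr0//; [apply/squareP|right; left].
  rewrite (g0 (a.1 + h, y)) ?mulr0//; first exact/squareP.
  by left => /hsquareP[/=]; rewrite ltxx andbF.
apply: etrans (integralB (measurable_hsquare a h) iu iv) _.
apply: etrans (f_equal2 (fun x y : \bar R => x - y)%E zu zv) _.
by rewrite subee.
Qed.

End StokesSquare.

(** * Calculus in charts and the Poisson bracket *)

Section Charts.
Context {R : realType} {M : topologicalType} {S : smooth_surface R M}.
Implicit Types (i j : chart S) (x : M) (p : R * R) (f g : M -> R).

Definition chart_image i : set (R * R) := coord i @` dom i.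

Lemma coordK_at i x : dom i x -> param i (coord i x) = x.
Proof. by move=> ix; apply: (coordK (i := i)); rewrite inE. Qed.

Lemma chart_image_coord i x : dom i x -> chart_image i (coord i x).
Proof. by move=> ix; exists x. Qed.

Lemma chart_imageP i p : chart_image i p -> dom i (param i p) /\ coord i (param i p) = p.
Proof. by move=> [x ix <-]; rewrite coordK_at. Qed.

Lemma open_chart_image i : open (chart_image i).
Proof. exact: coord_dom_open. Qed.

Lemma coord_nbhs i x (B : set (R * R)) : dom i x -> nbhs (coord i x) B ->
  nbhs x (coord i @^-1` B).
Proof.
move=> ix nB; have c : {for x, continuous (coord i)}.
  by apply: Defs.coord_continuous; rewrite inE.
exact: c.
Qed.

Lemma param_continuous_at i p : chart_image i p -> {for p, continuous (param i)}.
Proof. by move=> ip; apply: param_continuous; rewrite inE. Qed.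

Lemma param_nbhs i x (A : set M) : dom i x -> nbhs x A ->
  nbhs (coord i x) (param i @^-1` A).
Proof.
move=> ix nA; apply: (param_continuous_at (chart_image_coord ix)).
by rewrite coordK_at.
Qed.

Lemma open_coord_image i (W : set M) : open W -> open (coord i @` (dom i `&` W)).
Proof.
move=> oW; rewrite openE => _ [x [ix Wx] <-].
have n1 := open_nbhs_nbhs (conj (@open_chart_image i) (chart_image_coord ix)).
have n2 := param_nbhs ix (open_nbhs_nbhs (conj oW Wx)).
suff : nbhs (coord i x) (coord i @` (dom i `&` W)) by [].
apply: filterS (filterI n1 n2).
move=> p [/chart_imageP[ip pK] Wp]; exists (param i p) => //.
Qed.

Lemma ex_chart x : exists i, dom i x.
Proof. by have : [set: M] x by []; rewrite -(@dom_cover _ _ S) => -[i _ ix]; exists i. Qed.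

Lemma continuous_of_charts f x i : dom i x -> {for coord i x, continuous (f \o param i)} ->
  {for x, continuous f}.
Proof.
move=> ix cf A; rewrite -{1}(coordK_at ix) => /cf/(coord_nbhs ix) nA.
apply: filterS (filterI (open_nbhs_nbhs (conj (dom_open i) ix)) nA).
by move=> y [iy]; rewrite /= coordK_at.
Qed.

(** The C^1 counterpart of [smooth], for the cut-off functions below: they are built from squares of
    positive parts, hence not smooth. *)
Definition C1M f := forall i, C1_on (chart_image i) (f \o param i).

Lemma C1M_continuous f : C1M f -> continuous f.
Proof.
move=> cf x; have [i ix] := ex_chart x; apply: (continuous_of_charts ix).
exact: (C1_continuous (cf i) (chart_image_coord ix)).
Qed.

Lemma smooth_C1M f : smooth S f -> C1M f.
Proof. by move=> sf i; apply: C1_of_Ck1; [exact: open_chart_image|exact: sf]. Qed.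

Lemma smooth_dx f i : smooth S f -> C1_on (chart_image i) (dx (f \o param i)).
Proof.
move=> sf; apply: C1_of_Ck1; first exact: open_chart_image.
by have [_ [_ h _]] := sf i 2%N.
Qed.

Lemma smooth_dy f i : smooth S f -> C1_on (chart_image i) (dy (f \o param i)).
Proof.
move=> sf; apply: C1_of_Ck1; first exact: open_chart_image.
by have [_ [_ _ h]] := sf i 2%N.
Qed.

Definition trans1 i j (p : R * R) : R := (coord j (param i p)).1.
Definition trans2 i j (p : R * R) : R := (coord j (param i p)).2.

Lemma trans_C1 i j : C1_on (coord i @` (dom i `&` dom j)) (trans1 i j) /\
  C1_on (coord i @` (dom i `&` dom j)) (trans2 i j).
Proof.
have oU := @open_coord_image i _ (@dom_open _ _ S j).
by have [h1 h2] := transition_smooth i j; split; apply: C1_of_Ck1.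
Qed.

Lemma transE i j p : (trans1 i j p, trans2 i j p) = coord j (param i p).
Proof. by rewrite /trans1 /trans2 -surjective_pairing. Qed.

Lemma C1_on_coord_image f i j (W : set M) : open W -> W `<=` dom j ->
  C1_on (coord j @` W) (f \o param j) ->
  C1_on (coord i @` (dom i `&` W)) (f \o param i).
Proof.
move=> oW Wj cf; have oU := @open_coord_image i _ oW.
have [c1 c2] := trans_C1 i j.
have sub p : (coord i @` (dom i `&` W)) p -> (coord i @` (dom i `&` dom j)) p.
  by move=> [x [ix Wx] <-]; exists x => //; split => //; exact: Wj.
apply: (@near_eq_C1 _ _ (fun p => (f \o param j) (trans1 i j p, trans2 i j p))) => //.
  move=> _ [x [ix Wx] <-]; rewrite transE /= !coordK_at//; exact: Wj.
apply: (C1_comp2 oU cf).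
- by move=> p /sub; exact: c1.
- by move=> p /sub; exact: c2.
- by move=> _ [x [ix Wx] <-]; rewrite transE coordK_at//; exists x.
Qed.

(** Transition maps carry regularity from one chart around a point to all the others. *)
Lemma C1M_local f : (forall x, exists j W,
    [/\ open W, W x, W `<=` dom j & C1_on (coord j @` W) (f \o param j)]) -> C1M f.
Proof.
move=> H i _ [x ix <-]; have [j [W [oW Wx Wj cf]]] := H x.
by apply: (C1_on_coord_image oW Wj cf); exists x.
Qed.

Lemma C1M_cst (c : R) : C1M (fun=> c).
Proof. by move=> i; exact: C1_cst. Qed.

Lemma C1M_add f g : C1M f -> C1M g -> C1M (fun x => f x + g x).
Proof. by move=> cf cg i; exact: (C1_add (@open_chart_image i) (cf i) (cg i)). Qed.

Lemma C1M_mul f g : C1M f -> C1M g -> C1M (fun x => f x * g x).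
Proof. by move=> cf cg i; exact: (C1_mul (@open_chart_image i) (cf i) (cg i)). Qed.

Lemma C1M_inv f : C1M f -> (forall x, f x != 0) -> C1M (fun x => (f x)^-1).
Proof.
by move=> cf f0 i; exact: (C1_inv (@open_chart_image i) (cf i) (fun p _ => f0 _)).
Qed.

Lemma C1M_comp1 f (phi dphi : R -> R) : C1M f ->
  (forall t : R, is_derive t 1 phi (dphi t)) -> continuous dphi -> C1M (phi \o f).
Proof.
move=> cf dp cdp i.
exact: (C1_comp1 (@open_chart_image i) (cf i) (fun p _ => conj (dp _) (cdp _))).
Qed.

Lemma C1M_sum n (F : 'I_n -> M -> R) : (forall k, C1M (F k)) ->
  C1M (fun x => \sum_(k < n) F k x).
Proof.
elim: n F => [|n IH] F cF.
  rewrite (_ : (fun x => _) = fun=> 0); first exact: C1M_cst.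
  by apply/funext => x; rewrite big_ord0.
rewrite (_ : (fun x => _) = fun x => (\sum_(k < n) F (widen_ord (leqnSn n) k) x) + F ord_max x).
  by apply: C1M_add => //; apply: IH.
by apply/funext => x; rewrite big_ord_recr.
Qed.

Lemma jacobian_local (f1 g1 f2 g2 : R * R -> R) (U : set (R * R)) p : open U -> U p ->
  (forall q, U q -> f1 q = f2 q) -> (forall q, U q -> g1 q = g2 q) ->
  jacobian f1 g1 p = jacobian f2 g2 p.
Proof.
move=> oU Up ef eg.
have E (h1 h2 : R * R -> R) v : (forall q, U q -> h1 q = h2 q) -> 'D_v h1 p = 'D_v h2 p.
  move=> e; apply: near_eq_derive.
  by apply: filterS (open_nbhs_nbhs (conj oU Up)) => q; exact: e.
by rewrite /Defs.jacobian /dx /dy !(E _ _ _ ef) !(E _ _ _ eg).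
Qed.

Definition jac i f g (p : R * R) : R := jacobian (f \o param i) (g \o param i) p.

Lemma jac_transition f g i j p : C1M f -> C1M g -> (coord i @` (dom i `&` dom j)) p ->
  jac i f g p = jac j f g (coord j (param i p)) * jacobian (trans1 i j) (trans2 i j) p.
Proof.
move=> cf cg Up; have oU := @open_coord_image i _ (@dom_open _ _ S j).
have [c1 c2] := trans_C1 i j.
have e (h : M -> R) q : (coord i @` (dom i `&` dom j)) q ->
    (h \o param i) q = (h \o param j) (trans1 i j q, trans2 i j q).
  by move=> [x [ix jx] <-]; rewrite transE /= !coordK_at.
have jp : chart_image j (trans1 i j p, trans2 i j p).
  by rewrite transE; move: Up => [x [ix jx] <-]; rewrite coordK_at//; exists x.
have [d1 _ _] := c1 p Up; have [d2 _ _] := c2 p Up.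
have [df _ _] := cf j _ jp; have [dg _ _] := cg j _ jp.
rewrite /jac (jacobian_local oU Up (e f) (e g)).
by rewrite (jacobian_comp2 d1 d2 df dg) transE.
Qed.

Lemma jac_continuous f g i p : C1M f -> C1M g -> chart_image i p ->
  {for p, continuous (jac i f g)}.
Proof.
move=> cf cg ip; have [_ fx fy] := cf i p ip; have [_ gx gy] := cg i p ip.
have h1 := continuous_at_mul fx gy; have h2 := continuous_at_mul fy gx.
exact: (cvgB h1 h2).
Qed.

Lemma jac_add f g h i p : C1M g -> C1M h -> chart_image i p ->
  jac i f (fun x => g x + h x) p = jac i f g p + jac i f h p.
Proof.
move=> cg ch ip; rewrite /jac /Defs.jacobian.
have ex : dx ((fun x => g x + h x) \o param i) p = dx (g \o param i) p + dx (h \o param i) p.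
  exact: (derive_add (1, 0) (cg i) (ch i) ip).
have ey : dy ((fun x => g x + h x) \o param i) p = dy (g \o param i) p + dy (h \o param i) p.
  exact: (derive_add (0, 1) (cg i) (ch i) ip).
rewrite ex ey; move: (dx _ p) (dy _ p) (dx _ p) (dy _ p) (dx _ p) (dy _ p) => *; ring.
Qed.

Lemma jac_zero f g i x (W : set M) : dom i x -> nbhs x W -> (forall y, W y -> g y = 0) ->
  jac i f g (coord i x) = 0.
Proof.
move=> ix nW g0.
have E v : 'D_v (g \o param i) (coord i x) = 0.
  rewrite (@near_eq_derive _ _ _ _ (cst 0)) ?derive_cst//.
  by apply: filterS (param_nbhs ix nW) => p /g0.
by rewrite /jac /Defs.jacobian /dx /dy !E !mulr0 subrr.
Qed.

Section Bracket.
Variable w : area_form S.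
Local Notation pb := (poisson_bracket w).

Lemma density_continuous i p : chart_image i p -> {for p, continuous (density w i)}.
Proof.
by move=> ip; have [c _] := density_smooth w i 0%N; apply: c; rewrite inE.
Qed.

Lemma density_neq i p : chart_image i p -> density w i p != 0.
Proof. exact: density_neq0. Qed.

Lemma density_trans i j p : (coord i @` (dom i `&` dom j)) p ->
  density w i p = density w j (coord j (param i p)) * jacobian (trans1 i j) (trans2 i j) p.
Proof. exact: density_transition. Qed.

(** The choice made by [get] is never a default value: under a change of chart [jac] and [density]
    are multiplied by the same Jacobian, so the quotient computed in one chart solves the equation
    in all of them. *)
Lemma poisson_bracketE f g i x : C1M f -> C1M g -> dom i x ->
  - jac i f g (coord i x) = pb f g x * density w i (coord i x).
Proof.
move=> cf cg ix; move: i ix.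
apply: (@getPex _ [set b : R | forall i : chart S, dom i x ->
    - jac i f g (coord i x) = b * density w i (coord i x)]).
have [j jx] := ex_chart x.
have dj := density_neq (chart_image_coord jx).
exists (- jac j f g (coord j x) / density w j (coord j x)) => i ix.
have Up : (coord i @` (dom i `&` dom j)) (coord i x) by exists x.
rewrite (jac_transition cf cg Up) (density_trans Up) coordK_at//.
move: (jac j f g (coord j x)) (jacobian _ _ _) (density w j _) dj => A B D D0.
by field.
Qed.

Lemma poisson_bracket_quot f g i x : C1M f -> C1M g -> dom i x ->
  pb f g x = - jac i f g (coord i x) / density w i (coord i x).
Proof.
move=> cf cg ix; rewrite (poisson_bracketE cf cg ix) mulfK//.
exact/density_neq/chart_image_coord.
Qed.

Lemma poisson_bracket_continuous f g : C1M f -> C1M g -> continuous (pb f g).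
Proof.
move=> cf cg x; have [i ix] := ex_chart x; apply: (continuous_of_charts ix).
apply: (@continuous_at_of_eq _ (chart_image i) _
    (fun p => - jac i f g p * (density w i p)^-1)).
- exact: open_chart_image.
- exact: chart_image_coord.
- move=> p /chart_imageP[ip pK] /=.
  by rewrite (poisson_bracket_quot cf cg ip) pK.
have ixp := chart_image_coord ix.
apply: continuous_at_mul.
  by have := jac_continuous cf cg ixp; exact: cvgN.
apply: cvgV; first exact: density_neq.
exact: density_continuous.
Qed.

Lemma poisson_bracket_add f g h x : C1M f -> C1M g -> C1M h ->
  pb f (fun x => g x + h x) x = pb f g x + pb f h x.
Proof.
move=> cf cg ch; have [i ix] := ex_chart x.
rewrite (poisson_bracket_quot cf (C1M_add cg ch) ix) (poisson_bracket_quot cf cg ix).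
rewrite (poisson_bracket_quot cf ch ix) (jac_add _ cg ch (chart_image_coord ix)).
by rewrite opprD mulrDl.
Qed.

Lemma poisson_bracket_zero f g x (W : set M) : C1M f -> C1M g -> nbhs x W ->
  (forall y, W y -> g y = 0) -> pb f g x = 0.
Proof.
move=> cf cg nW g0; have [i ix] := ex_chart x.
by rewrite (poisson_bracket_quot cf cg ix) (jac_zero f ix nW g0) oppr0 mul0r.
Qed.

Lemma poisson_bracket_sum n f (G : 'I_n -> M -> R) x : C1M f -> (forall k, C1M (G k)) ->
  pb f (fun x => \sum_(k < n) G k x) x = \sum_(k < n) pb f (G k) x.
Proof.
move=> cf; elim: n G => [|n IH] G cG.
  rewrite (_ : (fun x => _) = fun=> 0); last by apply/funext => y; rewrite big_ord0.
  rewrite big_ord0.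
  exact: (poisson_bracket_zero cf (C1M_cst 0) (@filterT _ (nbhs x) _) (fun=> fun=> erefl)).
rewrite (_ : (fun x => _) = fun x => (\sum_(k < n) G (widen_ord (leqnSn n) k) x) + G ord_max x).
  have cG' k : C1M (G (widen_ord (leqnSn n) k)) by exact: cG.
  by rewrite (poisson_bracket_add x cf (C1M_sum cG') (cG ord_max)) (IH _ cG') big_ord_recr.
by apply/funext => y; rewrite big_ord_recr.
Qed.

End Bracket.

End Charts.

Arguments C1M {R M} S f.

(** * C^1 bump functions on the plane *)

Section Bumps.
Context {R : realType}.

Definition sqpos (t : R) : R := (Num.max 0 t) ^+ 2.

(** For [sqpos] the remainder is bounded by [h^2] globally, which gives differentiability at 0
    together with all other points. *)
Lemma is_derive_of_quadratic_error (f : R -> R) (x d : R) :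
  (forall h, `|f (h + x) - f x - d * h| <= h ^+ 2) -> is_derive x 1 f d.
Proof.
move=> H.
have c : (fun h => h^-1 *: ((f \o shift x) (h *: 1) - f x)) @ 0^' --> d.
  apply/cvgrPdist_le => e e0; near=> h.
  have h0 : h != 0 by near: h; exact: nbhs_dnbhs_neq.
  have he : `|h| <= e.
    near: h; apply: nbhs_dnbhs; apply/nbhs_ballP; exists e => // h /=.
    by rewrite -ball_normE /ball_ /= sub0r normrN => /ltW.
  rewrite /= /GRing.scale /= mulr1.
  have nh : 0 < `|h| by rewrite normr_gt0.
  rewrite -(ler_pM2r nh) -normrM.
  rewrite (_ : (d - _) * h = - (f (h + x) - f x - d * h)); last first.
    by move: (f (h + x)) (f x) => A B; field.
  rewrite normrN (le_trans (H h))// -real_normK ?num_real// expr2.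
  by rewrite ler_wpM2r// ltW.
by apply: DeriveDef; [apply/cvg_ex; exists d|exact: cvg_lim c].
Unshelve. all: by end_near. Qed.

Lemma is_derive_sqpos (t : R) : is_derive t 1 sqpos (2 * Num.max 0 t).
Proof.
apply: is_derive_of_quadratic_error => h; rewrite /sqpos.
rewrite ler_norml; case: (leP 0 t) => t0; case: (leP 0 (h + t)) => ht0;
  rewrite ?expr2; apply/andP; split; nra.
Qed.

Lemma continuous_pos_part : continuous (fun t : R => 2 * Num.max 0 t).
Proof.
move=> t; apply: cvgM; first exact: cvg_cst.
by apply: cvg_maxr; [exact: cvg_cst|exact: cvg_id].
Qed.

Lemma sqpos_ge0 t : 0 <= sqpos t.
Proof. exact: sqr_ge0. Qed.

Lemma sqpos_gt0 t : 0 < t -> 0 < sqpos t.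
Proof. by move=> t0; rewrite exprn_gt0// lt_max t0 orbT. Qed.

Lemma sqpos_eq0 t : t <= 0 -> sqpos t = 0.
Proof. by move=> t0; rewrite /sqpos max_l// expr0n. Qed.

Lemma C1_proj (U : set (R * R)) : C1_on U fst /\ C1_on U snd.
Proof.
have D1 (p v : R * R) : 'D_v fst p = v.1 :> R.
  have c : (fun h : R => h^-1 *: ((fst \o shift p) (h *: v) - p.1)) @ 0^' --> v.1.
    apply: cvg_near_cst; near=> h; have h0 : h != 0 by near: h; exact: nbhs_dnbhs_neq.
    by rewrite /= addrK /GRing.scale /= mulKf.
  exact: cvg_lim c.
have D2 (p v : R * R) : 'D_v snd p = v.2 :> R.
  have c : (fun h : R => h^-1 *: ((snd \o shift p) (h *: v) - p.2)) @ 0^' --> v.2.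
    apply: cvg_near_cst; near=> h; have h0 : h != 0 by near: h; exact: nbhs_dnbhs_neq.
    by rewrite /= addrK /GRing.scale /= mulKf.
  exact: cvg_lim c.
have E1 v : (fun p : R * R => 'D_v fst p) = (fun=> v.1 : R) by apply/funext => p; exact: D1.
have E2 v : (fun p : R * R => 'D_v snd p) = (fun=> v.2 : R) by apply/funext => p; exact: D2.
split=> p _; split.
- apply: (@differentiable_of_affine_approx _ _ _ 1 0) => e e0; exists 1 => // z _ _.
  by rewrite mul1r mul0r subr0 subrr normr0 mulr_ge0// ?addr_ge0// ltW.
- by rewrite /dx E1; exact: cvg_cst.
- by rewrite /dy E1; exact: cvg_cst.
- apply: (@differentiable_of_affine_approx _ _ _ 0 1) => e e0; exists 1 => // z _ _.
  by rewrite mul1r mul0r subr0 subrr normr0 mulr_ge0// ?addr_ge0// ltW.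
- by rewrite /dx E2; exact: cvg_cst.
- by rewrite /dy E2; exact: cvg_cst.
Unshelve. all: by end_near. Qed.

Definition osquare (a : R * R) (h : R) : set (R * R) :=
  [set q | a.1 < q.1 < a.1 + h /\ a.2 < q.2 < a.2 + h].

Lemma osquare_square a h (q : R * R) : osquare a h q -> square a h q.
Proof.
move=> [/andP[? ?] /andP[? ?]]; apply/squareP.
by split; apply/andP; split; exact: ltW.
Qed.

Lemma osquare_nbhs a h (q : R * R) : osquare a h q -> exists2 e, 0 < e &
  forall z, `|q.1 - z.1| < e -> `|q.2 - z.2| < e -> osquare a h z.
Proof.
move=> [/andP[q1 q2] /andP[q3 q4]].
exists (Num.min (Num.min (q.1 - a.1) (a.1 + h - q.1))
  (Num.min (q.2 - a.2) (a.2 + h - q.2))).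
  by rewrite !lt_min; do !(apply/andP; split); lra.
move=> z; rewrite !lt_min => /andP[/andP[z1 z2] _] /andP[_ /andP[z3 z4]].
by move: z1 z2 z3 z4; rewrite !ltr_norml => /andP[? ?] /andP[? ?] /andP[? ?] /andP[? ?];
  split; apply/andP; split; lra.
Qed.

Lemma open_osquare a h : open (osquare a h).
Proof.
rewrite openE => q /osquare_nbhs[e e0 eP].
by apply/plane_nbhsP; exists e.
Qed.

Lemma compact_square (a : R * R) h : compact (square a h).
Proof. by apply: compact_setX; exact: segment_compact. Qed.

Lemma closed_square (a : R * R) h : closed (square a h).
Proof. by apply: compact_closed; [exact: norm_hausdorff|exact: compact_square]. Qed.

Definition plane_bump (a : R * R) (h : R) (p : R * R) : R :=
  sqpos ((p.1 - a.1) * (a.1 + h - p.1)) * sqpos ((p.2 - a.2) * (a.2 + h - p.2)).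

Lemma plane_bump_C1 a h : C1_on setT (plane_bump a h).
Proof.
have [c1 c2] := C1_proj (@setT (R * R)).
have oT : open (@setT (R * R)) by exact: openT.
have aux (f : R * R -> R) (x y : R) : C1_on setT f ->
    C1_on setT (fun p => sqpos ((f p - x) * (y - f p))).
  move=> cf; apply: (C1_comp1 oT (f := fun p => (f p - x) * (y - f p))
    (dphi := fun t => 2 * Num.max 0 t)); last first.
    by move=> p _; split; [exact: is_derive_sqpos|exact: continuous_pos_part].
  have cy : C1_on setT (fun q => y + (-1) * f q).
    exact: (C1_add oT (C1_cst y) (C1_mul oT (C1_cst (-1)) cf)).
  rewrite (_ : (fun p => _) = fun p => (f p - x) * (y + (-1) * f p)).
    exact: (C1_mul oT (C1_add oT cf (C1_cst (- x))) cy).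
  by apply/funext => q; rewrite mulN1r.
exact: (C1_mul oT (aux fst a.1 (a.1 + h) c1) (aux snd a.2 (a.2 + h) c2)).
Qed.

Lemma plane_bump_ge0 a h p : 0 <= plane_bump a h p.
Proof. by rewrite mulr_ge0// sqpos_ge0. Qed.

Lemma plane_bump_gt0 a h p : osquare a h p -> 0 < plane_bump a h p.
Proof.
move=> [/andP[? ?] /andP[? ?]].
by apply: mulr_gt0; apply: sqpos_gt0; apply: mulr_gt0; lra.
Qed.

Lemma plane_bump_eq0 a h p : 0 < h -> ~ osquare a h p -> plane_bump a h p = 0.
Proof.
move=> h0 np.
have aux (x y : R) : ~~ (x < y < x + h) -> sqpos ((y - x) * (x + h - y)) = 0.
  rewrite negb_and -!leNgt => /orP[yx|yx]; apply: sqpos_eq0; nra.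
have /not_andP[/negP/aux|/negP/aux] := np; rewrite /plane_bump => ->.
  by rewrite mul0r.
by rewrite mulr0.
Qed.

End Bumps.

(** * Finite covers of the surface by good squares *)

Section Cover.
Context {R : realType} {M : topologicalType} {S : smooth_surface R M}.
Hypothesis hS : closed_surface S.
Variable w : area_form S.
Implicit Types (i j : chart S) (x : M) (p : R * R) (f g : M -> R).

(** Charts need not respect the orientation. A density of constant sign reduces an integral against
    its absolute value to one against plus or minus the form, to which Stokes' theorem applies. *)
Definition good_square i (a : R * R) (h : R) : Prop :=
  [/\ 0 < h, square a h `<=` chart_image i &
    (forall p, square a h p -> 0 < density w i p) \/
    (forall p, square a h p -> density w i p < 0)].

Definition patch i (a : R * R) (h : R) : set M := param i @` square a h.

Definition opatch i (a : R * R) (h : R) : set M := dom i `&` coord i @^-1` osquare a h.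

Lemma closed_patch i a h : good_square i a h -> closed (patch i a h).
Proof.
move=> [h0 sU _]; case: hS => _ hM; apply: compact_closed => //.
apply: continuous_compact; last exact: compact_square.
by apply: continuous_in_subspaceT => p; rewrite inE => /sU; exact: param_continuous_at.
Qed.

Lemma patchP i a h x : good_square i a h ->
  patch i a h x <-> dom i x /\ square a h (coord i x).
Proof.
move=> [_ sU _]; split=> [[p pa <-]|[ix xa]].
  by have [ip ->] := chart_imageP (sU p pa).
by exists (coord i x) => //; rewrite coordK_at.
Qed.

Lemma open_opatch i a h : open (opatch i a h).
Proof.
rewrite openE => x [ix xa].
have n1 := open_nbhs_nbhs (conj (@dom_open _ _ S i) ix).
have n2 := coord_nbhs ix (open_nbhs_nbhs (conj (@open_osquare R a h) xa)).
exact: (filterI n1 n2).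
Qed.

Lemma opatch_patch i a h : good_square i a h -> opatch i a h `<=` patch i a h.
Proof. by move=> gs x [ix /osquare_square xa]; apply/patchP. Qed.

Lemma ex_good_square x : exists i a h, good_square i a h /\ opatch i a h x.
Proof.
have [i ix] := @ex_chart _ _ S x; have ip := chart_image_coord ix.
set p := coord i x.
have cd := @density_continuous _ _ _ w _ _ ip; have d0 := @density_neq _ _ _ w _ _ ip.
have e0 : 0 < `|density w i p| by rewrite normr_gt0.
have nd : nbhs p [set q | `|density w i p - density w i q| < `|density w i p|].
  by move: cd => /cvgr_dist_lt /(_ _ e0).
have [r r0 rP] := (plane_nbhsP p _).1
  (filterI (open_nbhs_nbhs (conj (@open_chart_image _ _ S i) ip)) nd).
have sub q : square (p.1 - r / 2, p.2 - r / 2) r q ->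
    chart_image i q /\ `|density w i p - density w i q| < `|density w i p|.
  move=> /squareP[/= q1 q2]; apply: rP; rewrite ltr_norml; apply/andP; split; lra.
exists i, (p.1 - r / 2, p.2 - r / 2), r; split; last first.
  by split => //; split => /=; rewrite -/p; apply/andP; split; lra.
split => //; first by move=> q /sub[].
have [dp|dn] := ltP 0 (density w i p); [left|right] => q /sub[_].
  by rewrite (gtr0_norm dp) ltr_norml; lra.
rewrite (ler0_norm dn) ltr_norml; lra.
Qed.

Lemma finite_good_cover : exists n (c : 'I_n -> chart S) (a : 'I_n -> R * R) (h : 'I_n -> R),
  (forall k, good_square (c k) (a k) (h k)) /\
  (forall x, exists k, opatch (c k) (a k) (h k) x).
Proof.
have /choice[c /choice[a /choice[h H]]] := ex_good_square.
have [[x0 _]|M0] := pselect (exists x : M, True); last first.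
  have nf (T : Type) : 'I_0 -> T by case.
  exists 0%N, (nf _), (nf _), (nf _); split=> [[]//|x].
  by exfalso; apply: M0; exists x.
have cM : @cover_compact M setT.
  pose Mp : ptopologicalType := HB.pack M (isPointed.Build M x0).
  have E : @compact M setT = @cover_compact M setT.
    exact: (congr1 (fun P : set (set M) => P setT) (compact_cover Mp)).
  by rewrite -E; case: hS.
have [||D _ cov] := cM M setT (fun x : M => opatch (c x) (a x) (h x)).
- by move=> x _; exact: open_opatch.
- by move=> x _; exists x => //; case: (H x).
pose s := finmap.enum_fset D.
exists (size s), (fun k => c (tnth (in_tuple s) k)), (fun k => a (tnth (in_tuple s) k)),
  (fun k => h (tnth (in_tuple s) k)); split.
  by move=> k; case: (H (tnth (in_tuple s) k)).
move=> x; have [y yD xy] := cov x Logic.I.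
have /tnthP[k yk] : y \in in_tuple s by [].
by exists k; rewrite -yk.
Qed.

Definition bump i (a : R * R) (h : R) x : R :=
  if `[< dom i x >] then plane_bump a h (coord i x) else 0.

Lemma bump_ge0 i a h x : 0 <= bump i a h x.
Proof. by rewrite /bump; case: ifPn => // _; exact: plane_bump_ge0. Qed.

Lemma bump_gt0 i a h x : opatch i a h x -> 0 < bump i a h x.
Proof. by move=> [ix xa]; rewrite /bump asboolT//; exact: plane_bump_gt0. Qed.

Lemma bump_eq0 i a h x : 0 < h -> ~ opatch i a h x -> bump i a h x = 0.
Proof.
move=> h0 nx; rewrite /bump; case: ifPn => // /asboolP ix.
by apply: plane_bump_eq0 => // xa; apply: nx.
Qed.

(** The delicate points are those outside [dom i], where the value is 0 by decree. The patch is
    compact, hence closed in the Hausdorff space [M], and lies in [dom i]; so its complement is a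
    neighbourhood of such a point on which the function vanishes. *)
Lemma bump_C1M i a h : good_square i a h -> C1M S (bump i a h).
Proof.
move=> gs; apply: C1M_local => x; have [ix|nix] := pselect (dom i x).
  exists i, (dom i); split => //; first exact: dom_open.
  apply: (@near_eq_C1 _ _ (plane_bump a h)); first exact: open_chart_image.
    by move=> _ [y iy <-]; rewrite /= coordK_at// /bump asboolT.
  by move=> p _; exact: plane_bump_C1.
have [j jx] := @ex_chart _ _ S x.
have oP : open (dom j `&` ~` patch i a h).
  by apply: openI; [exact: dom_open|apply: closed_openC; exact: closed_patch].
exists j, (dom j `&` ~` patch i a h); split.
- exact: oP.
- by split => // /(patchP _ gs)[ix].
- by move=> y [].
apply: (@near_eq_C1 _ _ (fun=> 0)); last exact: C1_cst.
  by have := @open_coord_image _ _ S j _ oP; rewrite setIA setIid.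
move=> _ [y [jy ny] <-]; rewrite /= coordK_at// bump_eq0//; first by case: gs.
by move=> /(opatch_patch gs).
Qed.

End Cover.

(** * Integration in charts and exact forms *)

Section ChartIntegral.
Context {R : realType} {M : topologicalType} {S : smooth_surface R M}.
Hypothesis hS : closed_surface S.
Variable w : area_form S.
Local Notation pb := (poisson_bracket w).
Local Notation RR := (measurableTypeR R * measurableTypeR R)%type.
Implicit Types (i j : chart S) (x : M) (f g b : M -> R) (a : R * R) (h : R).

(** The 2-form [b w] read in a chart; the absolute value appears because [M] is oriented by [w]
    itself. *)
Definition chart_density i b (p : R * R) : R := b (param i p) * `|density w i p|.

Definition chart_integral i a h b : \bar R :=
  (\int[lebesgue2]_(p in hsquare a h) (chart_density i b p)%:E)%E.

Lemma chart_density_continuous i b p : continuous b -> chart_image i p ->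
  {for p, continuous (chart_density i b)}.
Proof.
move=> cb ip; apply: continuous_at_mul.
  by apply: (continuous_comp (param_continuous_at ip)); exact: cb.
have := density_continuous (w := w) ip; exact: cvg_norm.
Qed.

Lemma chart_density_integrable i a h b : good_square w i a h -> continuous b ->
  lebesgue2.-integrable (hsquare a h) (EFin \o chart_density i b).
Proof.
move=> [h0 sU _] cb.
exact: (integrable_hsquare h0 (@open_chart_image _ _ S i) sU
  (fun p ip => chart_density_continuous cb ip)).
Qed.

Lemma chart_density_measurable i a h b : good_square w i a h -> continuous b ->
  measurable_fun (hsquare a h) (chart_density i b : RR -> R).
Proof.
move=> [h0 sU _] cb.
exact: (measurable_on_hsquare (@open_chart_image _ _ S i) sU
  (fun p ip => chart_density_continuous cb ip)).
Qed.

Lemma chart_integral_ge0 i a h b : (forall x, 0 <= b x) -> (0 <= chart_integral i a h b)%E.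
Proof.
by move=> b0; apply: integral_ge0 => p _; rewrite lee_fin mulr_ge0.
Qed.

Lemma chart_integral_sum n i a h (B : 'I_n -> M -> R) : good_square w i a h ->
  (forall k, continuous (B k)) ->
  chart_integral i a h (fun x => \sum_(k < n) B k x) =
  (\sum_(k < n) chart_integral i a h (B k))%E.
Proof.
move=> gs cB.
rewrite /chart_integral -integral_sum; last 2 first.
- exact: measurable_hsquare.
- by move=> k; exact: (chart_density_integrable gs (cB k)).
by apply: eq_integral => p _; rewrite /chart_density mulr_suml -sumEFin.
Qed.

(** Half of the change of variables formula: [image_cover] for the transition map from [i] to [j],
    the weight [m] being the density in chart [j] pulled back. The majorant dominates that density
    on the support of [b], and its integral is at most the integral in chart [i] plus [e]. *)
Let chart_integral_le i a h j a' h' b : good_square w i a h -> good_square w j a' h' ->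
  continuous b -> (forall x, 0 <= b x) ->
  (forall x, b x != 0 -> patch i a h x /\ patch j a' h' x) ->
  (chart_integral j a' h' b <= chart_integral i a h b)%E.
Proof.
move=> gi gj cb b0 bsupp; have [h0 sU _] := gi; have [h'0 sU' _] := gj.
apply/lee_addgt0Pr => e e0.
(* An error of [e / h^2] per unit of area amounts to [e] on a square of side [h]. *)
have e'0 : 0 < e / h ^+ 2 by rewrite divr_gt0// exprn_gt0.
pose K : set (R * R) := [set p | patch j a' h' (param i p)].
pose U := coord i @` (dom i `&` dom j).
have oU : open U by apply: open_coord_image; exact: dom_open.
have UP p : U p -> [/\ chart_image i p, chart_image j (coord j (param i p)) &
    dom j (param i p)].
  by move=> [x [ix jx] <-]; rewrite coordK_at//; split => //; exists x.
have KU : K `&` square a h `<=` U.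
  move=> p [/(patchP _ gj)[jp _] /sU ip]; have [dp pK] := chart_imageP ip.
  by exists (param i p).
have [c1 c2] := trans_C1 i j.
pose m p := chart_density j b (coord j (param i p)).
have m0 p : 0 <= m p by rewrite mulr_ge0.
have cm p : U p -> {for p, continuous m}.
  move=> /UP[ip jp dp].
  have cT : {for p, continuous (fun q => coord j (param i q))}.
    apply: (continuous_comp (param_continuous_at ip)).
    by apply: Defs.coord_continuous; rewrite inE.
  exact: (continuous_comp cT (chart_density_continuous cb jp)).
have HK p : square a h p -> ~ K p -> \forall q \near p, ~ K q.
  move=> /sU ip nKp.
  have oc : open (~` patch j a' h') by apply: closed_openC; exact: (closed_patch hS gj).
  exact: (param_continuous_at ip (open_nbhs_nbhs (conj oc nKp))).
have Hphi p : square a h p -> K p -> {for p, continuous (chart_density i b)} /\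
    m p * `|jacobian (trans1 i j) (trans2 i j) p| <= chart_density i b p.
  move=> ap Kp; have Up := KU p (conj Kp ap); have [ip jp dp] := UP p Up.
  split; first exact: chart_density_continuous.
  rewrite /m /chart_density coordK_at// (density_trans w Up) normrM.
  by rewrite mulrA.
have [Th [mT T0 cT _] iT] := image_cover (phi := chart_density i b)
  h0 ltr01 e'0 HK oU KU c1 c2
  (fun p ap Kp => conj (cm p (KU p (conj Kp ap))) (m0 p))
  (chart_density_measurable gi cb) (fun p _ => mulr_ge0 (b0 _) (normr_ge0 _)) Hphi.
have mh := measurable_hsquare a h.
have -> : (chart_integral i a h b + e%:E)%E =
    (\int[lebesgue2]_(p in hsquare a h) (chart_density i b p + e / h ^+ 2)%:E)%E.
  have -> : (\int[lebesgue2]_(p in hsquare a h) (chart_density i b p + e / h ^+ 2)%:E)%E =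
      (\int[lebesgue2]_(p in hsquare a h) ((chart_density i b p)%:E + (e / h ^+ 2)%:E))%E by [].
  rewrite ge0_integralD//; last 3 first.
  - by move=> p _; rewrite lee_fin mulr_ge0.
  - by apply/measurable_EFinP; exact: chart_density_measurable.
  - by move=> p _; rewrite lee_fin ltW.
  rewrite integral_cst// lebesgue2_hsquare ?(ltW h0)// -EFinM divfK//.
  by rewrite expf_neq0// gt_eqF.
apply: le_trans iT.
rewrite /chart_integral integral_mkcond; apply: ge0_le_integral => //.
- by move=> q _; apply: erestrict_ge0 => {}q _; rewrite lee_fin mulr_ge0.
- apply/(measurable_restrictT _ (measurable_hsquare a' h')).
  by apply/measurable_EFinP; exact: chart_density_measurable.
- move=> q _; rewrite patchE; case: ifPn => // /[!inE] /hsquare_square qa.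
  have [jq qK] := chart_imageP (sU' q qa).
  have [bq|bq] := eqVneq (b (param j q)) 0.
    by rewrite /chart_density bq mul0r.
  have [/(patchP _ gi)[iq qai] _] := bsupp _ bq.
  have := cT (coord i (param j q)) qai; rewrite /K /= coordK_at// => /(_ _)/wrap[].
    exact: (bsupp _ bq).2.
  rewrite /m !(coordK_at iq) qK; congr (_ <= Th _)%E.
  by rewrite transE coordK_at// qK.
Qed.

(** The inequality in both directions, for the positive and the negative part of [b]. *)
Lemma chart_integral_eq i a h j a' h' b : good_square w i a h -> good_square w j a' h' ->
  continuous b -> (forall x, b x != 0 -> patch i a h x /\ patch j a' h' x) ->
  chart_integral i a h b = chart_integral j a' h' b.
Proof.
move=> gi gj cb bsupp.
have eq_ge0 b' : continuous b' -> (forall x, 0 <= b' x) ->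
    (forall x, b' x != 0 -> b x != 0) ->
    chart_integral i a h b' = chart_integral j a' h' b'.
  move=> cb' b'0 bb'; apply/eqP; rewrite eq_le; apply/andP; split.
    by apply: chart_integral_le => // x /bb'/bsupp[].
  by apply: chart_integral_le => // x /bb'/bsupp[].
have parts k c l : chart_integral k c l b =
    (chart_integral k c l (fun x => Num.max (b x) 0)%R -
     chart_integral k c l (fun x => Num.max (- b x) 0)%R)%E.
  rewrite /chart_integral integralE; congr (_ - _)%E; apply: eq_integral => p _.
    rewrite funeposE /= /chart_density -EFin_max; congr EFin.
    by rewrite maxr_pMl// mul0r.
  rewrite funenegE /= /chart_density -EFin_max; congr EFin.
  by rewrite maxr_pMl// mul0r mulNr.
rewrite !parts; congr (_ - _)%E; apply: eq_ge0.
- by move=> x; apply: cvg_maxr; [exact: cb|exact: cvg_cst].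
- by move=> x; rewrite le_max lexx orbT.
- by move=> x; apply: contraNneq => ->; rewrite maxxx.
- by move=> x; apply: cvg_maxr; [apply: cvgN; exact: cb|exact: cvg_cst].
- by move=> x; rewrite le_max lexx orbT.
- by move=> x; apply: contraNneq => ->; rewrite oppr0 maxxx.
Qed.

Lemma chart_integral_gt0 i a h b x : good_square w i a h -> continuous b ->
  (forall x, 0 <= b x) -> opatch i a h x -> 0 < b x -> (0 < chart_integral i a h b)%E.
Proof.
move=> gi cb b0 [ix xa] bx; have [h0 sU _] := gi.
set p := coord i x; have ip : chart_image i p by exact: chart_image_coord.
have dp : 0 < chart_density i b p.
  by rewrite /chart_density /p coordK_at// mulr_gt0// normr_gt0; exact: density_neq.
pose d := chart_density i b p / 2; have d0 : 0 < d by rewrite divr_gt0.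
have nd : nbhs p [set q | `|chart_density i b p - chart_density i b q| < d].
  by move: (chart_density_continuous cb ip) => /cvgr_dist_lt /(_ _ d0).
have [r r0 rP] := (plane_nbhsP p _).1
  (filterI (open_nbhs_nbhs (conj (@open_osquare R a h) xa)) nd).
have r20 : 0 < r / 2 by rewrite divr_gt0.
have sub q : hsquare p (r / 2) q -> osquare a h q /\ d < chart_density i b q.
  move=> /hsquareP[q1 q2].
  have [|//|oq nq] := rP q; try by rewrite ltr_norml; apply/andP; split; lra.
  by split => //; move: nq; rewrite /= ltr_norml /d; lra.
have mh := measurable_hsquare a h; have mr := measurable_hsquare p (r / 2).
apply: (@lt_le_trans _ _ (\int[lebesgue2]_(q in hsquare p (r / 2)) d%:E)%E).
  rewrite integral_cst// lebesgue2_hsquare ?(ltW r20)// -EFinM lte_fin.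
  by rewrite mulr_gt0// exprn_gt0.
apply: (@le_trans _ _ (\int[lebesgue2]_(q in hsquare p (r / 2)) (chart_density i b q)%:E)%E).
  apply: ge0_le_integral => //.
  - by move=> q _; rewrite lee_fin ltW.
  - apply/measurable_EFinP; apply: measurable_funS (chart_density_measurable gi cb) => //.
    move=> q /sub[[/andP[q1 q2] /andP[q3 q4]] _]; apply/hsquareP.
    by split; apply/andP; split => //; exact: ltW.
  - by move=> q /sub[_ /ltW]; rewrite lee_fin.
apply: ge0_subset_integral => //.
- by apply/measurable_EFinP; exact: chart_density_measurable.
- by move=> q _; rewrite lee_fin mulr_ge0.
- move=> q /sub[[/andP[q1 q2] /andP[q3 q4]] _]; apply/hsquareP.
  by split; apply/andP; split => //; exact: ltW.
Qed.

(** On a good square the absolute value of the density is a constant sign times the density, so the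
    integrand is a constant multiple of the Jacobian. As [g] is 0 off the open patch it vanishes on
    the boundary, and [stokes_square] applies. *)
Lemma chart_integral_bracket i a h f g : good_square w i a h -> smooth S f -> C1M S g ->
  (forall x, ~ opatch i a h x -> g x = 0) -> chart_integral i a h (pb f g) = 0%E.
Proof.
move=> gi sf cg g0; have [h0 sU sgn] := gi.
have cf := smooth_C1M sf.
have oU := @open_chart_image _ _ S i.
have cj p : chart_image i p -> {for p, continuous (jac i f g)}.
  by move=> ip; exact: jac_continuous.
have [s sP] : exists s : R, forall p, square a h p -> `|density w i p| = s * density w i p.
  case: sgn => sgn; [exists 1|exists (-1)] => p /sgn dp.
    by rewrite mul1r gtr0_norm.
  by rewrite mulN1r ltr0_norm.
transitivity (\int[lebesgue2]_(p in hsquare a h) ((- s)%:E * (jac i f g p)%:E))%E.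
  apply: eq_integral => p; rewrite inE => /hsquare_square ap; rewrite -EFinM; congr EFin.
  have [ip pK] := chart_imageP (sU p ap).
  rewrite /chart_density sP// mulrCA -[density w i p]/(density w i p) -{2}pK.
  by rewrite -(poisson_bracketE w cf cg ip) pK mulrN mulNr.
rewrite integralZl; last 2 first.
- exact: measurable_hsquare.
- exact: (integrable_hsquare h0 oU sU cj).
rewrite (_ : (\int[lebesgue2]_(p in hsquare a h) (jac i f g p)%:E)%E = 0%E) ?mule0//.
apply: (stokes_square h0 oU sU (cf i) (@smooth_dx _ _ S f i sf) (@smooth_dy _ _ S f i sf) (cg i)).
move=> p ap bd; apply: g0 => -[ip]; rewrite /preimage /= (chart_imageP (sU p ap)).2.
move=> [/andP[p1 p2] /andP[p3 p4]].
case: bd => [nq|[e|e]]; last 2 first.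
- by move: p1; rewrite e ltxx.
- by move: p3; rewrite e ltxx.
by apply: nq; apply/hsquareP; split; apply/andP; split => //; exact: ltW.
Qed.

(* Stokes' theorem for d(g df), localized by a partition of unity. *)
Lemma bracket_ge0_eq0 f g : smooth S f -> C1M S g -> (forall x, 0 <= pb f g x) ->
  forall x, pb f g x = 0.
Proof.
move=> sf cg pb0 x0; have cf := smooth_C1M sf.
have [n [c [a [h [gs cov]]]]] := finite_good_cover hS w.
pose bmp k := bump (c k) (a k) (h k).
have cbmp k : C1M S (bmp k) by apply: (bump_C1M hS (gs k)).
pose tot x := \sum_(k < n) bmp k x.
have ctot : C1M S tot by exact: C1M_sum.
have tot0 x : 0 < tot x.
  have [k xk] := cov x; rewrite /tot (bigD1 k)//= ltr_wpDr//.
    by rewrite sumr_ge0// => l _; exact: bump_ge0.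
  exact: bump_gt0 xk.
pose psi k x := bmp k x * (tot x)^-1.
have cpsi k : C1M S (psi k).
  exact: (C1M_mul (cbmp k) (C1M_inv ctot (fun x => lt0r_neq0 (tot0 x)))).
have psi0 k x : 0 <= psi k x by rewrite mulr_ge0 ?bump_ge0// invr_ge0 ltW.
have psisum x : \sum_(k < n) psi k x = 1.
  by rewrite /psi -mulr_suml -/(tot x) divff// gt_eqF.
have psiout k x : ~ opatch (c k) (a k) (h k) x -> psi k x = 0.
  by move=> nx; rewrite /psi /bmp bump_eq0 ?mul0r//; case: (gs k).
pose G k x := psi k x * g x.
have cG k : C1M S (G k) := C1M_mul (cpsi k) cg.
have Gsum : g = fun x => \sum_(k < n) G k x.
  by apply/funext => x; rewrite /G -mulr_suml psisum mul1r.
(* [{f, g}] is the sum of the brackets [b k = {f, psi k * g}], each supported in one patch and of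
   integral 0 there. *)
pose b k := pb f (G k).
have cb k : continuous (b k) := poisson_bracket_continuous cf (cG k).
have bsum x : pb f g x = \sum_(k < n) b k x.
  transitivity (pb f (fun x => \sum_(k < n) G k x) x); first by rewrite -Gsum.
  exact: poisson_bracket_sum.
have bsupp k x : b k x != 0 -> patch (c k) (a k) (h k) x.
  apply: contra_neqP => nx.
  have oc : open (~` patch (c k) (a k) (h k)).
    by apply: closed_openC; exact: (closed_patch hS (gs k)).
  apply: (poisson_bracket_zero w cf (cG k) (open_nbhs_nbhs (conj oc nx))) => y ny.
  by rewrite /G psiout ?mul0r// => /(opatch_patch (gs k)).
have cpb : continuous (pb f g) by exact: poisson_bracket_continuous.
have cmul (u v : M -> R) : continuous u -> continuous v -> continuous (fun x => u x * v x).
  by move=> cu cv x; apply: cvgM; [exact: cu|exact: cv].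
have cpsi' k : continuous (psi k) by exact: C1M_continuous.
pose I k := chart_integral (c k) (a k) (h k).
have Ib k : I k (b k) = 0%E.
  by apply: (chart_integral_bracket (gs k) sf (cG k)) => x /psiout e; rewrite /G e mul0r.
(* [psi l * b k] is supported in both patches, so it can be integrated in either of the two
   charts. *)
have swap k l : I l (fun x => psi l x * b k x) = I k (fun x => psi l x * b k x).
  apply: (chart_integral_eq (gs l) (gs k) (cmul _ _ (cpsi' l) (cb k))) => x.
  rewrite mulf_eq0 negb_or => /andP[px bx]; split; last exact: bsupp.
  apply: contrapT => nx; move/negP: px; apply; apply/eqP/psiout.
  by move=> /(opatch_patch (gs l)).
(* Expand [{f, g}], move the term of indices [k] and [l] to the patch of [k], and sum over [l]
   first: as the [psi l] add up to 1, what remains is the sum of the integrals of the [b k]. *)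
have tot_eq0 : (\sum_(l < n) I l (fun x => psi l x * pb f g x)%R = 0)%E.
  transitivity (\sum_(l < n) \sum_(k < n) I k (fun x => psi l x * b k x)%R)%E.
    apply: eq_bigr => l _.
    rewrite (_ : (fun x => psi l x * pb f g x)%R = fun x => \sum_(k < n) psi l x * b k x).
      rewrite /I (chart_integral_sum (gs l) (fun k => cmul _ _ (cpsi' l) (cb k))).
      by apply: eq_bigr => k _; exact: swap.
    by apply/funext => x; rewrite bsum mulr_sumr.
  rewrite exchange_big /= big1// => k _.
  rewrite -[RHS](Ib k) /I -(chart_integral_sum (gs k) (fun l => cmul _ _ (cpsi' l) (cb k))).
  by congr chart_integral; apply/funext => x; rewrite -mulr_suml psisum mul1r.
apply/eqP; rewrite eq_le pb0 andbT leNgt; apply/negP => pbx.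
have [k xk] := cov x0.
have I0 l : (0 <= I l (fun x => psi l x * pb f g x)%R)%E.
  by apply: chart_integral_ge0 => x; rewrite mulr_ge0.
have : (0 < I k (fun x => psi k x * pb f g x)%R)%E.
  have pk : 0 < psi k x0 by rewrite mulr_gt0 ?invr_gt0//; exact: bump_gt0 xk.
  apply: (chart_integral_gt0 (x := x0) (gs k)) => //.
  - exact: cmul.
  - by move=> x; rewrite mulr_ge0.
  - exact: mulr_gt0.
have : (I k (fun x => psi k x * pb f g x)%R <= 0)%E.
  by rewrite -tot_eq0 (bigD1 k)//= leeDl// sume_ge0.
by move=> /le_lt_trans /[apply]; rewrite ltxx.
Qed.

End ChartIntegral.

(** * Values with a single preimage *)

Section Degree.
Context {R : realType} {M : topologicalType} {S : smooth_surface R M}.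
Hypothesis hS : closed_surface S.
Variable w : area_form S.
Local Notation pb := (poisson_bracket w).
Implicit Types (x : M) (f g h : M -> R).

Lemma poisson_bracket_mul f g h x : C1M S f -> C1M S g -> C1M S h ->
  pb f (fun x => g x * h x) x = g x * pb f h x + h x * pb f g x.
Proof.
move=> cf cg ch; have [i ix] := @ex_chart _ _ S x.
have ip := chart_image_coord ix.
have E : jac i f (fun x => g x * h x) (coord i x) =
    g x * jac i f h (coord i x) + h x * jac i f g (coord i x).
  rewrite /jac /Defs.jacobian.
  have e v : 'D_v ((fun x => g x * h x) \o param i) (coord i x) =
      g x * 'D_v (h \o param i) (coord i x) + h x * 'D_v (g \o param i) (coord i x).
    have := derive_mul v (cg i) (ch i) ip; rewrite /= coordK_at//; exact.
  have ex := e (1, 0); have ey := e (0, 1); rewrite -!/(dx _ _) in ex; rewrite -!/(dy _ _) in ey.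
  rewrite ex ey; move: (g x) (h x) (dx _ _) (dx _ _) (dx _ _) (dy _ _) (dy _ _) (dy _ _).
  by move=> *; ring.
rewrite (poisson_bracket_quot w cf (C1M_mul cg ch) ix) (poisson_bracket_quot w cf cg ix).
rewrite (poisson_bracket_quot w cf ch ix) E.
move: (g x) (h x) (jac _ _ _ _) (jac _ _ _ _) (density _ _ _)^-1 => *; ring.
Qed.

Lemma poisson_bracket_comp f g (phi dphi : R -> R) x : C1M S f -> C1M S g ->
  (forall t : R, is_derive t 1 phi (dphi t)) -> continuous dphi ->
  pb f (phi \o g) x = dphi (g x) * pb f g x.
Proof.
move=> cf cg dp cdp; have [i ix] := @ex_chart _ _ S x.
have ip := chart_image_coord ix; have [dg _ _] := cg i _ ip.
have E : jac i f (phi \o g) (coord i x) = dphi (g x) * jac i f g (coord i x).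
  rewrite /jac /Defs.jacobian.
  have e v : 'D_v ((phi \o g) \o param i) (coord i x) =
      dphi (g x) * 'D_v (g \o param i) (coord i x).
    have := derive_comp1 (phi := phi) (dphi := dphi) v dg (dp _).
    by rewrite /= coordK_at//; exact.
  have ex := e (1, 0); have ey := e (0, 1); rewrite -!/(dx _ _) in ex; rewrite -!/(dy _ _) in ey.
  rewrite ex ey; move: (dphi _) (dx _ _) (dx _ _) (dy _ _) (dy _ _).
  by move=> *; ring.
rewrite (poisson_bracket_quot w cf (C1M_comp1 cg dp cdp) ix) (poisson_bracket_quot w cf cg ix) E.
move: (dphi _) (jac _ _ _ _) (density _ _ _)^-1 => *; ring.
Qed.

Lemma poisson_bracket_self f x : C1M S f -> pb f f x = 0.
Proof.
move=> cf; have [i ix] := @ex_chart _ _ S x.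
rewrite (poisson_bracket_quot w cf cf ix) /jac /Defs.jacobian.
by rewrite (mulrC (dy _ _)) (subrr (dx _ _ * dy _ _)) oppr0 mul0r.
Qed.

Lemma poisson_bracket_scale f g (c : R) x : C1M S f -> C1M S g ->
  pb f (fun x => c * g x) x = c * pb f g x.
Proof.
move=> cf cg; rewrite (poisson_bracket_mul x cf (C1M_cst c) cg).
have -> : pb f (fun=> c) x = 0; last by rewrite mulr0 addr0.
rewrite -[fun=> c]/((fun _ : R => c) \o f) (@poisson_bracket_comp _ _ _ (fun=> 0))//.
- by rewrite mul0r.
- by move=> t; exact: cst_continuous.
Qed.

Lemma is_derive_sqpos_affine (s b t : R) : s ^+ 2 = 1 ->
  is_derive t 1 (fun t => sqpos (s * t + b)) (s * (2 * Num.max 0 (s * t + b))).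
Proof.
move=> s1; apply: is_derive_of_quadratic_error => h; rewrite /sqpos.
rewrite (_ : s * (h + t) + b = s * h + (s * t + b)); last by ring.
have : (s * h) ^+ 2 = h ^+ 2 by rewrite exprMn s1 mul1r.
rewrite (_ : s * (2 * _) * h = 2 * Num.max 0 (s * t + b) * (s * h)); last by ring.
move: (s * h) (s * t + b) => k u <-.
rewrite ler_norml; case: (leP 0 u) => t0; case: (leP 0 (k + u)) => ht0;
  rewrite ?expr2; apply/andP; split; nra.
Qed.

Let continuous_dsqpos_affine (s b : R) :
  continuous (fun t : R => s * (2 * Num.max 0 (s * t + b))).
Proof.
move=> t; apply: cvgM; first exact: cvg_cst.
apply: cvgM; first exact: cvg_cst.
apply: cvg_maxr; first exact: cvg_cst.
by apply: cvgD; [apply: cvgM; [exact: cvg_cst|exact: cvg_id]|exact: cvg_cst].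
Qed.

Let sq_aff (s b : R) f x := sqpos (s * f x + b).

Let sq_aff_C1M (s b : R) f : s ^+ 2 = 1 -> C1M S f -> C1M S (sq_aff s b f).
Proof.
move=> s1 cf.
exact: (C1M_comp1 cf (fun t => is_derive_sqpos_affine b t s1) (@continuous_dsqpos_affine s b)).
Qed.

Let sq_aff_bracket (s b : R) f g x : s ^+ 2 = 1 -> C1M S f -> C1M S g ->
  pb f (sq_aff s b g) x = s * (2 * Num.max 0 (s * g x + b)) * pb f g x.
Proof.
move=> s1 cf cg.
exact: (poisson_bracket_comp x cf cg (fun t => is_derive_sqpos_affine b t s1)
  (@continuous_dsqpos_affine s b)).
Qed.

(** A hat function of height [2 r] vanishing for [|t| >= r], written as the derivative of the second
    difference [sqpos (t + r) - 2 * sqpos t + sqpos (t - r)], which supplies an explicit C^1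
    primitive. *)
Let tent (t r : R) : R :=
  2 * Num.max 0 (t + r) + (-2 * (2 * Num.max 0 t) + 2 * Num.max 0 (t - r)).

Let tent_ge0 t r : 0 < r -> 0 <= tent t r.
Proof.
move=> r0; rewrite /tent.
by case: (leP 0 (t + r)); case: (leP 0 t); case: (leP 0 (t - r)); lra.
Qed.

Let tent_gt0 r : 0 < r -> 0 < tent 0 r.
Proof.
move=> r0; rewrite /tent add0r sub0r maxxx max_r ?(ltW r0)// max_l ?oppr_le0 ?(ltW r0)//.
lra.
Qed.

Let tent_eq0 t r : 0 < r -> r <= `|t| -> tent t r = 0.
Proof.
move=> r0; rewrite ler_normr /tent => /orP[h|h].
  rewrite !max_r; lra.
rewrite !max_l; lra.
Qed.

(* The degree of [(F, G)] at a regular value with a single preimage would be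
   [+-1]; it is 0 because the 2-form [rho(F, G) dF /\ dG] is exact, here with
   [rho] a bump supported near that value. *)
Lemma single_preimage_critical (F G : M -> R) x0 : smooth S F -> smooth S G ->
  (forall y, F y = F x0 -> G y = G x0 -> y = x0) -> pb F G x0 = 0.
Proof.
move=> sF sG uniq0; apply/eqP/negP => /negP b0.
have cF := smooth_C1M sF; have cG := smooth_C1M sG.
have cFc := C1M_continuous cF; have cGc := C1M_continuous cG.
have cpb : continuous (pb F G) by exact: poisson_bracket_continuous.
pose u := F x0; pose v := G x0; pose b x := Num.sg (pb F G x0) * pb F G x.
have bx0 : 0 < b x0 by rewrite /b -normrEsg normr_gt0.
(* The sum is positive everywhere, since only [x0] has the value [(u, v)] and [b x0 > 0]. Its lower
   bound makes [b] positive on the whole preimage of a neighbourhood of [(u, v)], and not merely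
   near [x0]. *)
have [||e e0 eK] := @compact_pos_lower_bound R M
    (fun y => `|F y - u| + `|G y - v| + Num.max 0 (b y)) hS.1.
- move=> y; apply: cvgD; first apply: cvgD.
  + by apply: cvg_norm; apply: cvgB; [exact: cFc|exact: cvg_cst].
  + by apply: cvg_norm; apply: cvgB; [exact: cGc|exact: cvg_cst].
  + by apply: cvg_maxr; [exact: cvg_cst|apply: cvgM; [exact: cvg_cst|exact: cpb]].
- move=> y; have m0 : 0 <= Num.max 0 (b y) by rewrite le_max lexx.
  have [Fy|Fy] := eqVneq (F y) u; last first.
    by rewrite -addrA ltr_wpDr ?addr_ge0// normr_gt0 subr_eq0.
  have [Gy|Gy] := eqVneq (G y) v; last first.
    by rewrite ltr_wpDr// ltr_wpDl// normr_gt0 subr_eq0.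
  by rewrite Fy Gy !subrr normr0 !add0r (uniq0 _ Fy Gy) lt_max bx0 orbT.
pose r := e / 2; have r0 : 0 < r by rewrite divr_gt0.
have near_b y : `|F y - u| < r -> `|G y - v| < r -> 0 < b y.
  move=> Fy Gy; have := eK y; have [b_le|//] := leP (b y) 0.
  by move: Fy Gy; rewrite /r; lra.
have s1 : (1 : R) ^+ 2 = 1 by rewrite expr1n.
have sN : (-1 : R) ^+ 2 = 1 by rewrite sqrrN expr1n.
(* [rho] is a function of [F], nonzero exactly where [|F - u| < r]; as functions of [G], [p2] is a
   primitive of [tau]. Since [{F, rho} = 0], the bracket of [F] with [rho * p2] is
   [rho * tau * {F, G}]. *)
pose rho x := sq_aff 1 (r - u) F x * sq_aff (-1) (r + u) F x.
pose p2 x := sq_aff 1 (r - v) G x + (-2 * sq_aff 1 (- v) G x + sq_aff 1 (- r - v) G x).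
pose tau x := tent (G x - v) r.
have cA1 := sq_aff_C1M (r - u) s1 cF; have cA2 := sq_aff_C1M (r + u) sN cF.
have cB1 := sq_aff_C1M (r - v) s1 cG; have cB2 := sq_aff_C1M (- v) s1 cG.
have cB3 := sq_aff_C1M (- r - v) s1 cG.
have crho : C1M S rho := C1M_mul cA1 cA2.
have cN2 : C1M S (fun x => -2 * sq_aff 1 (- v) G x) := C1M_mul (C1M_cst _) cB2.
have cp2' : C1M S (fun x => -2 * sq_aff 1 (- v) G x + sq_aff 1 (- r - v) G x) :=
  C1M_add cN2 cB3.
have cp2 : C1M S p2 := C1M_add cB1 cp2'.
have pbrho x : pb F rho x = 0.
  apply: etrans (poisson_bracket_mul x cF cA1 cA2) _.
  rewrite (sq_aff_bracket _ x s1 cF cF) (sq_aff_bracket _ x sN cF cF).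
  by rewrite (poisson_bracket_self x cF) !mulr0 addr0.
have pbp2 x : pb F p2 x = tau x * pb F G x.
  apply: etrans (poisson_bracket_add w x cF cB1 cp2') _.
  rewrite (poisson_bracket_add w x cF cN2 cB3) (poisson_bracket_scale _ x cF cB2).
  rewrite !(sq_aff_bracket _ x s1 cF cG) /tau /tent !mul1r.
  rewrite (_ : G x + (r - v) = G x - v + r); last by ring.
  rewrite (_ : G x + (- r - v) = G x - v - r); last by ring.
  by move: (pb F G x) (Num.max _ _) (Num.max _ _) (Num.max _ _) => *; ring.
pose G' x := Num.sg (pb F G x0) * (rho x * p2 x).
have crp := C1M_mul crho cp2.
have cG' : C1M S G' := C1M_mul (C1M_cst _) crp.
have pbG' x : pb F G' x = rho x * tau x * b x.
  apply: etrans (poisson_bracket_scale _ x cF crp) _.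
  rewrite (poisson_bracket_mul x cF crho cp2) pbrho pbp2 mulr0 addr0 /b.
  by move: (Num.sg _) (rho x) (tau x) (pb F G x) => *; ring.
have rho0 x : 0 <= rho x by rewrite mulr_ge0// sqpos_ge0.
have tau0 x : 0 <= tau x := tent_ge0 _ r0.
have pos x : 0 <= pb F G' x.
  rewrite pbG'; have [Fx|Fx] := ltP `|F x - u| r; last first.
    have -> : rho x = 0.
      rewrite /rho /sq_aff; move: Fx; rewrite ler_normr => /orP[Fx|Fx].
        by rewrite [X in _ * X]sqpos_eq0 ?mulr0//; lra.
      by rewrite sqpos_eq0 ?mul0r//; lra.
    by rewrite !mul0r.
  have [Gx|Gx] := ltP `|G x - v| r; last first.
    have -> : tau x = 0 by exact: tent_eq0.
    by rewrite mulr0 mul0r.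
  by apply: mulr_ge0; [exact: mulr_ge0|exact/ltW/near_b].
have := bracket_ge0_eq0 hS sF cG' pos x0.
have rx : 0 < rho x0 by apply: mulr_gt0; apply: sqpos_gt0; rewrite -/u; lra.
have tx : 0 < tau x0 by rewrite /tau subrr; exact: tent_gt0.
by move/eqP; rewrite pbG' gt_eqF//; apply: mulr_gt0 => //; exact: mulr_gt0.
Qed.

End Degree.

(** * Passage to the limit by Fatou's lemma *)

Section EventualCover.
Local Open Scope ereal_scope.
Context d (X : measurableType d) (R : realType) (mu : {measure set X -> \bar R}).

(** The index from which [Th m v] is at least [r] depends on [v], so a single [Th m] need not
    dominate on all of [A]. The lower limit of the sequence does, and Fatou's lemma bounds its
    integral. *)
Lemma eventual_cover_le (A : set X) (Th : nat -> X -> \bar R) (r : R) (l : \bar R) :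
  measurable A -> (0 <= r)%R -> (forall m, measurable_fun setT (Th m)) ->
  (forall m v, 0 <= Th m v) ->
  (forall v, A v -> exists N, forall m, (N <= m)%N -> r%:E <= Th m v) ->
  (forall e : R, (0 < e)%R -> exists m0, forall m, (m0 <= m)%N ->
    \int[mu]_v Th m v <= l + e%:E) ->
  r%:E * mu A <= l.
Proof.
move=> mA r0 mTh Th0 ATh intTh.
have mThA m : measurable_fun A (Th m) by exact: measurable_funTS.
have liminfE (u : nat -> \bar R) : limn_einf u = ereal_sup (range (einfs u)).
  by rewrite limn_einf_lim; apply: cvg_lim => //; exact: cvg_einfs_sup.
have sub m : \int[mu]_(v in A) Th m v <= \int[mu]_v Th m v.
  by apply: ge0_subset_integral => //; exact: measurableT.
apply: (@le_trans _ _ (\int[mu]_(v in A) limn_einf (Th^~ v))).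
  rewrite -integral_cst//; apply: ge0_le_integral => //.
  - apply: (emeasurable_fun_cvg (fun n v => einfs (Th^~ v) n)).
      by move=> n; exact: measurable_fun_einfs.
    by move=> v _; rewrite liminfE; exact: cvg_einfs_sup.
  - move=> v /ATh[N Nv]; rewrite liminfE; apply: le_ereal_sup_tmp.
    exists (einfs (Th^~ v) N); first by exists N.
    by apply: le_ereal_inf_tmp => _ [m /= Nm <-]; exact: Nv.
apply: le_trans; first exact: (@fatou _ _ _ mu A mA Th mThA (fun m v _ => Th0 m v)).
apply/lee_addgt0Pr => e e0; have [m0 m0P] := intTh e e0.
rewrite liminfE; apply: ge_ereal_sup => _ [n _ <-].
apply: le_trans (m0P (maxn m0 n) (leq_maxl _ _)); apply: le_trans (sub _).
by apply: ereal_inf_lbound; exists (maxn m0 n) => //=; exact: leq_maxr.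
Qed.

End EventualCover.

(** * Majorants in one chart *)

Section ChartCover.
Context {R : realType} {M : topologicalType} {S : smooth_surface R M}.
Variable w : area_form S.
Variables F G : M -> R.
Hypotheses (sF : smooth S F) (sG : smooth S G).
Variable s : R.
Hypothesis s_bound : forall x, `|poisson_bracket w F G x| <= s.
Local Notation RR := (measurableTypeR R * measurableTypeR R)%type.
Implicit Types (i : chart S) (x : M) (a p q : R * R) (h : R).

Let cF : C1M S F. Proof. exact: smooth_C1M. Qed.
Let cG : C1M S G. Proof. exact: smooth_C1M. Qed.

Let jac_bound i p : chart_image i p -> `|jac i F G p| <= s * `|density w i p|.
Proof.
move=> ip; have [dp pK] := chart_imageP ip.
have := poisson_bracketE w cF cG dp; rewrite pK => e.
by rewrite -normrN e normrM ler_wpM2r.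
Qed.

(* Stands in for the complement of [C], the part of a square of one chart that
   squares of other charts cover already: unlike the complement it is closed. *)
Definition away (C : set (R * R)) (e : R) p :=
  forall q, C q -> ~ (`|p.1 - q.1| < e /\ `|p.2 - q.2| < e).

Let away_closed C e p : ~ away C e p -> \forall q \near p, ~ away C e q.
Proof.
move=> /existsNP[z /not_implyP[Cz /contrapT[h1 h2]]].
apply/plane_nbhsP; exists (Num.min (e - `|p.1 - z.1|) (e - `|p.2 - z.2|)).
  by rewrite lt_min !subr_gt0 h1.
move=> q; rewrite !lt_min => /andP[q1 _] /andP[_ q2] /(_ z Cz); apply; split.
  rewrite -(subrK p.1 q.1) -addrA (le_lt_trans (ler_normD _ _))//.
  by rewrite distrC; move: q1; lra.
rewrite -(subrK p.2 q.2) -addrA (le_lt_trans (ler_normD _ _))//.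
by rewrite distrC; move: q2; lra.
Qed.

Let chart_density1 i p : R := `|density w i p|.

Let chart_density1_continuous i p : chart_image i p ->
  {for p, continuous (chart_density1 i)}.
Proof. by move=> ip; have := density_continuous (w := w) ip; exact: cvg_norm. Qed.

(** The sum of two majorants given by [image_cover] with weight 1. [Th1] takes care of the points
    away from [C], where [s] times the absolute density bounds the Jacobian. [Th2] takes care of the
    critical points, where 0 bounds it: it grants them a second unit and costs at most [e h^2]. *)
Lemma chart_image_cover i a h (C : set (R * R)) (e : R) : good_square w i a h -> closed C ->
  0 < e -> exists Th : RR -> \bar R,
  [/\ measurable_fun setT Th, forall v, (0 <= Th v)%E,
    (\int[lebesgue2]_v Th v <=
      s%:E * \int[lebesgue2]_(p in (square a h `\` C : set RR)) `|density w i p|%:E +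
      (2 * e * h ^+ 2)%:E)%E &
    [/\ forall p, square a h p -> away C e p ->
          (1%:E <= Th (F (param i p), G (param i p)))%E,
        forall p q, square a h p -> square a h q -> away C e p -> away C e q ->
          e <= `|p.1 - q.1| + `|p.2 - q.2| ->
          F (param i p) = F (param i q) -> G (param i p) = G (param i q) ->
          (2%:E <= Th (F (param i p), G (param i p)))%E &
        forall p, square a h p -> away C e p -> jac i F G p = 0 ->
          (2%:E <= Th (F (param i p), G (param i p)))%E]].
Proof.
move=> gi cC e0; have [h0 sU _] := gi.
have [x0 _] : exists x : M, True by exists (param i a).
have s0 : 0 <= s by apply: le_trans (s_bound x0).
have oU := @open_chart_image _ _ S i.
have mA : measurable (square a h `\` C : set RR).
  by apply: measurableD; apply: plane_closed_measurable => //; exact: closed_square.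
have mh := measurable_hsquare a h.
have cd0 q : 0 <= chart_density1 i q by exact: normr_ge0.
(* Set to 0 on [C], so that the region covered by other charts is not paid for again. Near a point
   away from [C] it coincides with a continuous function, since [C] is closed. *)
pose phi p : R := if p \in C then 0 else s * chart_density1 i p.
have phi0 p : 0 <= phi p.
  by rewrite /phi; case: ifPn => // _; rewrite mulr_ge0.
have mdens (B : set RR) : measurable B -> B `<=` square a h ->
    measurable_fun B (chart_density1 i : RR -> R).
  move=> mB BQ; apply: (plane_continuous_measurable oU mB) => p.
    by move=> /BQ/sU.
  exact: chart_density1_continuous.
have phiE : phi = (fun p => s * chart_density1 i p * \1_(~` C) p).
  apply/funext => p; rewrite /phi indicE in_setC.
  by case: (p \in C); rewrite /= ?mulr0 ?mulr1.
have mphi : measurable_fun (hsquare a h) (phi : RR -> R).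
  have md1 := mdens _ mh (@hsquare_square R a h).
  rewrite phiE; apply: measurable_funM.
    by apply: measurable_funM; first exact: measurable_cst.
  apply: measurable_funTS; apply: measurable_indic; apply: measurableC.
  exact: plane_closed_measurable.
have phi_cont p : square a h p -> away C e p ->
    {for p, continuous phi} /\ 1 * `|jac i F G p| <= phi p.
  move=> ap Cp.
  have nC : ~ C p by move=> /Cp; apply; rewrite !subrr normr0.
  have oC : open (~` C) by exact: closed_openC.
  split; last by rewrite mul1r /phi memNset//; exact/jac_bound/sU.
  apply: (@continuous_at_of_eq _ _ _ (fun p => s * chart_density1 i p) _ oC nC).
    by move=> q Cq; rewrite /phi memNset.
  apply: continuous_at_mul; first exact: cst_continuous.
  by apply: chart_density1_continuous; exact: sU.
have one_cont (p : R * R) : {for p, continuous (fun _ : R * R => 1 : R)} /\ 0 <= 1 :> R.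
  by split => //; exact: cst_continuous.
have [Th1 [mT1 T10 c1 c12] i1] := image_cover (phi := phi) (K := away C e)
  (m := fun=> 1) h0 e0 e0 (fun p _ => @away_closed C e p) oU
  (fun p Kp => sU p Kp.2) (@cF i) (@cG i) (fun p _ _ => one_cont p) mphi
  (fun p _ => phi0 p) phi_cont.
pose crit : set (R * R) := [set p | jac i F G p = 0].
have crit_closed p : square a h p -> ~ crit p -> \forall q \near p, ~ crit q.
  move=> ap nz; have cj := jac_continuous cF cG (sU p ap).
  have e1 : 0 < `|jac i F G p| by rewrite normr_gt0; apply/eqP.
  have n1 : nbhs p [set q | `|jac i F G p - jac i F G q| < `|jac i F G p|].
    by move: cj => /cvgr_dist_lt /(_ _ e1).
  apply: filterS n1 => q /= + jq; rewrite jq subr0 ltxx.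
  by [].
have zero_cont (p : R * R) : crit p ->
    {for p, continuous (fun _ : R * R => 0 : R)} /\ 1 * `|jac i F G p| <= 0.
  by move=> ->; split; [exact: cst_continuous|rewrite normr0 mulr0].
have [Th2 [mT2 T20 c2 _] i2] := image_cover (phi := fun=> 0) (K := crit)
  (m := fun=> 1) h0 e0 e0 crit_closed oU
  (fun p Kp => sU p Kp.2) (@cF i) (@cG i) (fun p _ _ => one_cont p)
  (measurable_cst _) (fun p _ => lexx 0) (fun p _ => zero_cont p).
exists (fun v => Th1 v + Th2 v)%E; split.
- exact: emeasurable_funD.
- by move=> v; rewrite adde_ge0.
- rewrite ge0_integralD//.
  have l2 : lebesgue2 (hsquare a h) = (h ^+ 2)%:E by rewrite lebesgue2_hsquare// ltW.
  apply: le_trans (leeD i1 i2) _.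
  have -> : (\int[lebesgue2]_(p in hsquare a h) (0 + e)%:E = (e * h ^+ 2)%:E)%E.
    by rewrite integral_cst// l2 add0r -EFinM.
  have -> : (\int[lebesgue2]_(p in hsquare a h) (phi p + e)%:E =
      \int[lebesgue2]_(p in hsquare a h) (phi p)%:E + (e * h ^+ 2)%:E)%E.
    have -> : (\int[lebesgue2]_(p in hsquare a h) (phi p + e)%:E =
        \int[lebesgue2]_(p in hsquare a h) ((phi p)%:E + e%:E))%E by [].
    rewrite ge0_integralD//; last 3 first.
    + by move=> p _; rewrite lee_fin.
    + exact/measurable_EFinP.
    + by move=> p _; rewrite lee_fin ltW.
    by rewrite integral_cst// l2 -EFinM.
  rewrite -addeA -EFinD (_ : e * h ^+ 2 + e * h ^+ 2 = 2 * e * h ^+ 2); last by ring.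
  apply: leeD => //.
  rewrite -ge0_integralZl//; last first.
    by apply/measurable_EFinP; apply: (mdens _ mA) => p [].
  rewrite [leLHS]integral_mkcond [leRHS]integral_mkcond.
  apply: ge0_le_integral.
  + exact: measurableT.
  + by move=> q _; apply: erestrict_ge0 => {}q _; rewrite lee_fin.
  + by apply/(measurable_restrictT _ mh); exact/measurable_EFinP.
  + apply/(measurable_restrictT _ mA); apply: measurable_funeM.
    by apply/measurable_EFinP; apply: (mdens _ mA) => p [].
  + move=> q _; rewrite !patchE; have [qh|qh] := boolP (q \in hsquare a h).
      have [qC|qC] := boolP (q \in C).
        rewrite /phi qC; case: ifPn => // _.
        by rewrite -EFinM lee_fin mulr_ge0.
      rewrite mem_set; last first.
        split; first by move: qh; rewrite inE => /hsquare_square.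
        by move: qC; rewrite notin_setE.
      by rewrite /phi (negbTE qC) -EFinM.
    by case: ifPn => // _; rewrite -EFinM lee_fin mulr_ge0.
- split.
  + move=> p ap Cp; apply: (le_trans (c1 p ap Cp)); exact: leeDl.
  + move=> p q ap aq Cp Cq dpq Fpq Gpq.
    by apply: (le_trans (c12 p q ap aq Cp Cq Fpq Gpq dpq)); exact: leeDl.
  + move=> p ap Cp jp; apply: (leeD (c1 p ap Cp) (c2 p ap jp)).
Qed.

End ChartCover.

(** * Area of a set of values, counted twice *)

Section AreaLowerBound.
Context {R : realType} {M : topologicalType} {S : smooth_surface R M}.
Hypothesis hS : closed_surface S.
Variable w : area_form S.
Local Notation RR := (measurableTypeR R * measurableTypeR R)%type.

Lemma eventually_inv_lt (r : R) : 0 < r -> exists N, forall m, (N <= m)%N ->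
  m.+1%:R^-1 < r.
Proof.
move=> r0; have [N _ NP] := near_infty_natSinv_lt (PosNum r0).
by exists N => m Nm; exact: NP.
Qed.

Section Partition.
Variables (n : nat) (c : 'I_n -> chart S) (a : 'I_n -> R * R) (h : 'I_n -> R).
Hypothesis gs : forall k, good_square w (c k) (a k) (h k).
Hypothesis cov : forall x, exists k, opatch (c k) (a k) (h k) x.

(** The part of a square that patches of smaller index cover already. Removing it makes the pieces
    [fresh] disjoint; and as it is closed, each remaining point is at positive distance from it,
    hence satisfies [away] for a small enough distance. *)
Definition overlap k : set (R * R) := square (a k) (h k) `&`
  [set p | exists2 j : 'I_n, (j < k)%N & patch (c j) (a j) (h j) (param (c k) p)].

Definition fresh k : set M := patch (c k) (a k) (h k) `\`
  [set x | exists2 j : 'I_n, (j < k)%N & patch (c j) (a j) (h j) x].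

Lemma closed_overlap k : closed (overlap k).
Proof.
pose P : set M := [set x | exists2 j : 'I_n, (j < k)%N & patch (c j) (a j) (h j) x].
have cP : closed P.
  have -> : P = \bigcup_(j in [set j : 'I_n | (j < k)%N]) patch (c j) (a j) (h j).
    by apply/seteqP; split=> x [j jk xj]; exists j.
  by apply: closed_bigcup => [|j _]; [exact: finite_finset|exact: (closed_patch hS (gs j))].
rewrite -[overlap k]setCK; apply: open_closedC; rewrite openE => p np.
have [ap|ap] := pselect (square (a k) (h k) p); last first.
  apply: (filterS (P := ~` square (a k) (h k))); first by move=> q nq [].
  by apply: open_nbhs_nbhs; split => //; apply: closed_openC; exact: closed_square.
have [_ sU _] := gs k.
have := closed_openC cP; rewrite openE => /(_ (param (c k) p)).
move=> /(_ (fun H => np (conj ap H))) n1.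
have n2 : nbhs p (param (c k) @^-1` ~` P) := param_continuous_at (sU p ap) n1.
by apply: (filterS _ n2) => q nq [_].
Qed.

Lemma coord_fresh k : Defs.coord (c k) @` fresh k = square (a k) (h k) `\` overlap k.
Proof.
have [_ sU _] := gs k.
apply/seteqP; split=> [_ [x [xk nx] <-]|p [ap np]].
  have [dx sx] := (patchP x (gs k)).1 xk; split => // -[_] /=.
  by rewrite (coordK_at dx).
have [dp pK] := chart_imageP (sU p ap).
exists (param (c k) p) => //; split; first by exists p.
by move=> H; apply: np.
Qed.

Lemma ex_fresh x : exists k, fresh k x.
Proof.
have [k0 /(opatch_patch (gs k0)) k0x] := cov x.
have P0 : `[<patch (c k0) (a k0) (h k0) x>] by apply/asboolP.
have [k /asboolP kx kmin] :=
  @arg_minnP _ k0 (fun k => `[<patch (c k) (a k) (h k) x>]) (fun k => k : nat) P0.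
exists k; split => // -[j jk jx].
by have := kmin j (asboolT jx); rewrite leqNgt jk.
Qed.

Lemma freshP k x : fresh k x ->
  [/\ dom (c k) x, square (a k) (h k) (Defs.coord (c k) x) &
    ~ overlap k (Defs.coord (c k) x)].
Proof.
move=> kx; have [dx _] := (patchP x (gs k)).1 kx.1.
have : (Defs.coord (c k) @` fresh k) (Defs.coord (c k) x) by exists x.
by rewrite coord_fresh => -[].
Qed.

Lemma measurable_fresh k :
  measurable (square (a k) (h k) `\` overlap k : set RR).
Proof.
apply: measurableD; apply: plane_closed_measurable.
  exact: closed_square.
exact: closed_overlap.
Qed.

Lemma chart_partition_fresh : chart_partition c fresh.
Proof.
split.
- by move=> k x /freshP[].
- by move=> k; rewrite coord_fresh; exact: measurable_fresh.
- move=> j k _ _ [x [[xj nj] [xk nk]]]; have [jk|kj|/ord_inj//] := ltngtP j k.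
    by exfalso; apply: nk; exists j.
  by exfalso; apply: nj; exists k.
- by apply/seteqP; split=> // x _; have [k kx] := ex_fresh x; exists k.
Qed.

End Partition.

Variables F G : M -> R.
Hypotheses (sF : smooth S F) (sG : smooth S G).
Variable s : R.
Hypotheses (s0 : 0 <= s) (s_bound : forall x, `|poisson_bracket w F G x| <= s).

(** For [v] in [T] with preimage [x], the sum of the majorants eventually reaches 2 in each of three
    cases: a second preimage in another piece, a second preimage in the same piece, or no second
    preimage, when [x] is critical by [single_preimage_critical]. *)
Lemma area_lower_bound (T : set RR) : measurable T ->
  (forall v, T v -> exists x, F x = v.1 /\ G x = v.2) ->
  (2%:E * lebesgue2 T <= s%:E * area w)%E.
Proof.
move=> mT TP.
have [n [c [a [h [gs cov]]]]] := finite_good_cover hS w.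
pose I k := (\int[lebesgue2]_(p in (square (a k) (h k) `\` overlap c a h k : set RR))
  `|density w (c k) p|%:E)%E.
have I0 k : (0 <= I k)%E by apply: integral_ge0 => p _; rewrite lee_fin.
have IA : (\sum_(k < n) I k <= area w)%E.
  apply: ereal_sup_ubound; exists n, c, (fresh c a h); split.
    exact: chart_partition_fresh gs cov.
  by apply: eq_bigr => k _; rewrite coord_fresh.
apply: (le_trans _ (lee_wpmul2l _ IA)); last by rewrite lee_fin.
have e0 m : 0 < (m.+1%:R^-1 : R) by rewrite invr_gt0.
pose H k m := cid (chart_image_cover sF sG s_bound (gs k)
  (closed_overlap gs (k := k)) (e0 m)).
pose Th k m := sval (H k m).
have ThP k m := svalP (H k m); rewrite -/(Th _ _) in ThP.
have mTh k m : measurable_fun setT (Th k m) by case: (ThP k m).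
have Th0 k m v : (0 <= Th k m v)%E by have [_ T0 _ _] := ThP k m; exact: T0.
have Th1 k m v : (Th k m v <= \sum_(k < n) Th k m v)%E.
  by rewrite (bigD1 k)//= leeDl// sume_ge0.
apply: (@eventual_cover_le _ _ _ _ T (fun m v => \sum_(k < n) Th k m v)%E) => //.
- by move=> m; exact: emeasurable_fun_sum.
- by move=> m v; exact: sume_ge0.
- move=> v /TP[x [Fx Gx]].
  (* The separation [1 / (m + 1)] eventually falls below the distance from the point to the closed
     overlap. *)
  have awayP y k : fresh c a h k y -> exists N, forall m, (N <= m)%N ->
      away (overlap c a h k) m.+1%:R^-1 (Defs.coord (c k) y).
    move=> /(freshP gs)[_ _ ny].
    have nb := open_nbhs_nbhs (conj (closed_openC (closed_overlap gs (k := k))) ny).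
    have [r r0 rP] := (plane_nbhsP _ _).1 nb.
    have [N NP] := eventually_inv_lt r0.
    exists N => m /NP mr q Cq [q1 q2]; apply: (rP q) => //.
      exact: lt_trans mr.
    exact: lt_trans mr.
  have [k kx] := ex_fresh gs cov x; have [dx sx nx] := freshP gs kx.
  have [N1 N1P] := awayP x k kx; have xK := coordK_at dx.
  have [[y [yx Fy Gy]]|uniq_x] := pselect (exists y, [/\ y <> x, F y = F x & G y = G x]).
    have [l ly] := ex_fresh gs cov y; have [dy sy ny] := freshP gs ly.
    have [N2 N2P] := awayP y l ly; have yK := coordK_at dy.
    have [lk|lk] := eqVneq l k; last first.
      exists (maxn N1 N2) => m; rewrite geq_max => /andP[m1 m2].
      have t1 : (1 <= Th k m v)%E.
        have [_ _ _ [H1 _ _]] := ThP k m.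
        by have := H1 _ sx (N1P m m1); rewrite xK Fx Gx -surjective_pairing.
      have t2 : (1 <= Th l m v)%E.
        have [_ _ _ [H1 _ _]] := ThP l m.
        by have := H1 _ sy (N2P m m2); rewrite yK Fy Gy Fx Gx -surjective_pairing.
      rewrite (bigD1 k)//= (bigD1 l)//=.
      apply: (@le_trans _ _ (1 + (1 + 0))%E); first by rewrite adde0 -EFinD.
      by apply: leeD => //; apply: leeD => //; exact: sume_ge0.
    subst l.
    (* Both preimages in one piece: the chart is injective there, so their coordinates differ, and
       eventually by more than [1 / (m + 1)]. *)
    pose p := Defs.coord (c k) x; pose q := Defs.coord (c k) y.
    have d0 : 0 < `|p.1 - q.1| + `|p.2 - q.2|.
      rewrite lt_neqAle addr_ge0// andbT eq_sym; apply/eqP => d0.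
      apply: yx; rewrite -xK -yK; congr (param _ _).
      have p1 : `|p.1 - q.1| = 0.
        by move: d0 (normr_ge0 (p.1 - q.1)) (normr_ge0 (p.2 - q.2)); lra.
      have p2 : `|p.2 - q.2| = 0.
        by move: d0 (normr_ge0 (p.1 - q.1)) (normr_ge0 (p.2 - q.2)); lra.
      move/normr0_eq0/subr0_eq: p1; move/normr0_eq0/subr0_eq: p2.
      by rewrite /p /q => e2 e1; apply/pair_eqP; apply/andP; split; apply/eqP.
    have [N3 N3P] := eventually_inv_lt d0.
    exists (maxn (maxn N1 N2) N3) => m; rewrite !geq_max => /andP[/andP[m1 m2] m3].
    apply: le_trans (Th1 k m v).
    have [_ _ _ [_ H2 _]] := ThP k m.
    have := H2 p q sx sy (N1P m m1) (N2P m m2) (ltW (N3P m m3)).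
    by rewrite xK yK Fy Gy Fx Gx -surjective_pairing; apply.
  have pb0 : poisson_bracket w F G x = 0.
    apply: single_preimage_critical => // y Fy Gy.
    by apply: contrapT => yx; apply: uniq_x; exists y.
  exists N1 => m m1; apply: le_trans (Th1 k m v).
  have [_ _ _ [_ _ H3]] := ThP k m.
  have := H3 _ sx (N1P m m1); rewrite xK Fx Gx -surjective_pairing; apply.
  have cF : C1M S F by exact: smooth_C1M.
  have cG : C1M S G by exact: smooth_C1M.
  have := poisson_bracketE w cF cG dx; rewrite pb0 mul0r => /eqP.
  by rewrite oppr_eq0 => /eqP.
- move=> e epos.
  (* The errors of all charts add up to [K / (m + 1)]; dividing [e] by [K + 1] covers the case
     [K = 0]. *)
  pose K := \sum_(k < n) 2 * h k ^+ 2.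
  have K0 : 0 <= K by apply: sumr_ge0 => k _; rewrite mulr_ge0// sqr_ge0.
  have eK : 0 < e / (K + 1) by rewrite divr_gt0// ltr_wpDl.
  have [N NP] := eventually_inv_lt eK.
  exists N => m /NP; rewrite ltr_pdivlMr ?ltr_wpDl// => mK.
  rewrite ge0_integral_sum//.
  apply: (@le_trans _ _ (\sum_(k < n) (s%:E * I k +
      (2 * m.+1%:R^-1 * h k ^+ 2)%:E))%E).
    by apply: lee_sum => k _; case: (ThP k m).
  rewrite big_split /= ge0_sume_distrr//; apply: leeD => //.
  rewrite sumEFin lee_fin.
  have -> : \sum_(k < n) 2 * m.+1%:R^-1 * h k ^+ 2 = m.+1%:R^-1 * K.
    rewrite mulr_sumr; apply: eq_bigr => k _.
    by move: (h k ^+ 2) (m.+1%:R^-1) => u t; ring.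
  move: mK (e0 m); set t := _^-1 => mK t0; apply: le_trans (ltW mK).
  by rewrite ler_wpM2l ?ltW// ltrDl.
Qed.

End AreaLowerBound.

(** * Area of the triangle *)

Section Triangle.
Context {R : realType}.
Local Notation RR := (measurableTypeR R * measurableTypeR R)%type.

(** Fubini and the fundamental theorem of calculus, [dg] being a lower bound for the lengths of the
    vertical sections. *)
Lemma lebesgue2_ge_sections (T : set RR) (g dg : R -> R) (x h : R) :
  measurable T -> 0 < h ->
  (forall t : R, is_derive t 1 g (dg t)) -> continuous dg ->
  (forall t, x < t < x + h -> 0 <= dg t /\
    ((dg t)%:E <= lebesgue_measure (xsection T t : set (measurableTypeR R)))%E) ->
  ((g (x + h) - g x)%:E <= lebesgue2 T)%E.
Proof.
move=> mT h0 gd cd dgT.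
have mdg (A : set (measurableTypeR R)) : measurable_fun A (fun t => (dg t)%:E).
  by apply/measurable_EFinP; apply: measurable_funTS; exact: continuous_measurable_fun.
rewrite EFinB -(FTC2_half_open (dG := dg) h0); last by move=> t _; split; [exact: gd|exact: cd].
rewrite -(@integral_itv_obnd_cbnd R x (BLeft (x + h)))//.
rewrite lebesgue2_xsection.
have mX : measurable_fun setT
    (fun t : measurableTypeR R => lebesgue_measure (xsection T t : set (measurableTypeR R))).
  exact: measurable_fun_xsection.
apply: (@le_trans _ _ (\int[lebesgue_measure]_(t in `]x, (x + h)%R[)
    lebesgue_measure (xsection T t : set (measurableTypeR R)))%E).
  apply: ge0_le_integral => //.
  - by move=> t; rewrite /= in_itv /= => /dgT[]; rewrite lee_fin.
  - exact: measurable_funTS.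
  - by move=> t; rewrite /= in_itv /= => /dgT[].
  by apply: ge0_subset_integral => //; exact: measurableT.
exact: mdg.
Qed.

(** [sg] stands for the sign of [a + b - c], which decides the side of each line on which the
    triangle lies: the three quantities add up to [sg * (a + b - c)]. *)
Definition triangle (sg a b c : R) : set (R * R) :=
  [set v | [/\ 0 < sg * (a - v.1), 0 < sg * (b - v.2) & 0 < sg * (v.1 + v.2 - c)]].

Lemma open_triangle sg a b c : open (triangle sg a b c).
Proof.
have op (f : R * R -> R) : continuous f -> open [set v | 0 < f v].
  move=> cf; have -> : [set v | 0 < f v] = f @^-1` [set y | 0 < y] by [].
  by apply: open_comp; [move=> v _; exact: cf|exact: open_gt].
have -> : triangle sg a b c = [set v | 0 < sg * (a - v.1)] `&`
    ([set v | 0 < sg * (b - v.2)] `&` [set v | 0 < sg * (v.1 + v.2 - c)]).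
  by apply/seteqP; split=> v [] //= ? []; split.
have c1 : continuous (fst : R * R -> R) by move=> v; exact: cvg_fst.
have c2 : continuous (snd : R * R -> R) by move=> v; exact: cvg_snd.
apply: openI; [|apply: openI]; apply: op => v; apply: cvgM; (try exact: cvg_cst).
- by apply: cvgB; [exact: cvg_cst|exact: c1].
- by apply: cvgB; [exact: cvg_cst|exact: c2].
- by apply: cvgB; [apply: cvgD; [exact: c1|exact: c2]|exact: cvg_cst].
Qed.

(** A right isosceles triangle with legs [d = |a + b - c|], whose section over [t] has length
    [d - sg * (a - t)]. *)
Lemma lebesgue2_triangle_ge (sg a b c : R) : sg = 1 \/ sg = -1 ->
  0 < sg * (a + b - c) ->
  (((a + b - c) ^+ 2)%:E <= 2%:E * lebesgue2 (triangle sg a b c : set RR))%E.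
Proof.
move=> sg1; set d := sg * (a + b - c) => d0.
(* Left end of the projection to the first axis, which is []a - d, a[] or []a, a + d[] according to
   [sg]; [g] is a primitive of the length of the sections. *)
pose x0 := if sg == 1 then a - d else a.
pose g t := d * t + sg / 2 * (a - t) ^+ 2.
have n1 : (-1 == 1 :> R) = false by rewrite lt_eqF//; lra.
have sg2 : sg * sg = 1 by case: sg1 => ->; rewrite ?mulr1 ?mulrNN ?mulr1.
have gE : g (x0 + d) - g x0 = (a + b - c) ^+ 2 / 2.
  have -> : (a + b - c) ^+ 2 = d ^+ 2.
    by rewrite /d exprMn (expr2 sg) sg2 mul1r.
  rewrite /g /x0; case: sg1 => ->; first by rewrite eqxx; field.
  by rewrite n1; field.
have mT : measurable (triangle sg a b c : set RR).
  by apply: plane_open_measurable; exact: open_triangle.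
have : ((g (x0 + d) - g x0)%:E <= lebesgue2 (triangle sg a b c : set RR))%E.
  apply: (@lebesgue2_ge_sections _ g (fun t => d - sg * (a - t))) => //.
  - move=> t; rewrite /g.
    have h1 : is_derive t 1 (fun t : R => a - t) (0 - 1) by apply: is_deriveB.
    have h2 := is_deriveX 2 h1.
    have h3 : is_derive t 1 (fun t : R => d * t) (d *: 1) by apply: is_deriveZ.
    have h4 := is_deriveZ (sg / 2) h2.
    refine (is_derive_eq (is_deriveD h3 h4) _).
    by rewrite /GRing.scale /= expr1; field.
  - move=> t; apply: cvgB; first exact: cvg_cst.
    apply: cvgM; first exact: cvg_cst.
    by apply: cvgB; [exact: cvg_cst|exact: cvg_id].
  - move=> t xt.
    have [ta tpos] : 0 < sg * (a - t) /\ 0 < d - sg * (a - t).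
      move: xt; rewrite /x0; case: sg1 => ->; first by rewrite eqxx => /andP[]; split; lra.
      by rewrite n1 => /andP[]; split; lra.
    split; first exact: ltW.
    (* The section lies between [c - t] and [b], and the order of these two depends on [sg]. *)
    pose u := Num.min (c - t) b; pose v := Num.max (c - t) b.
    have uv : v - u = d - sg * (a - t).
      rewrite /u /v /d; move: tpos; rewrite /d; case: sg1 => -> tp.
        by rewrite min_l ?max_r; lra.
      by rewrite min_r ?max_l; lra.
    have -> : (d - sg * (a - t))%:E = lebesgue_measure (`]u, v[%classic : set R).
      by rewrite lebesgue_measure_itv /= lte_fin ifT -?EFinB ?uv//; lra.
    apply: le_measure; rewrite ?inE.
    + exact: measurable_itv.
    + exact: measurable_xsection.
    + move=> y; rewrite /= in_itv /= => /andP[uy yv].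
      apply: set_mem; rewrite mem_xsection; apply: mem_set; split => //=.
        move: uy yv tpos; rewrite /u /v /d; case: sg1 => ->.
          by move=> _; rewrite lt_max => /orP[]; lra.
        by rewrite gt_min => /orP[]; lra.
      move: uy yv tpos; rewrite /u /v /d; case: sg1 => ->.
        by rewrite gt_min => /orP[]; lra.
      by move=> _; rewrite lt_max => /orP[]; lra.
move=> H; have : (2%:E * (g (x0 + d) - g x0)%:E <=
    2%:E * lebesgue2 (triangle sg a b c : set RR))%E.
  by apply: lee_wpmul2l => //; rewrite lee_fin.
by rewrite gE -EFinM mulrC divfK.
Qed.

End Triangle.

(** * From the area of the triangle to the inequality for quasi-states *)

Theorem theorem1p4 (R : realType) (M : topologicalType)
    (S : smooth_surface R M) (hS : closed_surface S) (w : area_form S)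
    (zeta : (M -> R) -> R) (hzeta : simple_quasi_state zeta)
    (F G : M -> R) (hF : smooth S F) (hG : smooth S G) :
  ((`|zeta (fun x => F x + G x) - zeta F - zeta G| ^+ 2)%:E
    <= area w * sup_norm (poisson_bracket w F G))%E.
Proof.
(* On the empty space the constants 0 and 1 coincide, whereas [zeta] separates them. *)
have [x0 _] : exists x : M, True.
  apply: contrapT => noM.
  have c0 : continuous (fun _ : M => 0 : R) by exact: cst_continuous.
  have := zeta_affine hzeta 0 0 c0.
  rewrite (_ : (fun _ => _) = (fun=> 1)); last by apply/funext => x; case: noM; exists x.
  by case: hzeta => -[_ _ ->] _; rewrite mul0r addr0 => /eqP; rewrite oner_eq0.
have cF := C1M_continuous (smooth_C1M hF); have cG := C1M_continuous (smooth_C1M hG).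
have cFG : continuous (fun x => F x + G x).
  by move=> x; apply: cvgD; [exact: cF|exact: cG].
have [cM _] := hS.
(* The supremum norm is attained, which provides a real bound [s] for the bracket that does not
   exceed the norm. *)
have [z _ zmax] : exists2 z, z \in [set: M] & forall t, t \in [set: M] ->
    `|poisson_bracket w F G t| <= `|poisson_bracket w F G z|.
  apply: compact_EVT_max => //; first by exists x0.
  apply: continuous_subspaceT => x; apply: cvg_norm.
  exact: (poisson_bracket_continuous (smooth_C1M hF) (smooth_C1M hG)).
pose s := `|poisson_bracket w F G z|.
have s_bound x : `|poisson_bracket w F G x| <= s by apply: zmax; rewrite inE.
have s0 : 0 <= s by exact: normr_ge0.
(* The lower bound for the empty set of values, used with the bound [s + 1], which is positive and
   can be cancelled. *)
have area0 : (0 <= area w)%E.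
  have s1 : 0 < s + 1 by rewrite ltr_wpDl.
  have sb x : `|poisson_bracket w F G x| <= s + 1.
    by apply: le_trans (s_bound x) _; rewrite lerDl.
  have := area_lower_bound hS hF hG (ltW s1) sb (@measurable0 _ _) (fun v => False_ind _).
  by rewrite measure0 mule0 pmule_rge0.
set a := zeta F; set b := zeta G; set c := zeta _.
have main sg : sg = 1 \/ sg = -1 -> 0 < sg * (a + b - c) ->
    (((a + b - c) ^+ 2)%:E <= area w * sup_norm (poisson_bracket w F G))%E.
  move=> sg1 d0; apply: le_trans (lebesgue2_triangle_ge sg1 d0) _.
  apply: (@le_trans _ _ (s%:E * area w)%E).
    apply: (area_lower_bound hS hF hG s0 s_bound).
      by apply: plane_open_measurable; exact: open_triangle.
    move=> v [va vb vc].
    have aff (H : M -> R) (k l : R) : continuous H ->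
        continuous (fun x => k * H x + l).
      move=> cH x; apply: cvgD; last exact: cvg_cst.
      by apply: cvgM; [exact: cvg_cst|exact: cH].
    have sgI (y u : R) : sg * y + - (sg * u) = 0 -> y = u.
      by case: sg1 => ->; lra.
    have [x||||x [/sgI xF /sgI xG]] := zeta_balanced cM hzeta
      (aff F sg (- (sg * v.1)) cF) (aff G sg (- (sg * v.2)) cG)
      (aff _ (- sg) (sg * (v.1 + v.2)) cFG); last by exists x.
    - by move: (F x) (G x) => f g; ring.
    - by rewrite (zeta_affine hzeta _ _ cF) -/a; move: va; rewrite mulrBr.
    - by rewrite (zeta_affine hzeta _ _ cG) -/b; move: vb; rewrite mulrBr.
    - rewrite (zeta_affine hzeta _ _ cFG) -/c; move: vc.
      by rewrite mulrBr mulNr addrC.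
  rewrite muleC; apply: lee_wpmul2l => //.
  by apply: ereal_sup_ubound; exists z.
have -> : `|c - a - b| ^+ 2 = (a + b - c) ^+ 2.
  by rewrite real_normK ?num_real//; move: a b c {main} => a b c; ring.
(* In the degenerate case [a + b = c] the triangle is empty, and only the sign of the right-hand
   side is at stake. *)
have [ab|ab|ab] := ltrgtP 0 (a + b - c).
- by apply: (main 1); [left|rewrite mul1r].
- by apply: (main (-1)); [right|rewrite mulN1r oppr_gt0].
- rewrite -ab expr0n /= mule_ge0//; apply: le_trans (_ : s%:E <= _)%E.
    by rewrite lee_fin.
  by apply: ereal_sup_ubound; exists z.
Qed.
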